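(* Let $\mathcal{P}=(P,d\mu,d\sigma)$ be an $n$-dimensional system with $n\ge2$. (1) For every $T>0$ there exists a unique $u^{\mathrm{can}}_T\in\mathcal{M}^1(P)$ minimizing $F_{\mathcal{P}}(T,\cdot)$ on $\mathcal{M}^1(P)$, and it lies in $\mathcal{M}^{\frac{n}{n-1}}(P)$. (2) For $T=0$ there exists a unique $u^{\mathrm{can}}_0\in\mathcal{M}^{1}(P)$ such that $u^{\mathrm{can}}_0$ minimizes $U_{\mathcal{P}}$ on $\mathcal{M}^1(P)$ and $S_{\mathcal{P}}(u^{\mathrm{can}}_0)=\max\{S_{\mathcal{P}}(u): u\in\mathcal{M}^1(P),\ U_{\mathcal{P}}(u)=\min U_{\mathcal{P}}\}$; moreover $u^{\mathrm{can}}_0\in\mathcal{M}^{\frac{n}{n-1}}(P)$.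
   Context: An $n$-dimensional system is a triple $\mathcal{P}=(P,d\mu,d\sigma)$ where $P$ is a simple polytope in an $n$-dimensional real affine space $V$ (a compact subset with non-empty interior that is a finite intersection of closed half spaces, such that every vertex is the intersection of exactly $n$ facets), $d\mu$ is the restriction to $P$ of a translation-invariant measure on $V$ that is positive and finite on bounded non-empty open sets (i.e. a positive multiple of Lebesgue measure), and $d\sigma$ is a measure on the boundary $\partial P$ whose restriction to each facet is a positive multiple of the Lebesgue measure of the affine hyperplane spanned by that facet. For $p\ge1$, $\mathcal{M}^p(P)$ is the set of lower semicontinuous functions $u:P\to(0,\infty]$ that are log-convex ($u((1-t)x+ty)\le u(x)^{1-t}u(y)^t$ for $x,y\in P$, $t\in[0,1]$) and satisfy $\int_P u\,d\mu=\int_P d\mu$ and $\int_P u^p\,d\mu<\infty$. For $u\in\mathcal{M}^1(P)$: entropy $S_{\mathcal{P}}(u):=-\frac{1}{\int_Pd\mu}\int_P u\log u\,d\mu\in[-\infty,0]$; internal $\mu$-energy $U_{\mathcal{P}}(u):=\frac{1}{\int_Pd\mu}\int_{\partial P}u\,d\sigma\in(0,\infty]$; and for $T\in\mathbb{R}$, free $\mu$-energy $F_{\mathcal{P}}(T,u):=U_{\mathcal{P}}(u)-TS_{\mathcal{P}}(u)$ if $S_{\mathcal{P}}(u)>-\infty$, and $F_{\mathcal{P}}(T,u):=+\infty$ if $S_{\mathcal{P}}(u)=-\infty$. *)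

(* Defs.v *)
From HB Require Import structures.
From mathcomp Require Import all_boot all_order all_algebra.
From mathcomp Require Import all_classical all_reals all_analysis.
Set Implicit Arguments. Unset Strict Implicit. Unset Printing Implicit Defensive.
Import Order.TTheory GRing.Theory Num.Theory.
Import numFieldNormedType.Exports.
Local Open Scope classical_set_scope.
Local Open Scope ring_scope.

Section Defs.
Variables (R : realType) (n : nat).
Local Notation V := 'rV[R]_n.

Definition dotp (a x : V) : R := \sum_(j < n) a ord0 j * x ord0 j.

Definition BorelV : Type := g_sigma_algebraType (@open V).

Definition translate (A : set V) (v : V) : set V := [set x + v | x in A].

Definition is_polyhedron (P : set V) : Prop :=
  exists (m : nat) (a : 'I_m -> V) (b : 'I_m -> R),
    P = [set x | forall i, dotp (a i) x <= b i].

Definition supporting (P : set V) (a : V) (b : R) : Prop :=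
  a != 0 /\ (forall x, P x -> dotp a x <= b) /\ exists x, P x /\ dotp a x = b.

Definition hyperplane (a : V) (b : R) : set V := [set x | dotp a x = b].

Definition affdim_ge (F : set V) (k : nat) : Prop :=
  exists (p0 : V) (W : 'M[R]_(k, n)),
    \rank W = k /\ F p0 /\ forall i, F (p0 + row i W).

Definition facet_wrt (P : set V) (a : V) (b : R) (F : set V) : Prop :=
  supporting P a b /\ F = P `&` hyperplane a b /\ affdim_ge F n.-1.

Definition facet (P : set V) (F : set V) : Prop :=
  exists a b, facet_wrt P a b F.

Definition vertex (P : set V) (v : V) : Prop :=
  exists a b, supporting P a b /\ P `&` hyperplane a b = [set v].

Definition simple_polytope (P : set V) : Prop :=
  [/\ is_polyhedron P, compact P, (interior P !=set0) &
      forall v, vertex P v ->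
        exists Fs : 'I_n -> set V,
          injective Fs /\ (forall i, facet P (Fs i) /\ Fs i v) /\
          (forall F, facet P F -> F v -> exists i, F = Fs i)].

Definition boundary (P : set V) : set V := P `\` interior P.

(* translation-invariant measure, positive and finite on bounded non-empty
   open sets (i.e. a positive multiple of Lebesgue measure) *)
Definition lebesgue_like (mu : {measure set BorelV -> \bar R}) : Prop :=
  (forall (A : set BorelV) (v : V), measurable A ->
      mu (translate A v) = mu A) /\
  (forall A : set V, open A -> bounded_set A -> A !=set0 ->
      (0 < mu A)%E /\ (mu A < +oo)%E).

(* a (positive multiple of) Lebesgue measure of the affine hyperplane
   {<a,x> = b}, viewed as a measure on V carried by that hyperplane:
   invariant under translations parallel to the hyperplane, positive and
   finite on bounded non-empty relatively open subsets of it *)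
Definition hyperplane_lebesgue (a : V) (b : R)
    (lam : {measure set BorelV -> \bar R}) : Prop :=
  [/\ lam (~` hyperplane a b) = 0%E,
      (forall (A : set BorelV) (v : V), measurable A -> dotp a v = 0 ->
          lam (translate A v) = lam A) &
      (forall O : set V, open O -> bounded_set (O `&` hyperplane a b) ->
          (O `&` hyperplane a b) !=set0 ->
          (0 < lam (O `&` hyperplane a b))%E /\
          (lam (O `&` hyperplane a b) < +oo)%E)].

Definition facet_measure (P : set V) (sigma : {measure set BorelV -> \bar R})
  : Prop :=
  forall a b F, facet_wrt P a b F ->
    exists (lam : {measure set BorelV -> \bar R}) (c : R),
      hyperplane_lebesgue a b lam /\ 0 < c /\
      forall A : set BorelV, measurable A ->
        sigma (A `&` F) = (c%:E * lam (A `&` F))%E.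

Definition lsc_on (P : set V) (u : V -> \bar R) : Prop :=
  forall x (r : R), P x -> (r%:E < u x)%E ->
    exists2 W, nbhs x W & forall y, W y -> P y -> (r%:E < u y)%E.

(* log-convexity on P, u : P -> (0, +oo]:
   u((1-t)x+ty) <= u(x)^(1-t) u(y)^t ; when u x or u y is +oo the right-hand
   side is +oo for 0<t<1 (and the inequality is trivial for t = 0, 1), so the
   condition only bites when both values are finite. *)
Definition logconvex_on (P : set V) (u : V -> \bar R) : Prop :=
  forall x y (t : R), P x -> P y -> 0 <= t <= 1 ->
    forall rx ry : R, u x = rx%:E -> u y = ry%:E ->
      (u ((1 - t) *: x + t *: y)%R <= (rx `^ (1 - t) * ry `^ t)%:E)%E.

Variable mu : {measure set BorelV -> \bar R}.
Variable sigma : {measure set BorelV -> \bar R}.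
Variable P : set V.

Definition Mp (p : R) (u : V -> \bar R) : Prop :=
  [/\ lsc_on P u, (forall x, P x -> (0 < u x)%E), logconvex_on P u,
      (\int[mu]_(x in (P : set BorelV)) u x = mu P)%E &
      (\int[mu]_(x in (P : set BorelV)) (u x `^ p) < +oo)%E].

Definition ulogu (e : \bar R) : \bar R :=
  match e with
  | r%:E => (r * ln r)%:E
  | +oo%E => +oo%E
  | -oo%E => -oo%E
  end.

Definition entropy (u : V -> \bar R) : \bar R :=
  (- (((fine (mu P))^-1)%:E * \int[mu]_(x in (P : set BorelV)) ulogu (u x)))%E.

Definition internal_energy (u : V -> \bar R) : \bar R :=
  (((fine (mu P))^-1)%:E *
     \int[sigma]_(x in (boundary P : set BorelV)) u x)%E.

Definition free_energy (T : R) (u : V -> \bar R) : \bar R :=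
  if entropy u == -oo%E then +oo%E
  else (internal_energy u - T%:E * entropy u)%E.

End Defs.

(* Main.v *)
Require Import Defs.
From HB Require Import structures.
From mathcomp Require Import all_boot all_order all_algebra.
From mathcomp Require Import all_classical all_reals all_analysis.
From mathcomp Require Import measurable_realfun.
From mathcomp Require Import ring lra.
Set Implicit Arguments. Unset Strict Implicit. Unset Printing Implicit Defensive.
Import Order.TTheory GRing.Theory Num.Theory.
Import numFieldNormedType.Exports.
Local Open Scope classical_set_scope.
Local Open Scope ring_scope.

(* On a line through the interior of P, a log-convex u is bounded by the larger of
   its values at the two exit points, so u is controlled in each of the n coordinate
   directions by its boundary trace. The Loomis-Whitney inequality, applied to the
   minima of u over dyadic cells, turns this into
     int_P u^(n/(n-1)) dmu <= C (int_bd(P) u dsigma)^(n/(n-1)).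
   Hence bounded energy gives uniform integrability. Interior bounds for log-convex
   densities of fixed mass give a subsequence converging pointwise in the interior,
   whose mass does not drop; Fatou makes both U and -S lower semicontinuous along it.
   So minimizers exist; at T = 0 one minimizes U - S among the minimizers of U.
   Uniqueness follows from the strict convexity of r ln r at the mean of two
   minimizers. *)

(** [mu] and [sigma] are given only by invariance, positivity and finiteness, so measures are
    compared through the uniqueness of an invariant measure on dyadic cells, or on cylinders over
    them, rather than through coordinates. The obstacle is the boundary: log-convexity controls a
    density locally in the interior only, and in a limit mass could escape to the boundary. An L^p
    bound with p > 1 excludes this, and n/(n-1) is the exponent at which Loomis-Whitney is scale
    invariant, so that the bound survives refinement of the grid. Limits are found in the interior
    and extended to the boundary by lower semicontinuity; Fatou for [sigma] then requires the
    extension to lie below the liminf of the sequence, which follows from convexity along segments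
    into the interior. Likewise two minimizers first agree almost everywhere, and then at each point
    of P because a lower semicontinuous convex function is determined on the boundary by its
    interior values. *)

Section Cells.
Variables (R : realType) (n : nat).
Local Notation V := 'rV[R]_n.
Local Notation B := (BorelV R n).

(** * Borel sets and dyadic cells *)

Lemma open_measurableV (A : set V) : open A -> measurable (A : set B).
Proof. exact: sub_sigma_algebra. Qed.

Lemma closed_measurableV (A : set V) : closed A -> measurable (A : set B).
Proof.
move=> cA; rewrite -[A]setCK; apply: (@measurableC _ B).
by apply: open_measurableV; rewrite openC.
Qed.

Lemma continuous_measurableV (f : V -> V) : continuous f ->
  measurable_fun [set: B] (f : B -> B).
Proof.
move=> cf; apply: (@measurability _ _ B B setT f (@open V)) => //.
move=> _ [A oA <-]; rewrite setTI; apply: open_measurableV.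
by apply: open_comp => // x _; exact: cf.
Qed.

Lemma nbhs_rVP (x : V) (A : set V) :
  nbhs x A <-> exists2 e : R, 0 < e &
    forall y : V, (forall i, `|x ord0 i - y ord0 i| < e) -> A y.
Proof.
split=> [/nbhs_ballP[e /= e0 eA]|[e e0 eA]].
  exists e => // y xy; apply: eA; split=> // i j.
  by rewrite ord1; exact: xy.
apply/nbhs_ballP; exists e => //= y [_ xy]; apply: eA => i.
exact: (xy ord0 i).
Qed.

Lemma norm_rV_le (x : V) (r : R) : 0 <= r ->
  (forall i, `|x ord0 i| <= r) -> `|x| <= r.
Proof.
move=> r0 h; rewrite /Num.norm/= mx_normrE; apply/bigmax_leP; split=> // -[i j] _ /=.
by rewrite (ord1 i).
Qed.

Lemma coord_norm_le (x : V) i : `|x ord0 i| <= `|x|.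
Proof.
rewrite [leRHS]/Num.norm/= mx_normrE.
by apply/bigmax_geP; right; exists (ord0, i).
Qed.

Lemma bounded_rVP (A : set V) :
  bounded_set A <-> exists M : R, forall x i, A x -> `|x ord0 i| <= M.
Proof.
split=> [[M [_ h]]|[M h]].
  exists (M + 1) => x i Ax; apply: le_trans (coord_norm_le x i) _.
  by apply: h => //; rewrite ltrDl.
exists `|M|; split=> // r Mr x Ax; apply: norm_rV_le => [|i].
  by apply: le_trans (ltW Mr).
by apply: le_trans (h _ _ Ax) _; apply: le_trans (ltW Mr); exact: ler_norm.
Qed.

Lemma measurable_strip (i : 'I_n) (a b : R) :
  measurable ([set x : V | a <= x ord0 i < b] : set B).
Proof.
have -> : [set x : V | a <= x ord0 i < b] =
    [set x : V | a <= x ord0 i] `&` [set x : V | x ord0 i < b].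
  by apply/seteqP; split=> x /=; [move/andP|move=> h; apply/andP].
apply: (@measurableI _ B).
  apply: closed_measurableV.
  rewrite (_ : [set x | _] = (fun x : V => x ord0 i) @^-1` [set y | a <= y])//.
  by apply: closed_comp (@closed_ge R a) => x _; exact: coord_continuous.
apply: open_measurableV.
rewrite (_ : [set x | _] = (fun x : V => x ord0 i) @^-1` [set y | y < b])//.
by apply: open_comp (@open_lt R b) => x _; exact: coord_continuous.
Qed.

(* The coordinates in [J] are pinned to a dyadic interval of length [2^-k], the
   others are free: a cell for [J = xpredT], a column along [e_k] for [J = predC1 k]. *)
Definition dcol (J : pred 'I_n) (k : nat) (z : 'I_n -> int) : set V :=
  [set x | forall i, J i -> Num.floor (2 ^+ k * x ord0 i) = z i].

Local Notation cell := (dcol xpredT).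

Lemma dcol_floorP J k z x : dcol J k z x <->
  forall i, J i -> (z i)%:~R / 2 ^+ k <= x ord0 i < (z i + 1)%:~R / 2 ^+ k.
Proof.
have k0 : (0 : R) < 2 ^+ k by rewrite exprn_gt0.
split=> h i Ji.
  by rewrite ler_pdivrMr// ltr_pdivlMr// mulrC -(h i Ji) floor_itv.
apply: floor_def; have := h i Ji.
by rewrite ler_pdivrMr// ltr_pdivlMr// mulrC.
Qed.

Lemma measurable_dcol J k z : measurable (dcol J k z : set B).
Proof.
have -> : dcol J k z = \bigcap_(i in [set i | J i])
    [set x | (z i)%:~R / 2 ^+ k <= x ord0 i < (z i + 1)%:~R / 2 ^+ k].
  by apply/seteqP; split=> x; [move/dcol_floorP|move=> h; apply/dcol_floorP].
apply: (@fin_bigcap_measurable _ B) => [|i _]; first exact: finite_finset.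
exact: measurable_strip.
Qed.

(** An integer [m] is below [2 ^+ k * x] exactly when [m * 2 ^+ d] is below the floor of
    [2 ^+ (k + d) * x], so the finer floor determines the coarser one. *)
Lemma floor_dyadic_coarsen (k d : nat) (x y : R) :
  Num.floor (2 ^+ (k + d) * x) = Num.floor (2 ^+ (k + d) * y) ->
  Num.floor (2 ^+ k * x) = Num.floor (2 ^+ k * y).
Proof.
move=> h; have d0 : (0 : R) < 2 ^+ d by rewrite exprn_gt0.
have E (m : int) (a : R) :
    (m%:~R <= 2 ^+ k * a) = (m * 2 ^+ d <= Num.floor (2 ^+ (k + d) * a)).
  rewrite floor_ge_int intrM exprD -mulrA [2 ^+ d * a]mulrC mulrA.
  by rewrite rmorphXn/= ler_pM2r.
apply/eqP; rewrite floor_eq; apply/andP; split; first by rewrite E h -E floor_le_tmp.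
by rewrite ltNge E h -E -ltNge floorD1_gt.
Qed.

Lemma cell_nest (k l : nat) z w x : (k <= l)%N -> cell k z x -> cell l w x ->
  cell l w `<=` cell k z.
Proof.
move=> /subnKC <- xk xl y yl i _; rewrite -(xk i isT).
by apply: (@floor_dyadic_coarsen _ (l - k)%N); rewrite (xl i isT) (yl i isT).
Qed.

Lemma exists_small_dyadic (e : R) : 0 < e -> exists k, forall l, (k <= l)%N -> 2 ^- l < e.
Proof.
move=> e0; exists (Num.Def.archi_bound e^-1) => l kl.
by rewrite invf_plt ?posrE ?exprn_gt0// upper_nthrootP.
Qed.

Definition cellidx k (x : V) : 'I_n -> int := fun i => Num.floor (2 ^+ k * x ord0 i).

Lemma cell_dist (J : pred _) k z (x y : V) i : J i -> dcol J k z x -> dcol J k z y ->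
  `|x ord0 i - y ord0 i| < 2 ^- k.
Proof.
move=> Ji /dcol_floorP/(_ i Ji)/andP[x1 x2] /dcol_floorP/(_ i Ji)/andP[y1 y2].
rewrite intrD mulrDl mul1r in x2 y2; rewrite ltr_norml; apply/andP; split; lra.
Qed.

Lemma cell_sub_nbhs (x : V) (A : set V) : nbhs x A ->
  exists k, forall l, (k <= l)%N -> cell l (cellidx l x) `<=` A.
Proof.
move=> /nbhs_rVP[e e0 eA]; have [k kP] := exists_small_dyadic e0; exists k => l kl y yl.
by apply: eA => i; apply: lt_trans (kP l kl); exact: (@cell_dist xpredT _ (cellidx l x)).
Qed.

(** [set0] makes the family closed under intersection. Finite functions as indices make it
    countable, which the decomposition of open sets requires. *)
Definition dyadic_cells : set (set V) :=
  [set A | A = set0 \/ exists k (z : {ffun 'I_n -> int}), A = cell k z].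

Lemma cell_ffun k z : cell k z = cell k [ffun i => z i].
Proof. by apply/seteqP; split=> x h i _; have := h i isT; rewrite ffunE. Qed.

(** An open set is the countable union of the cells it contains, since the cells around a point
    shrink to it. *)
Lemma dyadic_cells_generate :
  @measurable _ B = <<s dyadic_cells >>.
Proof.
apply/seteqP; split.
  apply: smallest_sub => [|A oA]; first exact: smallest_sigma_algebra.
  pose T := g_sigma_algebraType dyadic_cells.
  pose F (p : nat * {ffun 'I_n -> int}) : set T :=
    if `[< cell p.1 p.2 `<=` A >] then cell p.1 p.2 else set0.
  have -> : A = \bigcup_p F p.
    apply/seteqP; split=> [x Ax|x [p _]]; last first.
      by rewrite /F; case: asboolP => // h; exact: h.
    have [k kA] := cell_sub_nbhs (open_nbhs_nbhs (conj oA Ax)).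
    exists (k, [ffun i => cellidx k x i]) => //; rewrite /F/= -cell_ffun.
    by case: asboolP => [_ i _//|]; case; exact: kA.
  apply: (@countable_bigcupT_measurable _ T _ F) => [|p]; first exact: countableP.
  rewrite /F; case: asboolP => _; apply: sub_sigma_algebra; last by left.
  by right; exists p.1, p.2.
apply: smallest_sub; first exact: sigma_algebra_measurable.
by move=> A [->|[k [z ->]]]; [exact: measurable0|exact: measurable_dcol].
Qed.

Lemma dyadic_cells_setI : setI_closed dyadic_cells.
Proof.
move=> A A' [->|[k [z ->]]]; first by rewrite set0I; left.
move=> [->|[l [w ->]]]; first by rewrite setI0; left.
have [->|/set0P[x [xk xl]]] := eqVneq (cell k z `&` cell l w) set0; first by left.
right; have [kl|/ltnW lk] := leqP k l.
  by exists l, w; rewrite setIC; apply/setIidPl; exact: (@cell_nest _ _ _ _ x).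
by exists k, z; apply/setIidPl; exact: (@cell_nest _ _ _ _ x).
Qed.

(** Cells are disjoint or nested, hence form a generating pi-system; the unit cells provide the
    sigma-finite exhaustion. *)
Lemma dyadic_measure_unique (m1 m2 : {measure set B -> \bar R}) :
  (forall k z, m1 (cell k z) = m2 (cell k z)) ->
  (forall z, (m1 (cell 0 z) < +oo)%E) ->
  forall A, measurable A -> m1 A = m2 A.
Proof.
move=> m12 mfin A mA.
pose g (p : nat) : set B :=
  if unpickle p is Some z then cell 0 (z : {ffun 'I_n -> int}) else set0.
apply: (@measure_unique _ R B dyadic_cells g _ _ _ _ m1 m2 _ _ A) => //.
- exact: dyadic_cells_generate.
- exact: dyadic_cells_setI.
- by move=> p; rewrite /g; case: unpickle => [z|]; [right; exists 0%N, z|left].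
- apply/seteqP; split=> // x _; exists (pickle [ffun i => cellidx 0 x i]) => //.
  by rewrite /g pickleK -cell_ffun => i _.
- by move=> _ [->|[k [z ->]]] //; rewrite !measure0.
- by move=> p; rewrite /g; case: unpickle => [z|]//; rewrite measure0.
Qed.

Lemma measure_fin_type_bigcup d (T : measurableType d) (m : {measure set T -> \bar R})
    (I : finType) (S : {set I}) (F : I -> set T) :
  (forall i, measurable (F i)) ->
  (forall i j x, i \in S -> j \in S -> F i x -> F j x -> i = j) ->
  (m (\bigcup_(i in [set` S]) F i) = \sum_(i in S) m (F i))%E.
Proof.
move=> mF tF; rewrite measure_fin_bigcup//.
- rewrite -big_enum/= [RHS]fsbig_seq ?enum_uniq//.
  suff -> : [set` enum S] = [set` S] by [].
  by apply/seteqP; split=> i /=; rewrite mem_enum.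
- by move=> i j /= iS jS [x [xi xj]]; exact: tF xi xj.
Qed.

(** Indices of the level-[k] columns inside the unit column. Coordinates outside [J], which do not
    affect the column, are set to 0 so that no column is counted twice. *)
Definition offset_idx (k : nat) (J : pred 'I_n) : {set {ffun 'I_n -> 'I_(2 ^ k)}} :=
  [set z : {ffun 'I_n -> 'I_(2 ^ k)} | [forall i, ~~ J i ==> (z i == 0 :> nat)]]%SET.

Lemma dcol_split (J : pred 'I_n) k :
  dcol J 0 (fun=> 0) =
  \bigcup_(z in [set` offset_idx k J]) dcol J k (fun i => (z i : nat)%:Z).
Proof.
have k0 : (0 : R) < 2 ^+ k by rewrite exprn_gt0.
have kN : (2 ^ k)%:R = 2 ^+ k :> R by rewrite natrX.
apply/seteqP; split=> [x /dcol_floorP xJ|x [z /= zJ] /dcol_floorP xz].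
  have H i : J i -> (`|Num.floor (2 ^+ k * x ord0 i)|%N < 2 ^ k)%N /\
     (`|Num.floor (2 ^+ k * x ord0 i)|%N)%:Z = Num.floor (2 ^+ k * x ord0 i).
    move=> Ji; have := xJ i Ji; rewrite expr0 !divr1 add0r => /andP[x0 x1].
    have f0 : 0 <= Num.floor (2 ^+ k * x ord0 i).
      by rewrite floor_ge0 mulr_ge0// ltW.
    rewrite gez0_abs//; split=> //; rewrite -ltz_nat gez0_abs//.
    by rewrite floor_lt_int -pmulrn kN gtr_pMr.
  have p0 : (0 < 2 ^ k)%N by rewrite expn_gt0.
  pose z : {ffun 'I_n -> 'I_(2 ^ k)} :=
    [ffun i => if J i then insubd (Ordinal p0) `|Num.floor (2 ^+ k * x ord0 i)|%N
               else Ordinal p0].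
  exists z => [|i Ji].
    by rewrite /= inE; apply/forallP => i; apply/implyP => /negbTE Ji; rewrite ffunE Ji.
  by rewrite ffunE Ji val_insubd (H i Ji).1 (H i Ji).2.
apply/dcol_floorP => i Ji; have /andP[x0 x1] := xz i Ji.
rewrite expr0 !divr1 add0r; apply/andP; split.
  by apply: le_trans x0; rewrite divr_ge0// ltW.
apply: lt_le_trans x1 _; rewrite ler_pdivrMr// mul1r -kN.
by rewrite intrD -[X in _ + X]/(1%:R) -pmulrn -natrD addn1 ler_nat.
Qed.

Lemma dcol_idx_inj (J : pred 'I_n) k (z w : {ffun 'I_n -> 'I_(2 ^ k)}) x :
  z \in offset_idx k J -> w \in offset_idx k J ->
  dcol J k (fun i => (z i : nat)%:Z) x -> dcol J k (fun i => (w i : nat)%:Z) x ->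
  z = w.
Proof.
rewrite !inE => /forallP zJ /forallP wJ xz xw; apply/ffunP => i; apply/val_inj => /=.
have [Ji|Ji] := boolP (J i); first by have := xz i Ji; rewrite (xw i Ji) => -[].
by have := zJ i; have := wJ i; rewrite Ji /= => /eqP -> /eqP ->.
Qed.

(** * Uniqueness of invariant measures on cylinders *)

Definition push_meas (m : {measure set B -> \bar R}) (f : V -> V)
    (cf : continuous f) : {measure set B -> \bar R} :=
  measure_function_pushforward__canonical__measure_function_Measure m
    (continuous_measurableV cf).

Lemma continuous_rV (T : topologicalType) (f : T -> V) :
  (forall i, continuous (fun x => f x ord0 i)) -> continuous f.
Proof.
move=> cf x A /nbhs_rVP[e e0 eA].
have : \forall y \near x, forall i, `|f x ord0 i - f y ord0 i| < e.
  apply: filter_forall => i.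
  have /cvgr_dist_lt /(_ e e0) := cf i x.
  by apply: filterS => y.
by apply: filterS => y; exact: eA.
Qed.

Definition proj_coord (J : pred 'I_n) (x : V) : V :=
  \row_i (if J i then x ord0 i else 0).

Lemma proj_coord_continuous J : continuous (proj_coord J).
Proof.
apply: continuous_rV => i x.
rewrite (_ : (fun x => _) = (fun x : V => if J i then x ord0 i else 0)).
  by case: (J i); [exact: coord_continuous|exact: (@cst_continuous V R)].
by apply/funext => y; rewrite mxE.
Qed.

Lemma dcol_measure_split (J : pred 'I_n) (m : {measure set B -> \bar R}) k :
  (forall k z, m (dcol J k z) = m (dcol J k (fun=> 0))) ->
  m (dcol J 0 (fun=> 0)) = (#|offset_idx k J|%:R%:E * m (dcol J k (fun=> 0%R)))%E.
Proof.
move=> mJ; rewrite (@dcol_split J k) measure_fin_type_bigcup.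
- under eq_bigr do rewrite mJ.
  by rewrite mule_natl sumr_const.
- by move=> z; exact: measurable_dcol.
- by move=> z w x; exact: dcol_idx_inj.
Qed.

Definition coord_cylinder (J : pred 'I_n) (A : set V) :=
  forall x y : V, (forall i, J i -> x ord0 i = y ord0 i) -> A x -> A y.

(** By invariance a level-[k] column has the mass of the unit column divided by the number of such
    columns, a number common to both measures. Projecting the free coordinates away turns columns
    into cells, where uniqueness applies. The cross-multiplied form also covers unit columns of mass
    zero. *)
Lemma cylinder_measure_unique (J : pred 'I_n) (m1 m2 : {measure set B -> \bar R}) :
  (forall k z, m1 (dcol J k z) = m1 (dcol J k (fun=> 0))) ->
  (forall k z, m2 (dcol J k z) = m2 (dcol J k (fun=> 0))) ->
  (m1 (dcol J 0 (fun=> 0%R)) < +oo)%E -> (m2 (dcol J 0 (fun=> 0%R)) < +oo)%E ->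
  forall A, measurable (A : set B) -> coord_cylinder J A ->
  (m2 (dcol J 0 (fun=> 0%R)) * m1 A = m1 (dcol J 0 (fun=> 0%R)) * m2 A)%E.
Proof.
move=> i1 i2 f1 f2 A mA cA.
have F (m : {measure set B -> \bar R}) : (m (dcol J 0 (fun=> 0%R)) < +oo)%E ->
    exists c : {nonneg R}, m (dcol J 0 (fun=> 0%R)) = (c%:num)%:E.
  move=> mf; have m0 : 0 <= fine (m (dcol J 0 (fun=> 0%R))) by rewrite fine_ge0.
  by exists (NngNum m0); rewrite /= fineK// ge0_fin_numE.
have [c1 E1] := F _ f1; have [c2 E2] := F _ f2.
pose n1 : {measure set B -> \bar R} := mscale c2 (push_meas m1 (@proj_coord_continuous J)).
pose n2 : {measure set B -> \bar R} := mscale c1 (push_meas m2 (@proj_coord_continuous J)).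
have n1E X : n1 X = ((c2%:num)%:E * m1 (proj_coord J @^-1` X))%E by [].
have n2E X : n2 X = ((c1%:num)%:E * m2 (proj_coord J @^-1` X))%E by [].
have PA : proj_coord J @^-1` A = A.
  by apply/seteqP; split=> x; apply: cA => i Ji; rewrite mxE Ji.
have : n1 A = n2 A.
  apply: (@dyadic_measure_unique n1 n2) => // [k z|z].
    (* The projection puts 0 in the coordinates outside [J], so a cell with a nonzero index there
       has empty preimage. *)
    have [h|/existsNP[i /not_implyP[Ji zi]]] := pselect (forall i, ~~ J i -> z i = 0).
      have Pz : proj_coord J @^-1` (cell k z) = dcol J k z.
        apply/seteqP; split=> x xz i; first by move=> Ji; have := xz i isT; rewrite mxE Ji.
        move=> _; rewrite mxE; case: ifPn => Ji; first exact: xz.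
        by rewrite mulr0 floor0 h.
      rewrite n1E n2E Pz i1 i2 -E1 -E2.
      rewrite (@dcol_measure_split J m1 k)// (@dcol_measure_split J m2 k)//.
      by rewrite muleAC.
    have Pz : proj_coord J @^-1` (cell k z) = set0.
      apply/seteqP; split=> x //= /(_ i isT); rewrite mxE (negbTE Ji) mulr0 floor0.
      by move=> /esym.
    by rewrite n1E n2E Pz !measure0 !mule0.
  rewrite n1E; apply: (@le_lt_trans _ _ ((c2%:num)%:E * m1 (dcol J 0 z))%E).
    apply: lee_pmul => //; apply: le_measure; rewrite ?inE.
    - rewrite -[X in measurable X]setTI.
      apply: (continuous_measurableV (@proj_coord_continuous J)) => //.
      exact: measurable_dcol.
    - exact: measurable_dcol.
    - by move=> x xz i Ji; have := xz i isT; rewrite mxE Ji.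
  by rewrite i1 E1 -EFinM ltry.
by rewrite n1E n2E PA -E1 -E2.
Qed.

Lemma shift_continuous (c : V) : continuous (fun y : V => y - c).
Proof.
move=> y; apply: (@cvgB R V V (nbhs y) _ (fun y : V => y) (fun=> c) y c).
  by apply: cvg_id.
by apply: cvg_cst.
Qed.

Lemma translateE (A : set V) (v : V) : translate A v = (fun x => x - v) @^-1` A.
Proof.
apply/seteqP; split=> x; first by move=> [y Ay <-]; rewrite /= addrK.
by move=> Ax; exists (x - v) => //; rewrite subrK.
Qed.

Lemma dcol_translate J k z :
  dcol J k z = translate (dcol J k (fun=> 0)) (\row_i ((z i)%:~R / 2 ^+ k)).
Proof.
have k0 : (2 ^+ k : R) != 0 by rewrite expf_neq0.
rewrite translateE; apply/seteqP; split=> x xz i Ji; have := xz i Ji.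
  by rewrite !mxE mulrBr mulrCA mulfV// mulr1 -intrN floorDrz// intrKfloor => ->; rewrite subrr.
rewrite !mxE mulrBr mulrCA mulfV// mulr1 -intrN floorDrz// intrKfloor => /eqP.
by rewrite subr_eq0 => /eqP.
Qed.

Definition open_box (M : R) : set V := [set x | forall i, `|x ord0 i| < M].

Lemma open_box_open M : open (open_box M).
Proof.
rewrite openE => x xM.
suff : \forall y \near (x : V), forall i, `|(y : V) ord0 i| < M by [].
apply: (@filter_forall _ _ (fun i (y : V) => `|y ord0 i| < M) (nbhs (x : V))) => i.
have oi : open ((fun x : V => `|x ord0 i|) @^-1` [set y | y < M]).
  apply: open_comp (@open_lt R M) => y _.
  apply: continuous_comp; first exact: coord_continuous.
  exact: norm_continuous.
by have := open_nbhs_nbhs (conj oi (xM i)).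
Qed.

Lemma open_box_bounded M : bounded_set (open_box M).
Proof. by apply/bounded_rVP; exists M => x i /(_ i)/ltW. Qed.

Lemma open_box0 M : 0 < M -> open_box M 0.
Proof. by move=> M0 i; rewrite mxE normr0. Qed.

Lemma bounded_sub_box (A : set V) : bounded_set A -> exists2 M, 0 < M & A `<=` open_box M.
Proof.
move=> /bounded_rVP[M AM]; exists (`|M| + 1) => [|x Ax i]; first by rewrite ltr_pwDr.
by apply: le_lt_trans (AM x i Ax) _; rewrite (le_lt_trans (ler_norm M))// ltrDl.
Qed.

(** * Translation-invariant measures *)

Section LebesgueLike.
Variable mu : {measure set B -> \bar R}.
Hypothesis hmu : lebesgue_like mu.

Lemma lebesgue_bounded_lty (A : set V) : measurable (A : set B) -> bounded_set A ->
  (mu A < +oo)%E.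
Proof.
move=> mA /bounded_sub_box[M M0 AM].
apply: (@le_lt_trans _ _ (mu (open_box M))).
  apply: le_measure; rewrite ?inE//; apply: open_measurableV; exact: open_box_open.
have [] // := hmu.2 _ (@open_box_open M) (@open_box_bounded M) _.
by exists 0; exact: open_box0.
Qed.

Lemma lebesgue_dcol k z : mu (cell k z) = mu (cell k (fun=> 0)).
Proof. by rewrite dcol_translate hmu.1//; exact: measurable_dcol. Qed.

Lemma cell0_bounded k : bounded_set (cell k (fun=> 0)).
Proof.
apply/bounded_rVP; exists 1 => x i /dcol_floorP/(_ i isT); rewrite mul0r add0r => /andP[x0 x1].
rewrite ger0_norm// ltW// (lt_le_trans x1)// div1r invf_le1 ?exprn_gt0//.
by rewrite exprn_ege1// ler1n.
Qed.

Lemma lebesgue_cell_lty k z : (mu (cell k z) < +oo)%E.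
Proof.
by rewrite lebesgue_dcol; apply: lebesgue_bounded_lty; [exact: measurable_dcol|exact: cell0_bounded].
Qed.

Lemma open_gt0_subset (A U : set V) (x : V) : measurable (A : set B) -> open U -> U x ->
  U `<=` A -> (0 < mu A)%E.
Proof.
move=> mA oU Ux UA; have [e e0 eU] := (nbhs_rVP x U).1 (open_nbhs_nbhs (conj oU Ux)).
(* Positivity is postulated for bounded open sets only, so [U] is first shrunk to a box around
   [x]. *)
pose W : set V := (fun y => y - x) @^-1` open_box e.
have oW : open W.
  by apply: open_comp (@open_box_open e) => y _; exact: shift_continuous.
have WU : W `<=` U.
  by move=> y Wy; apply: eU => i; have := Wy i; rewrite !mxE distrC.
apply: (@lt_le_trans _ _ (mu W)); last first.
  apply: le_measure; rewrite ?inE//; first exact: open_measurableV.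
  exact: subset_trans UA.
have [||] // := hmu.2 _ oW _ _; last by exists x; rewrite /W/= subrr; exact: open_box0.
apply/bounded_rVP; exists (`|x| + e) => y i /(_ i); rewrite !mxE => Wy.
rewrite -[y ord0 i](subrK (x ord0 i)) (le_trans (ler_normD _ _))// addrC lerD//.
  exact: coord_norm_le.
exact: ltW.
Qed.

Lemma lebesgue_open_gt0 (U : set V) (x : V) : open U -> U x -> (0 < mu U)%E.
Proof. by move=> oU Ux; apply: (open_gt0_subset _ oU Ux) => //; exact: open_measurableV. Qed.

Lemma cell_interior k z : exists U : set V, [/\ open U, U !=set0 & U `<=` cell k z].
Proof.
have k0 : (0 : R) < 2 ^+ k by rewrite exprn_gt0.
pose c : V := \row_i (((z i)%:~R + 2^-1) / 2 ^+ k).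
exists ((fun y => y - c) @^-1` open_box (2^-1 / 2 ^+ k)); split.
- by apply: open_comp (@open_box_open _) => y _; exact: shift_continuous.
- by exists c; rewrite /= subrr; apply: open_box0; rewrite divr_gt0// invr_gt0.
- move=> y yc; apply/dcol_floorP => i _; have := yc i; rewrite !mxE ltr_norml intrD.
  rewrite !mulrDl => /andP[y1 y2]; apply/andP; split; first by lra.
  by move: y2; rewrite (_ : 1%:~R / 2 ^+ k = 2^-1 / 2 ^+ k + 2^-1 / 2 ^+ k :> R); [lra|rewrite -mulrDl; congr (_ / _); lra].
Qed.

Lemma lebesgue_cell_gt0 k z : (0 < mu (cell k z))%E.
Proof.
have [U [oU [x Ux] Usub]] := cell_interior k z.
by apply: (open_gt0_subset _ oU Ux Usub); exact: measurable_dcol.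
Qed.

Definition reflect (A : set V) : set V := [set x | A (- x)].

(** The reflected measure is again translation invariant, hence a multiple of [mu] by uniqueness.
    Any finite factor serves the symmetric-point argument in [density_local_bound]. *)
Lemma lebesgue_reflect : exists2 c : R, 0 <= c & forall A, measurable (A : set B) ->
  (mu (reflect A) = c%:E * mu A)%E.
Proof.
have cN : continuous (fun x : V => - x) by move=> x; exact: opp_continuous.
pose m : {measure set B -> \bar R} := push_meas mu cN.
have mE A : m A = mu (reflect A) by [].
have tN A v : reflect (translate A v) = translate (reflect A) (- v).
  by rewrite /reflect !translateE; apply/seteqP; split=> x /=; rewrite opprK opprD.
have mN A : measurable (A : set B) -> measurable (reflect A : set B).
  by move=> mA; rewrite -[X in measurable X]setTI; exact: (continuous_measurableV cN).
have m0 : (m (cell 0 (fun=> 0%R)) < +oo)%E.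
  rewrite mE; apply: lebesgue_bounded_lty; first by apply: mN; exact: measurable_dcol.
  have /bounded_rVP[M h] := cell0_bounded 0; apply/bounded_rVP; exists M => x i /h.
  by move=> /(_ i); rewrite mxE normrN.
have mu0 := lebesgue_cell_gt0 0 (fun=> 0); have muf := lebesgue_cell_lty 0 (fun=> 0).
set a := mu (cell 0 (fun=> 0%R)) in mu0 muf *; set b := m (cell 0 _) in m0 *.
have af : a \is a fin_num by rewrite ge0_fin_numE ?measure_ge0.
have bf : b \is a fin_num by rewrite ge0_fin_numE ?measure_ge0.
exists (fine b / fine a) => [|A mA].
  by rewrite divr_ge0// fine_ge0// measure_ge0.
have := @cylinder_measure_unique xpredT m mu _ _ _ _ A mA _.
rewrite -/a -/b mE => E.
have a0 : fine a != 0 by rewrite gt_eqF// fine_gt0// mu0.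
rewrite -[mu (reflect A)]mul1e -(mulVf a0) EFinM -muleA fineK// E.
  by rewrite mulrC EFinM fineK// muleA.
- by move=> k z; rewrite dcol_translate !mE tN hmu.1//; apply: mN; exact: measurable_dcol.
- by move=> k z; exact: lebesgue_dcol.
- exact: m0.
- exact: muf.
- by move=> x y xy; rewrite (_ : y = x)//; apply/rowP => i; rewrite xy.
Qed.

End LebesgueLike.

End Cells.

(** * Polytopes, facets and exit points *)

Section Polyhedra.
Variables (R : realType) (n : nat).
Local Notation V := 'rV[R]_n.
Implicit Types (a x y z : V) (P : set V).

Lemma dotpD a x y : dotp a (x + y) = dotp a x + dotp a y.
Proof. by rewrite /dotp -big_split; apply: eq_bigr => i _; rewrite mxE mulrDr. Qed.

Lemma dotpZ a (c : R) x : dotp a (c *: x) = c * dotp a x.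
Proof. by rewrite /dotp mulr_sumr; apply: eq_bigr => i _; rewrite mxE mulrCA. Qed.

Lemma dotp_conv a x y t : dotp a ((1 - t) *: x + t *: y) = (1 - t) * dotp a x + t * dotp a y.
Proof. by rewrite dotpD !dotpZ. Qed.

Lemma dotp0l x : dotp 0 x = 0.
Proof. by rewrite /dotp big1// => i _; rewrite mxE mul0r. Qed.

Lemma dotp_self_gt0 a : a != 0 -> 0 < dotp a a.
Proof.
move=> a0; rewrite lt_neqAle sumr_ge0 ?andbT; last by move=> i _; rewrite -expr2 sqr_ge0.
apply: contra_neq a0 => /esym/eqP; rewrite psumr_eq0; last by move=> i _; rewrite -expr2 sqr_ge0.
move=> /allP h; apply/rowP => i; rewrite mxE; apply/eqP.
by have := h i; rewrite mem_index_enum => /(_ isT); rewrite mulf_eq0 orbb.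
Qed.

Lemma dotp_continuous a : continuous (dotp a).
Proof.
suff H s : continuous (fun x : V => \sum_(j <- s) a ord0 j * x ord0 j) by exact: H.
elim: s => [|i s IH] x.
  rewrite (_ : (fun x => _) = (fun=> 0)); first exact: (@cst_continuous V R).
  by apply/funext => y; rewrite big_nil.
rewrite (_ : (fun x => _) =
  (fun x : V => a ord0 i * x ord0 i + \sum_(j <- s) a ord0 j * x ord0 j)); last first.
  by apply/funext => y; rewrite big_cons.
apply: (@continuousD R R V _ _ x); last exact: IH.
by apply: (@continuousM R V (fun=> a ord0 i) _ x);
  [exact: cst_continuous|exact: coord_continuous].
Qed.

Lemma interior_dotp_lt P a b x : a != 0 -> (forall y, P y -> dotp a y <= b) ->
  interior P x -> dotp a x < b.
Proof.
move=> a0 hP /(nbhs_rVP x P)[e e0 eP].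
have aa := dotp_self_gt0 a0.
pose t := e / 2 / (1 + `|a|); have a1 : 0 < 1 + `|a| by rewrite ltr_pwDl.
have t0 : 0 < t by rewrite !divr_gt0.
have : P (x + t *: a).
  apply: eP => i; rewrite !mxE opprD addNKr normrN normrM (gtr0_norm t0).
  rewrite /t mulrAC ltr_pdivrMr//.
  apply: (@le_lt_trans _ _ (e / 2 * (1 + `|a|))).
    by rewrite ler_pM2l ?divr_gt0// (le_trans (coord_norm_le a i))// lerDr.
  by rewrite ltr_pM2r// gtr_pMr// invf_lt1// ltr1n.
move=> /hP; rewrite dotpD dotpZ; apply: lt_le_trans.
by rewrite ltrDl mulr_gt0.
Qed.

Lemma strict_open (I : finType) (Q : pred I) (a : I -> V) (b : I -> R) x :
  (forall i, Q i -> dotp (a i) x < b i) ->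
  exists2 e : R, 0 < e & forall y : V, (forall i, `|x ord0 i - y ord0 i| < e) ->
    forall i, Q i -> dotp (a i) y < b i.
Proof.
move=> h; apply/nbhs_rVP.
apply: (@filter_forall _ _ (fun i (y : V) => Q i -> dotp (a i) y < b i) (nbhs x)) => i.
have [Qi|nQi] := boolP (Q i); last exact: filterE.
have oi : open (dotp (a i) @^-1` [set y | y < b i]).
  by apply: open_comp (@open_lt R (b i)) => y _; exact: dotp_continuous.
by have := open_nbhs_nbhs (conj oi (h i Qi)); apply: filterS.
Qed.

(** Supplies the directions that witness the dimension of a facet. *)
Lemma orth_basis a : a != 0 -> exists W : 'M[R]_(n.-1, n),
  \rank W = n.-1 /\ forall i, dotp a (row i W) = 0.
Proof.
move=> a0; pose K := kermx a^T.
have rK : \rank K = n.-1.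
  rewrite mxrank_ker mxrank_tr -subn1; congr (_ - _)%N.
  by rewrite rank_rV a0.
have KW : exists W : 'M[R]_(\rank K, n), \rank W = \rank K /\ forall i, dotp a (row i W) = 0.
  exists (row_base K); split=> [|i]; first by rewrite eq_row_base.
  have : (row i (row_base K) <= K)%MS by rewrite (submx_trans (row_sub _ _))// eq_row_base.
  move=> /sub_kermxP/matrixP/(_ ord0 ord0); rewrite !mxE => <-.
  by apply: eq_bigr => j _; rewrite !mxE mulrC.
by rewrite -rK.
Qed.

(** An irredundant system of inequalities. Since [facet_measure] describes [sigma] on facets only,
    each inequality has to cut out a facet. *)
Definition facet_system (P : set V) (I : finType) (a : I -> V) (b : I -> R) : Prop :=
  P = [set x | forall i, dotp (a i) x <= b i] /\
  forall i, facet_wrt P (a i) (b i) (P `&` hyperplane (a i) (b i)).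

(** [y] violates only inequality [i], so the segment from [x0] to [y] meets the hyperplane at a
    point [z] where the other inequalities are strict; near [z] the hyperplane lies in [P]. *)
Lemma facet_of_irredundant P (I : finType) (a : I -> V) (b : I -> R) (i : I) x0 y :
  (P = [set x | forall j, dotp (a j) x <= b j]) -> (forall j, dotp (a j) x0 < b j) ->
  (forall j, j != i -> dotp (a j) y <= b j) -> b i < dotp (a i) y ->
  facet_wrt P (a i) (b i) (P `&` hyperplane (a i) (b i)).
Proof.
move=> PE hx0 hy hyi.
have ai0 : a i != 0.
  apply/eqP => ai0; have := hx0 i; have := hyi.
  by rewrite ai0 !dotp0l => /lt_trans h /h; rewrite ltxx.
pose t := (b i - dotp (a i) x0) / (dotp (a i) y - dotp (a i) x0).
have d1 : 0 < b i - dotp (a i) x0 by rewrite subr_gt0.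
have d2 : b i - dotp (a i) x0 < dotp (a i) y - dotp (a i) x0 by rewrite ltrD2r.
have d3 := lt_trans d1 d2.
have t0 : 0 < t by rewrite divr_gt0.
have t1 : t < 1 by rewrite ltr_pdivrMr// mul1r.
pose z := (1 - t) *: x0 + t *: y.
have zi : dotp (a i) z = b i.
  rewrite /z dotp_conv mulrBl mul1r -addrA [- _ + _]addrC -mulrBr /t mulfVK ?gt_eqF//.
  by rewrite addrC subrK.
have zj j : j != i -> dotp (a j) z < b j.
  move=> ji; rewrite /z dotp_conv; have := hx0 j; have := hy j ji => h1 h2.
  apply: (@lt_le_trans _ _ ((1 - t) * b j + t * b j)); last by rewrite -mulrDl subrK mul1r.
  by rewrite ltr_leD// ?ltr_pM2l ?subr_gt0// ler_pM2l.
have Pz : P z.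
  by rewrite PE => j /=; have [->|/zj/ltW//] := eqVneq j i; rewrite zi.
split; last split=> //.
  split=> //; split; last by exists z.
  by move=> x; rewrite PE => /(_ i).
have [W [rW Wa]] := orth_basis ai0.
have [e e0 eP] := @strict_open I (fun j => j != i) a b z zj.
(* Used to rescale the spanning directions so that a step from [z] changes every coordinate by less
   than [e]. *)
pose M := 1 + `|W|; have M0 : 0 < M by rewrite ltr_pwDl.
exists z, ((e / 2 / M) *: W); split.
  by rewrite mxrank_scale_nz// gt_eqF// !divr_gt0.
have F x : dotp (a i) x = b i -> (forall j, `|z ord0 j - x ord0 j| < e) ->
    (P `&` hyperplane (a i) (b i)) x.
  move=> xi xe; split=> //; rewrite PE => j /=.
  by have [->|ji] := eqVneq j i; [rewrite xi|exact/ltW/eP].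
split; first by apply: F => // j; rewrite subrr normr0.
move=> k; apply: F; first by rewrite dotpD zi linearZ/= dotpZ Wa mulr0 addr0.
move=> j; rewrite !mxE opprD addNKr normrN normrM gtr0_norm ?divr_gt0//.
apply: (@le_lt_trans _ _ (e / 2)); last by rewrite gtr_pMr// invf_lt1// ltr1n.
rewrite mulrAC ler_pdivrMr// ler_pM2l ?divr_gt0//.
rewrite /M (@le_trans _ _ `|W|)// ?lerDr//.
rewrite [leRHS]/Num.norm/= mx_normrE.
by apply/bigmax_geP; right; exists (k, j).
Qed.

(** A minimal subfamily that still defines [P] is irredundant: dropping inequality [i] would enlarge
    the set, which produces a point violating [i] alone. *)
Lemma facet_system_exists P : is_polyhedron P -> interior P !=set0 ->
  exists (I : finType) (a : I -> V) (b : I -> R), facet_system P a b.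
Proof.
move=> [m [a [b PE]]] [x0 x0P].
pose Q (S : {set 'I_m}) := `[< P = [set x | forall i, i \in S -> dotp (a i) x <= b i] >].
have QT : Q [set: 'I_m]%SET.
  apply/asboolP; rewrite PE; apply/seteqP; split=> x /= h i; first by move=> _; exact: h.
  by apply: h; rewrite inE.
have [S /minsetP[/asboolP SE Smin]] : {S | minset Q S} by apply: ex_minset; exists [set: 'I_m]%SET.
pose I : finType := {i : 'I_m | i \in S}.
pose a' (i : I) := a (val i); pose b' (i : I) := b (val i).
have PE' : P = [set x | forall i : I, dotp (a' i) x <= b' i].
  rewrite SE; apply/seteqP; split=> x /= h; first by move=> [i iS]; exact: h.
  by move=> i iS; exact: (h (exist _ i iS)).
have ex_y (i : I) : exists y, (forall j : I, j != i -> dotp (a' j) y <= b' j) /\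
    b' i < dotp (a' i) y.
  apply: contrapT => /forallNP hy.
  have : Q (S :\ val i)%SET.
    apply/asboolP; rewrite {1}PE'; apply/seteqP; split=> x /= h j.
      by rewrite !inE => /andP[_ jS]; exact: (h (exist _ j jS)).
    have h' (j' : I) : j' != i -> dotp (a' j') x <= b' j'.
      by move=> ji; apply: h; rewrite !inE (valP j') andbT.
    have [->|/h'//] := eqVneq j i.
    by rewrite leNgt; apply/negP => hi; exact: hy x (conj h' hi).
  move=> /Smin/(_ (subD1set _ _))/setP/(_ (val i)).
  by rewrite !inE eqxx (valP i).
have x0' (i : I) : dotp (a' i) x0 < b' i.
  have hP x : P x -> dotp (a' i) x <= b' i by rewrite PE'; exact.
  apply: (@interior_dotp_lt P _ _ _ _ hP x0P); apply/eqP => ai0.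
  have [y [_]] := ex_y i; have := hP _ (interior_subset x0P).
  by rewrite ai0 !dotp0l => /le_lt_trans h /h; rewrite ltxx.
exists I, a', b'; split=> // i.
have [y [h1 h2]] := ex_y i.
exact: (@facet_of_irredundant P I a' b' i x0 y).
Qed.

Lemma measure_fin_cover_le d (T : measurableType d) (m : {measure set T -> \bar R})
    (I : finType) (A : set T) (F : I -> set T) :
  measurable A -> (forall i, measurable (F i)) -> A `<=` \bigcup_i F i ->
  (m A <= \sum_i m (F i))%E.
Proof.
move=> mA mF AF.
have H (s : seq I) : measurable (\big[setU/set0]_(i <- s) F i) /\
    (m (\big[setU/set0]_(i <- s) F i) <= \sum_(i <- s) m (F i))%E.
  elim: s => [|i s [ms IH]]; first by rewrite !big_nil measure0; split=> //; exact: measurable0.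
  rewrite !big_cons; split; first exact: measurableU.
  by apply: le_trans (measureU2 _ _ _) _ => //; exact: leeD2l.
apply: le_trans (H (index_enum I)).2; apply: le_measure; rewrite ?inE//; first exact: (H _).1.
move=> x /AF[i _ Fx]; rewrite -bigcup_seq; exists i => //=.
exact: mem_index_enum.
Qed.

Section FacetSystem.
Variables (P : set V) (I : finType) (a : I -> V) (b : I -> R).
Hypothesis fs : facet_system P a b.

Let PE : P = [set x | forall i, dotp (a i) x <= b i] := fs.1.

Lemma facet_normal_neq0 i : a i != 0.
Proof. by have [[]] := fs.2 i. Qed.

Lemma facet_interiorP x : interior P x <-> forall i, dotp (a i) x < b i.
Proof.
split=> [Px i|h].
  apply: (@interior_dotp_lt P _ _ _ (facet_normal_neq0 i)) => // y.
  by rewrite PE; exact.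
have [e e0 eP] := @strict_open I xpredT a b x (fun i _ => h i).
apply/(nbhs_rVP x P); exists e => // y xy; rewrite PE => i /=.
by apply: ltW; exact: eP.
Qed.

Lemma facet_boundary : boundary P = \bigcup_i (P `&` hyperplane (a i) (b i)).
Proof.
apply/seteqP; split=> [x [Px /facet_interiorP/existsNP[i /negP]]|x [i _ [Px xi]]].
  rewrite -leNgt => bx; exists i => //; split=> //; apply/eqP; rewrite eq_le bx andbT.
  by move: Px; rewrite PE; exact.
by split=> // /facet_interiorP/(_ i); rewrite xi ltxx.
Qed.

Lemma polytope_conv_interior x y t : P x -> interior P y -> 0 < t <= 1 ->
  interior P ((1 - t) *: x + t *: y).
Proof.
move=> Px /facet_interiorP Py /andP[t0 t1]; apply/facet_interiorP => i; rewrite dotp_conv.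
apply: (@lt_le_trans _ _ ((1 - t) * b i + t * b i)); last by rewrite -mulrDl subrK mul1r.
by rewrite ler_ltD ?ltr_pM2l// ler_wpM2l// ?subr_ge0//; move: Px; rewrite PE; exact.
Qed.

(** Boundedness yields a facet whose normal has positive product with [v], since otherwise the whole
    ray stays in [P]; among such facets, the one reached first is the exit. *)
Lemma polytope_exit x v : bounded_set P -> interior P x -> v != 0 ->
  exists t i, [/\ 0 < t, P (x + t *: v), dotp (a i) (x + t *: v) = b i & 0 < dotp (a i) v].
Proof.
move=> bP /facet_interiorP Px v0.
have [i0 iv] : exists i, 0 < dotp (a i) v.
  apply: contrapT => /forallNP h.
  have [M M0 PM] := bounded_sub_box bP.
  have [k vk] : exists k, v ord0 k != 0.
    apply: contrapT => /forallNP vk; case/eqP: v0; apply/rowP => k; rewrite mxE.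
    by apply/eqP/negPn/negP; exact: vk.
  pose t := (`|x ord0 k| + M) / `|v ord0 k|.
  have t0 : 0 <= t by rewrite divr_ge0// addr_ge0// ltW.
  have /PM/(_ k) : P (x + t *: v).
    rewrite PE => i /=; rewrite dotpD dotpZ -[leRHS]addr0 lerD//; first exact/ltW.
    by rewrite mulr_ge0_le0// leNgt; apply/negP.
  rewrite !mxE; apply/negP; rewrite -leNgt.
  have : `|(x ord0 k + t * v ord0 k) - x ord0 k| <= `|x ord0 k + t * v ord0 k| + `|x ord0 k|.
    exact: ler_normB.
  rewrite addrAC subrr add0r normrM ger0_norm// divfK ?normr_eq0//.
  by rewrite [X in X <= _]addrC lerD2r.
pose f i := (b i - dotp (a i) x) / dotp (a i) v.
case: (@arg_minP _ _ _ i0 (fun i => 0 < dotp (a i) v) f iv) => i iv' imin.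
exists (f i), i; split=> //.
- by rewrite divr_gt0// subr_gt0.
- rewrite PE => j /=; rewrite dotpD dotpZ -lerBrDl.
  have [jv|jv] := ltP 0 (dotp (a j) v); first by rewrite -ler_pdivlMr//; exact: imin.
  apply: (@le_trans _ _ 0); last by rewrite subr_ge0 ltW.
  by rewrite mulr_ge0_le0// ltW// divr_gt0// subr_gt0.
- by rewrite dotpD dotpZ /f divfK ?gt_eqF// addrC subrK.
Qed.

End FacetSystem.

(** * Measures of hyperplane pieces and of the boundary *)

Lemma hyperplane_closed a (b : R) : closed (hyperplane a b).
Proof.
rewrite (_ : hyperplane a b = dotp a @^-1` [set b]); last by [].
by apply: closed_comp (@closed_eq R b) => x _; exact: dotp_continuous.
Qed.

(** The translates of [A] by [a / (i + 1)] are pairwise disjoint, have equal mass and lie in one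
    fixed box, so every multiple of [mu A] is below the finite mass of that box. *)
Lemma lebesgue_hyperplane_null (mu : {measure set BorelV R n -> \bar R}) a b (A : set V) :
  lebesgue_like mu -> a != 0 -> measurable (A : set (BorelV R n)) -> bounded_set A ->
  A `<=` hyperplane a b -> mu A = 0%E.
Proof.
move=> hmu a0 mA bA Ah.
have [M M0 AM] := bounded_sub_box bA.
pose K := M + `|a|.
have mK : measurable (open_box K : set (BorelV R n)).
  by apply: open_measurableV; exact: open_box_open.
have Kfin : (mu (open_box K) < +oo)%E.
  by apply: lebesgue_bounded_lty => //; exact: open_box_bounded.
have Afin : mu A \is a fin_num.
  by rewrite ge0_fin_numE//; exact: lebesgue_bounded_lty.
have mT v : measurable (translate A v : set (BorelV R n)).
  rewrite translateE -[X in measurable X]setTI.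
  exact: (continuous_measurableV (@shift_continuous R n v)).
have H (N : nat) : (N%:R%:E * mu A <= mu (open_box K))%E.
  pose F (i : 'I_N) := translate A ((i.+1%:R^-1 : R) *: a).
  have -> : (N%:R%:E * mu A = mu (\bigcup_(i in [set` [set: 'I_N]%SET]) F i))%E.
    rewrite measure_fin_type_bigcup => [|i|i j x _ _].
    - under eq_bigr => i _ do rewrite hmu.1//.
      by rewrite mule_natl sumr_const cardsT card_ord.
    - exact: mT.
    - rewrite /F !translateE /= => /Ah xi /Ah xj; apply/val_inj/eqP => /=.
      have aa := dotp_self_gt0 a0.
      have : dotp a (x - i.+1%:R^-1 *: a) = dotp a (x - j.+1%:R^-1 *: a).
        by rewrite [LHS]xi [RHS]xj.
      rewrite -!scaleNr !dotpD !dotpZ => /addrI/(mulIf (lt0r_neq0 aa))/oppr_inj/invr_inj/eqP.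
      by rewrite eqr_nat eqSS.
  apply: le_measure; rewrite ?inE//.
    by apply: fin_bigcup_measurable => // i _; exact: mT.
  move=> x [i _]; rewrite /F translateE /= => /AM xi k; have := xi k; rewrite !mxE => xk.
  rewrite -[x ord0 k](subrK (i.+1%:R^-1 * a ord0 k)).
  apply: le_lt_trans (ler_normD _ _) _; apply: ltr_leD => //.
  rewrite normrM ger0_norm// -[leRHS]mul1r ler_pM//.
    by rewrite invf_le1// ler1n.
  exact: coord_norm_le.
apply/eqP; rewrite eq_le measure_ge0 andbT leNgt; apply/negP => A0.
have r0 : 0 < fine (mu A) by rewrite fine_gt0// A0 ltey_eq Afin.
have Kf : mu (open_box K) \is a fin_num by rewrite ge0_fin_numE.
pose N := Num.Def.archi_bound (fine (mu (open_box K)) / fine (mu A)).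
have := H N; rewrite -(fineK Afin) -(fineK Kf) -EFinM lee_fin -ler_pdivlMr// leNgt.
by rewrite archi_boundP// divr_ge0// fine_ge0.
Qed.

Section FacetSystemMeasure.
Variables (P : set V) (I : finType) (a : I -> V) (b : I -> R).
Hypothesis fs : facet_system P a b.
Hypothesis bP : bounded_set P.

Let PE : P = [set x | forall i, dotp (a i) x <= b i] := fs.1.

Lemma polytope_closed : closed P.
Proof.
rewrite PE (_ : [set x | _] = \bigcap_i [set x | dotp (a i) x <= b i]).
  apply: closed_bigI => i _.
  rewrite (_ : [set x | _] = dotp (a i) @^-1` [set y | y <= b i])//.
  by apply: closed_comp (@closed_le R (b i)) => x _; exact: dotp_continuous.
by apply/seteqP; split=> x h i; [move=> _|]; exact: h.
Qed.

Lemma polytope_measurable : measurable (P : set (BorelV R n)).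
Proof. by apply: closed_measurableV; exact: polytope_closed. Qed.

Lemma polytope_interior_measurable : measurable (interior P : set (BorelV R n)).
Proof. by apply: open_measurableV; exact: open_interior. Qed.

Lemma polytope_boundary_measurable : measurable (boundary P : set (BorelV R n)).
Proof.
apply: measurableD; first exact: polytope_measurable.
exact: polytope_interior_measurable.
Qed.

Lemma facet_measurable i : measurable (P `&` hyperplane (a i) (b i) : set (BorelV R n)).
Proof.
apply: (@measurableI _ (BorelV R n)); first exact: polytope_measurable.
by apply: closed_measurableV; exact: hyperplane_closed.
Qed.

Lemma boundary_null (mu : {measure set BorelV R n -> \bar R}) :
  lebesgue_like mu -> mu (boundary P) = 0%E.
Proof.
move=> hmu; apply/eqP; rewrite eq_le measure_ge0 andbT.
apply: (@le_trans _ _ (\sum_i mu (P `&` hyperplane (a i) (b i)))%E).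
  apply: measure_fin_cover_le; first exact: polytope_boundary_measurable.
  - exact: facet_measurable.
  - by rewrite (facet_boundary fs).
rewrite big1// => i _; apply: (@lebesgue_hyperplane_null mu (a i) (b i)) => //.
- exact: facet_normal_neq0 fs i.
- exact: facet_measurable.
- have [M M0 h] := bounded_sub_box bP; apply/bounded_rVP; exists M => x k [/h/(_ k)/ltW + _].
  exact.
Qed.

Lemma sigma_boundary_lty (sigma : {measure set BorelV R n -> \bar R}) :
  facet_measure P sigma -> (sigma (boundary P) < +oo)%E.
Proof.
move=> hs.
apply: (@le_lt_trans _ _ (\sum_i sigma (P `&` hyperplane (a i) (b i)))%E).
  apply: measure_fin_cover_le; first exact: polytope_boundary_measurable.
  - exact: facet_measurable.
  - by rewrite (facet_boundary fs).
apply: lte_sum_pinfty => i _.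
have [lam [c [[l0 lt lo] [c0 sE]]]] := hs _ _ _ (fs.2 i).
have := sE setT measurableT; rewrite setTI => ->.
have [M M0 PM] := bounded_sub_box bP.
have [x [Px xi]] : exists x, P x /\ dotp (a i) x = b i by have [[_ []]] := fs.2 i.
have [||_ fin] := lo (open_box M) (@open_box_open R n M) _ _.
- apply/bounded_rVP; exists M => y k [/(_ k)/ltW + _]; exact.
- by exists x; split=> //; exact: PM.
rewrite lte_mul_pinfty// ?lee_fin ?ltW//.
apply: le_lt_trans fin; apply: le_measure; rewrite ?inE.
- exact: facet_measurable.
- apply: (@measurableI _ (BorelV R n)); first by apply: open_measurableV; exact: open_box_open.
  by apply: closed_measurableV; exact: hyperplane_closed.
- by move=> y [Py yi]; split=> //; exact: PM.
Qed.

End FacetSystemMeasure.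

(** * Comparison of a facet with its shadow along a coordinate axis *)

Section FacetCylinder.
Variables (a : V) (b : R) (k : 'I_n).
Hypothesis ak : a ord0 k != 0.
Let J : pred 'I_n := predC1 k.

(** Projection onto the hyperplane along the [k]-th axis. It depends on the other coordinates only,
    so preimages under it are cylinders. *)
Definition slide (x : V) : V := x - ((dotp a x - b) / a ord0 k) *: delta_mx ord0 k.

Lemma dotp_delta : dotp a (delta_mx ord0 k) = a ord0 k.
Proof.
rewrite /dotp (bigD1 k)//= mxE !eqxx mulr1 big1 ?addr0// => i ik.
by rewrite mxE (negbTE ik) andbF mulr0.
Qed.

Lemma slide_hyperplane x : hyperplane a b (slide x).
Proof.
by rewrite /hyperplane/= /slide -scaleNr dotpD dotpZ dotp_delta mulNr divfK// opprB addrC subrK.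
Qed.

Lemma slide_id x : hyperplane a b x -> slide x = x.
Proof. by rewrite /hyperplane/= /slide => ->; rewrite subrr mul0r scale0r subr0. Qed.

Lemma slide_coord x i : J i -> slide x ord0 i = x ord0 i.
Proof. by move=> Ji; rewrite !mxE (negbTE Ji) andbF mulr0 subr0. Qed.

Lemma slide_cyl x y : (forall i, J i -> x ord0 i = y ord0 i) -> slide x = slide y.
Proof.
move=> xy.
have E : x = y + (x ord0 k - y ord0 k) *: delta_mx ord0 k.
  apply/rowP => i; rewrite !mxE eqxx/=; have [->|ik] := eqVneq i k.
    by rewrite mulr1 addrC subrK.
  by rewrite mulr0 addr0 xy.
rewrite /slide E dotpD dotpZ dotp_delta; apply/rowP => i; rewrite !mxE.
by field.
Qed.

Lemma slide_continuous : continuous slide.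
Proof.
apply: continuous_rV => i x.
rewrite (_ : (fun x => _) = (fun x : V => x ord0 i +
    (dotp a x - b) * - (a ord0 k)^-1 * (delta_mx ord0 k : V) ord0 i)); last first.
  by apply/funext => y; rewrite !mxE; ring.
apply: (@continuousD R R V _ _ x); first exact: coord_continuous.
apply: (@continuousM R V _ (fun=> _) x); last exact: (@cst_continuous V R).
apply: (@continuousM R V _ (fun=> _) x); last exact: (@cst_continuous V R).
apply: (@continuousB R R V _ _ x); first exact: dotp_continuous.
exact: (@cst_continuous V R).
Qed.

(** On the hyperplane, coordinate [k] is an affine function of the others. *)
Lemma hyperplane_coord_bound (A : set V) :
  (forall x i, A x -> J i -> `|x ord0 i| <= 1) -> bounded_set (A `&` hyperplane a b).
Proof.
move=> A1; apply/bounded_rVP.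
exists (1 + (`|b| + \sum_(i < n) `|a ord0 i|) / `|a ord0 k|) => x i [Ax xb].
have S0 : 0 <= (`|b| + \sum_(i < n) `|a ord0 i|) / `|a ord0 k|.
  by rewrite divr_ge0// addr_ge0// sumr_ge0.
have [->|ik] := eqVneq i k; last first.
  by rewrite (@le_trans _ _ 1)// ?lerDl//; exact: A1.
rewrite (@le_trans _ _ ((`|b| + \sum_(i < n) `|a ord0 i|) / `|a ord0 k|))// ?lerDr//.
rewrite ler_pdivlMr ?normr_gt0// -normrM.
move: xb; rewrite /hyperplane/= /dotp (bigD1 k)//= => /eqP; rewrite eq_sym -subr_eq => /eqP.
rewrite [x _ _ * _]mulrC => <-; apply: le_trans (ler_normB _ _) _; rewrite lerD2l.
rewrite [leRHS](bigD1 k)//= ler_wpDl//; apply: le_trans (ler_norm_sum _ _ _) _.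
apply: ler_sum => j jk; rewrite normrM ler_piMr//; exact: A1.
Qed.

End FacetCylinder.

Lemma dcol_translate_gen (J : pred 'I_n) l (z : 'I_n -> int) (v : V) :
  (forall i, J i -> v ord0 i = (z i)%:~R / 2 ^+ l) ->
  dcol J l z = translate (dcol J l (fun=> 0)) v.
Proof.
move=> vz; rewrite dcol_translate !translateE; apply/seteqP.
by split=> x h i Ji; have := h i Ji; rewrite !mxE vz.
Qed.

(* The shadow of the facet along [e_k] and the facet measure are both invariant
   measures on cylinders, hence proportional; this replaces an area formula. *)
Lemma facet_cylinder_comparison (mu lam : {measure set BorelV R n -> \bar R}) a b (k : 'I_n) :
  lebesgue_like mu -> hyperplane_lebesgue a b lam -> a ord0 k != 0 ->
  exists2 C : R, 0 <= C & forall E, measurable (E : set (BorelV R n)) ->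
    E `<=` hyperplane a b ->
    (mu ((slide a b k @^-1` E) `&` [set x : V | (0 <= x ord0 k < 1)%R]) <= C%:E * lam E)%E.
Proof.
move=> hmu [l0 lT lO] ak.
pose J : pred 'I_n := predC1 k.
have mstrip := measurable_strip k (0 : R) 1.
(* Cutting with a unit strip gives the columns along [e_k] finite mass. *)
pose tau : {measure set BorelV R n -> \bar R} := mrestr mu mstrip.
have tauE A : tau A = mu (A `&` [set x : V | 0 <= x ord0 k < 1]) by [].
have mH : measurable (hyperplane a b : set (BorelV R n)).
  by apply: closed_measurableV; exact: hyperplane_closed.
have lamH A : measurable (A : set (BorelV R n)) -> lam A = lam (A `&` hyperplane a b).
  move=> mA; rewrite (measureDI lam mA mH) [X in (X + _)%E](_ : _ = 0%E) ?add0e//.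
  apply/eqP; rewrite eq_le measure_ge0 andbT -l0; apply: le_measure; rewrite ?inE.
  - exact: measurableD.
  - exact: measurableC.
  - by move=> x [].
have lamJ l (z : 'I_n -> int) : lam (dcol J l z) = lam (dcol J l (fun=> 0)).
  (* [v0] is corrected along [e_k] to become parallel to the hyperplane, where [lam] is invariant;
     the column is insensitive to coordinate [k]. *)
  pose v0 : V := \row_i ((z i)%:~R / 2 ^+ l).
  pose v := slide a 0 k v0.
  rewrite (@dcol_translate_gen J l z v) => [|i Ji].
    apply: lT; first exact: measurable_dcol.
    exact: (@slide_hyperplane a 0 k ak v0).
  by rewrite /v slide_coord// mxE.
have tauJ l (z : 'I_n -> int) : tau (dcol J l z) = tau (dcol J l (fun=> 0)).
  (* The shift has no component along [e_k], so it preserves the strip. *)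
  pose v : V := \row_i (if J i then (z i)%:~R / 2 ^+ l else 0).
  have xvk x : (x - v) ord0 k = x ord0 k by rewrite 3!mxE /J/= eqxx subr0.
  rewrite (@dcol_translate_gen J l z v) => [|i Ji]; last by rewrite mxE Ji.
  rewrite !tauE -(@hmu.1 (dcol J l (fun=> 0) `&` [set x : V | 0 <= x ord0 k < 1]) v).
    congr (mu _); rewrite !translateE; apply/seteqP.
    by split=> x [] /= h h'; split=> //; move: h'; rewrite xvk.
  by apply: (@measurableI _ (BorelV R n)) => //; exact: measurable_dcol.
have col1 x i : dcol J 0 (fun=> 0) x -> J i -> `|x ord0 i| <= 1.
  move=> /dcol_floorP h Ji; have := h i Ji; rewrite expr0 !divr1 add0r => /andP[x0 x1].
  by rewrite ger0_norm// ltW.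
have H0 : hyperplane a b !=set0 by exists (slide a b k 0); exact: slide_hyperplane.
have colfin : (lam (dcol J 0 (fun=> 0%R)) < +oo)%E.
  rewrite lamH; last exact: measurable_dcol.
  have /bounded_sub_box[M M0 hM] := @hyperplane_coord_bound a b k ak (dcol J 0 (fun=> 0)) col1.
  have HM : open_box M `&` hyperplane a b !=set0.
    pose x1 : V := slide a b k 0; exists x1; split; last exact: slide_hyperplane.
    apply: hM; split; last exact: slide_hyperplane.
    by move=> i Ji; rewrite /x1 slide_coord// mxE mulr0 floor0.
  have [|//|_ fin] := lO (open_box M) (@open_box_open R n M).
    by apply/bounded_rVP; exists M => x i [/(_ i)/ltW].
  apply: le_lt_trans fin; apply: le_measure; rewrite ?inE.
  - by apply: (@measurableI _ (BorelV R n)) => //; exact: measurable_dcol.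
  - apply: (@measurableI _ (BorelV R n)) => //.
    by apply: open_measurableV; exact: open_box_open.
  - by move=> x [xc xb]; split=> //; exact: hM.
have colgt : (0 < lam (dcol J 0 (fun=> 0%R)))%E.
  (* The open cylinder around the axis of the unit column meets the hyperplane, so [lam] is positive
     on their intersection. *)
  pose c : V := \row_i 2^-1.
  pose U : set V := [set x | forall i, J i -> `|x ord0 i - 2^-1| < 2^-1].
  have oU : open U.
    rewrite openE => x xU.
    suff : \forall y \near (x : V), forall i, J i -> `|(y : V) ord0 i - 2^-1| < 2^-1 by [].
    apply: (@filter_forall _ _ (fun i (y : V) => J i -> `|y ord0 i - 2^-1| < 2^-1)
      (nbhs (x : V))) => i.
    have [Ji|nJi] := boolP (J i); last exact: filterE.
    have oi : open ((fun x : V => x ord0 i) @^-1` (ball (2^-1 : R) 2^-1)).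
      apply: open_comp; first by move=> y _; exact: coord_continuous.
      exact: ball_open.
    have xi : ((fun x : V => x ord0 i) @^-1` (ball (2^-1 : R) 2^-1)) x.
      by rewrite /= /ball/= distrC; exact: xU.
    by have := open_nbhs_nbhs (conj oi xi); apply: filterS => y; rewrite /ball/= distrC.
  have Ucol : U `<=` dcol J 0 (fun=> 0).
    move=> x xU; apply/dcol_floorP => i Ji; have := xU i Ji; rewrite expr0 !divr1 add0r.
    by rewrite ltr_norml => /andP[h1 h2]; apply/andP; split; lra.
  have [||+ _] := lO U oU.
  - by apply: (@hyperplane_coord_bound a b k ak) => x i /Ucol; exact: col1.
  - exists (slide a b k c); split; last exact: slide_hyperplane.
    by move=> i Ji; rewrite slide_coord// mxE subrr normr0 invr_gt0.
  move=> /lt_le_trans; apply; apply: le_measure; rewrite ?inE.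
  - by apply: (@measurableI _ (BorelV R n)) => //; exact: open_measurableV.
  - exact: measurable_dcol.
  - by move=> x [/Ucol].
have taufin : (tau (dcol J 0 (fun=> 0%R)) < +oo)%E.
  rewrite tauE; apply: (lebesgue_bounded_lty hmu).
    by apply: (@measurableI _ (BorelV R n)) => //; exact: measurable_dcol.
  apply/bounded_rVP; exists 1 => x i [xc /= /andP[x0 x1]].
  have [->|ik] := eqVneq i k; last exact: col1.
  by rewrite ger0_norm// ltW.
set A := lam (dcol _ _ _) in colfin colgt *; set T := tau (dcol _ _ _) in taufin *.
have Af : A \is a fin_num by rewrite ge0_fin_numE// ltW.
have Tf : T \is a fin_num by rewrite ge0_fin_numE// measure_ge0.
have A0 : 0 < fine A by rewrite fine_gt0// colgt ltey_eq Af.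
exists (fine T / fine A) => [|E mE EH].
  by rewrite divr_ge0// fine_ge0// ?measure_ge0// ltW.
have mD : measurable (slide a b k @^-1` E : set (BorelV R n)).
  rewrite -[X in measurable X]setTI.
  exact: (continuous_measurableV (@slide_continuous a b k)).
have TA : (T * lam (slide a b k @^-1` E) = A * tau (slide a b k @^-1` E))%E.
  apply: (@cylinder_measure_unique R n J lam tau lamJ tauJ colfin taufin _ mD).
  by move=> x y xy /=; rewrite (slide_cyl b ak xy).
rewrite -tauE.
(* [slide] fixes the hyperplane, which carries [lam], so the cylinder over [E] has the mass of
   [E]. *)
have lD : lam (slide a b k @^-1` E) = lam E.
  rewrite lamH//; congr (lam _); apply/seteqP; split=> x.
    by move=> [/= h xH]; rewrite -(slide_id k xH).
  by move=> Ex; have xH := EH x Ex; split=> //=; rewrite (slide_id k xH).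
rewrite -[X in (X <= _)%E]mul1e -(mulVf (lt0r_neq0 A0)) EFinM -muleA fineK// -TA lD.
by rewrite mulrC EFinM fineK// muleA.
Qed.

End Polyhedra.

(** * The Loomis-Whitney inequality on a finite grid *)

Section DiscreteLoomisWhitney.
Variables (R : realType) (n N : nat).
Local Notation T := {ffun 'I_n -> 'I_N}.

Definition upd (z : T) (j : 'I_n) (s : 'I_N) : T := [ffun i => if i == j then s else z i].

(** Partial sums remain functions on the full grid, constant in the summed coordinate. The index
    type never changes, at the price of a factor [N] in totals ([sum_coord_sum]). *)
Definition coord_sum (j : 'I_n) (f : T -> R) : T -> R := fun z => \sum_(s < N) f (upd z j s).

Definition coord_sums (r : seq 'I_n) (f : T -> R) : T -> R := foldr coord_sum f r.

Definition indep (j : 'I_n) (f : T -> R) := forall z s, f (upd z j s) = f z.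

Lemma upd_upd z j s t : upd (upd z j s) j t = upd z j t.
Proof. by apply/ffunP => i; rewrite !ffunE; case: eqP. Qed.

Lemma upd_comm z i j s t : i != j -> upd (upd z i s) j t = upd (upd z j t) i s.
Proof.
move=> ij; apply/ffunP => k; rewrite !ffunE.
by have [->|] := eqVneq k j; rewrite // eq_sym (negbTE ij).
Qed.

Lemma upd_id z j : upd z j (z j) = z.
Proof. by apply/ffunP => i; rewrite ffunE; case: eqP => [->|]. Qed.

Lemma coord_sum_indep j f : indep j (coord_sum j f).
Proof. by move=> z s; apply: eq_bigr => t _; rewrite upd_upd. Qed.

Lemma coord_sum_indep_neq i j f : indep i f -> indep i (coord_sum j f).
Proof.
have [<- _|ij fi z s] := eqVneq i j; first exact: coord_sum_indep.
by apply: eq_bigr => t _; rewrite upd_comm// fi.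
Qed.

Lemma coord_sums_indep i r f : indep i f \/ i \in r -> indep i (coord_sums r f).
Proof.
elim: r => [[]//|j r IH h] /=.
have [ij|ij] := eqVneq i j; first by rewrite ij; exact: coord_sum_indep.
apply: coord_sum_indep_neq; apply: IH; case: h; first by left.
by rewrite inE (negbTE ij) /=; right.
Qed.

Lemma coord_sum_le j f g : (forall z, f z <= g z) -> forall z, coord_sum j f z <= coord_sum j g z.
Proof. by move=> fg z; apply: ler_sum. Qed.

Lemma coord_sums_ge0 r f : (forall z, 0 <= f z) -> forall z, 0 <= coord_sums r f z.
Proof. by move=> f0; elim: r => //= j r IH z; apply: sumr_ge0. Qed.

(** The involution exchanging [z j] with the summation index makes the summand independent of the
    second variable. *)
Lemma sum_coord_sum j f : \sum_z coord_sum j f z = N%:R * \sum_z f z.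
Proof.
rewrite /coord_sum pair_bigA/=.
pose h (p : T * 'I_N) : T * 'I_N := (upd p.1 j p.2, p.1 j).
have hK : involutive h.
  by move=> [z s]; rewrite /h/= upd_upd ffunE eqxx upd_id.
rewrite (reindex_inj (inv_inj hK))/=.
under eq_bigr => p _ do rewrite upd_upd upd_id.
rewrite -(pair_bigA _ (fun z s => f z))/= mulr_sumr; apply: eq_bigr => z _.
by rewrite sumr_const card_ord mulr_natl.
Qed.

Lemma sum_coord_sums r f : \sum_z coord_sums r f z = N%:R ^+ size r * \sum_z f z.
Proof. by elim: r => [|j r IH] /=; rewrite ?mul1r// sum_coord_sum IH exprS mulrA. Qed.

Lemma indep_const f : (forall j, indep j f) -> forall z w, f z = f w.
Proof.
move=> fi z w.
have H (k : nat) : (k <= n)%N -> f [ffun i : 'I_n => if (i < k)%N then w i else z i] = f z.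
  elim: k => [_|k IH kn]; first by congr f; apply/ffunP => i; rewrite ffunE.
  rewrite -IH ?(ltnW kn)// -[RHS](fi (Ordinal kn) _ (w (Ordinal kn))); congr f.
  apply/ffunP => i; rewrite !ffunE ltnS leq_eqVlt -(inj_eq val_inj)/=.
  have [ik|//] := eqVneq (i : nat) k.
  by congr (w _); apply/val_inj.
rewrite -(H n)//; congr f; apply/ffunP => i; by rewrite ffunE ltn_ord.
Qed.

Lemma sum_const f z0 : (forall j, indep j f) -> \sum_z f z = N%:R ^+ n * f z0.
Proof.
move=> fi; rewrite (eq_bigr (fun=> f z0)) => [|z _]; last exact: indep_const.
by rewrite sumr_const card_ffun !card_ord -natrX mulr_natl.
Qed.

Lemma powR_prod (I : finType) (Q : pred I) (x : I -> R) (p : R) :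
  (forall i, 0 <= x i) -> (\prod_(i | Q i) x i) `^ p = \prod_(i | Q i) (x i) `^ p.
Proof.
move=> x0.
have [_ ->//] : 0 <= \prod_(i | Q i) x i /\ (\prod_(i | Q i) x i) `^ p = \prod_(i | Q i) (x i) `^ p.
elim/big_rec2: _ => [|i a c _ [c0 <-]]; first by rewrite powR1.
by split; [rewrite mulr_ge0|rewrite powRM].
Qed.

Lemma prod_root_le_mean (I : finType) (Q : pred I) (x : I -> R) :
  (0 < #|Q|)%N -> (forall i, 0 <= x i) ->
  \prod_(i | Q i) (x i) `^ (#|Q|%:R^-1) <= (\sum_(i | Q i) x i) / #|Q|%:R.
Proof.
move=> Q0 x0; have m0 : (0 : R) < #|Q|%:R by rewrite ltr0n.
have S0 : 0 <= (\sum_(i | Q i) x i) / #|Q|%:R by rewrite divr_ge0 ?sumr_ge0// ltW.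
rewrite -powR_prod//.
set A := leRHS in S0 *.
apply: (@le_trans _ _ ((A ^+ #|Q|) `^ (#|Q|%:R^-1))); last first.
  by rewrite -powR_mulrn// -powRrM mulfV ?gt_eqF// powRr1.
apply: ge0_ler_powR; rewrite ?nnegrE ?invr_ge0 ?prodr_ge0 ?exprn_ge0// ?(ltW m0)//.
have [+ _] := @leif_AGM R I (mem Q) x (fun i _ => x0 i).
exact.
Qed.

(** Divide each [g i] by its sum and apply the inequality of means at every [s]; the resulting means
    sum to 1. If some sum vanishes, the left side is zero. *)
Lemma hoelder_roots (I : finType) (Q : pred I) (g : I -> 'I_N -> R) :
  (0 < #|Q|)%N -> (forall i s, 0 <= g i s) ->
  \sum_s \prod_(i | Q i) (g i s) `^ (#|Q|%:R^-1) <=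
  \prod_(i | Q i) (\sum_s g i s) `^ (#|Q|%:R^-1).
Proof.
move=> Q0 g0; have m0 : (0 : R) < #|Q|%:R by rewrite ltr0n.
have S0 i : 0 <= \sum_s g i s by apply: sumr_ge0.
have [/existsP[i /andP[Qi /eqP Si]]|/existsPn nz] :=
    boolP [exists i, Q i && (\sum_s g i s == 0)].
  rewrite big1 ?prodr_ge0// => [i' _|s _]; first exact: powR_ge0.
  rewrite (bigD1 i)//=.
  have /eqP : \sum_s g i s = 0 by [].
  rewrite psumr_eq0// => /allP/(_ s); rewrite mem_index_enum => /(_ isT)/implyP/(_ isT)/eqP ->.
  by rewrite powR0 ?mul0r// invr_neq0// gt_eqF.
have Sp i : Q i -> 0 < \sum_s g i s.
  by move=> Qi; rewrite lt_neqAle S0 andbT eq_sym; have := nz i; rewrite Qi.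
set PS := \prod_(i | Q i) (\sum_s g i s) `^ _.
apply: (@le_trans _ _ (\sum_s PS * ((\sum_(i | Q i) g i s / \sum_t g i t) / #|Q|%:R))).
  apply: ler_sum => s _.
  apply: (@le_trans _ _ (PS * \prod_(i | Q i) (g i s / \sum_t g i t) `^ (#|Q|%:R^-1))).
    rewrite -big_split/=; apply: ler_prod => i Qi; rewrite powR_ge0/=.
    by rewrite -powRM ?divr_ge0// mulrCA mulfV ?mulr1// gt_eqF// Sp.
  rewrite ler_wpM2l ?prodr_ge0// => [i _|]; first exact: powR_ge0.
  by apply: prod_root_le_mean => // i; rewrite divr_ge0.
rewrite -mulr_sumr -mulr_suml exchange_big/=.
rewrite (eq_bigr (fun=> 1)) => [|i Qi]; last by rewrite -mulr_suml mulfV// gt_eqF// Sp.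
by rewrite sumr_const mulfV ?mulr1// gt_eqF.
Qed.

(* Hoelder's inequality, one coordinate at a time: [f j] does not depend on
   coordinate [j], so summing over it only involves the [n.-1] other factors. *)
Lemma coord_sums_roots (f : 'I_n -> T -> R) r : (1 < n)%N -> uniq r ->
  (forall i z, 0 <= f i z) -> (forall i, indep i (f i)) ->
  forall z, coord_sums r (fun z => \prod_i (f i z) `^ (n.-1%:R^-1)) z <=
    \prod_i (coord_sums (rem i r) (f i) z) `^ (n.-1%:R^-1).
Proof.
move=> n1 + f0 fi; elim: r => [_ z|j r IH /= /andP[jr ur] z]; first by [].
apply: le_trans (coord_sum_le _ (IH ur) z) _.
have card : #|predC1 j| = n.-1 by rewrite cardC1 card_ord.
pose B i := coord_sums (rem i r) (f i).
have Bj s : B j (upd z j s) = B j z by apply: coord_sums_indep; left.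
have remj i : rem i (j :: r) = if j == i then r else j :: rem i r by [].
rewrite [leRHS](bigD1 j)//= eqxx.
have -> : coord_sum j (fun z => \prod_i (coord_sums (rem i r) (f i) z) `^ (n.-1%:R^-1)) z =
    (B j z) `^ (n.-1%:R^-1) * \sum_s \prod_(i | predC1 j i) (B i (upd z j s)) `^ (n.-1%:R^-1).
  rewrite mulr_sumr; apply: eq_bigr => s _.
  by rewrite (bigD1 j)//= -/(B j (upd z j s)) Bj.
rewrite /B rem_id//; apply: ler_wpM2l; first exact: powR_ge0.
have := @hoelder_roots 'I_n (predC1 j) (fun i s => B i (upd z j s)).
rewrite card => /(_ _ _)/le_trans; apply.
- by rewrite -subn1 subn_gt0.
- by move=> i s; exact: coord_sums_ge0.
- by apply: ler_prod => i /= ij; rewrite powR_ge0/= [j == i]eq_sym (negbTE ij).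
Qed.

(** The power of [g] is a product of [n] copies of its root of order [n.-1], each bounded through
    one [f i]. As [f i] is constant in coordinate [i], its total is [N] times the sum over the
    projected grid; hence [N%:R * K] in the hypothesis. *)
Lemma discrete_loomis_whitney (f : 'I_n -> T -> R) (g : T -> R) (K : R) : (1 < n)%N -> (0 < N)%N ->
  (forall z, 0 <= g z) -> (forall i z, g z <= f i z) -> (forall i, indep i (f i)) ->
  (forall i, \sum_z f i z <= N%:R * K) ->
  \sum_z (g z) `^ (n%:R / (n%:R - 1)) <= K `^ (n%:R / (n%:R - 1)).
Proof.
move=> n1 N0 g0 gf fi fK.
have n0 : (0 < n)%N by exact: ltnW.
have m0 : (0 : R) < n.-1%:R by rewrite ltr0n -subn1 subn_gt0.
have NR : (0 : R) < N%:R by rewrite ltr0n.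
have f0 i z : 0 <= f i z by exact: le_trans (gf i z).
have mE : n%:R - 1 = n.-1%:R :> R by rewrite -subn1 natrB.
rewrite mE.
have powE (x : R) : 0 <= x -> x `^ (n%:R / n.-1%:R) = \prod_(i < n) x `^ (n.-1%:R^-1).
  by move=> x0; rewrite prodr_const card_ord mulrC powRrM powR_mulrn ?powR_ge0.
have pz : 'I_N by exact: (Ordinal N0).
pose z0 : T := [ffun=> pz].
have K0 : 0 <= K.
  have := fK (Ordinal n0); rewrite -ler_pdivrMl//; apply: le_trans.
  by rewrite mulr_ge0 ?invr_ge0 ?sumr_ge0// ltW.
rewrite powE//.
apply: (@le_trans _ _ (\sum_z \prod_i (f i z) `^ (n.-1%:R^-1))).
  apply: ler_sum => z _; rewrite powE//; apply: ler_prod => i _; rewrite powR_ge0/=.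
  by apply: ge0_ler_powR; rewrite ?invr_ge0 ?nnegrE// ltW.
(* The constant value is the total of [h], divided by [N] once for each of the [n - size r]
   coordinates not summed. *)
have E (h : T -> R) r : (forall j, indep j (coord_sums r h)) ->
    coord_sums r h z0 = N%:R ^+ size r * (\sum_z h z) / N%:R ^+ n.
  move=> hi; rewrite -sum_coord_sums (sum_const z0 hi) mulrC mulKf//.
  by rewrite expf_neq0// gt_eqF.
have := @coord_sums_roots f (enum 'I_n) n1 (enum_uniq _) f0 fi z0.
rewrite E; last by move=> j; apply: coord_sums_indep; right; rewrite mem_enum.
rewrite size_enum_ord mulrAC mulfV ?mul1r ?expf_neq0 ?gt_eqF// => /le_trans; apply.
apply: ler_prod => i _; rewrite powR_ge0/=.
apply: ge0_ler_powR; rewrite ?invr_ge0 ?nnegrE ?coord_sums_ge0// ?(ltW m0)//.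
rewrite E => [|j]; last first.
  apply: coord_sums_indep; have [->|ji] := eqVneq j i; first by left; exact: fi.
  by right; rewrite (mem_rem_uniq _ (enum_uniq _)) !inE ji mem_enum.
rewrite size_rem ?mem_enum// size_enum_ord ler_pdivrMr ?exprn_gt0//.
rewrite -[in leRHS](prednK n0) exprS [leRHS]mulrA [leRHS]mulrC; apply: ler_wpM2l.
  by rewrite exprn_ge0// ltW.
by rewrite mulrC.
Qed.

End DiscreteLoomisWhitney.

(** * The L^p bound by the boundary integral *)

Section IntegralBound.
Variables (R : realType) (n : nat).
Local Notation V := 'rV[R]_n.
Local Notation B := (BorelV R n).
Local Notation bmeas D u := (@measurable_fun _ _ B (\bar R) D u).

Lemma lsc_on_measurable (P : set V) (u : V -> \bar R) :
  measurable (P : set B) -> lsc_on P u -> bmeas P u.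
Proof.
move=> mP lu; apply: (measurability _ (ErealGenOInfty.measurableE R)).
move=> /= _ [_ [r ->]] <-; rewrite preimage_itvoy.
pose O := \bigcup_(W in [set W : set V | open W /\ forall y, W y -> P y -> (r%:E < u y)%E]) W.
have -> : P `&` [set x | (r%:E < u x)%E] = P `&` O.
  apply/seteqP; split=> x [Px].
    move=> /(lu x r Px)[W xW Wu]; split=> //; exists (interior W); last exact: xW.
    by split=> [|y /interior_subset]; [exact: open_interior|exact: Wu].
  by move=> [W [_ Wu] Wx]; split=> //; exact: Wu.
apply: (@measurableI _ B) => //; apply: open_measurableV.
by apply: bigcup_open => W [].
Qed.

(** The one consequence of log-convexity on which the L^p bound rests; it makes sense for infinite
    values as well. *)
Definition quasiconvex_on (P : set V) (u : V -> \bar R) : Prop :=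
  forall x y (t : R), P x -> P y -> 0 <= t <= 1 ->
    (u ((1 - t) *: x + t *: y)%R <= maxe (u x) (u y))%E.

Variables (mu sigma : {measure set B -> \bar R}) (P : set V).
Variables (I : finType) (a : I -> V) (b : I -> R).
Hypotheses (hmu : lebesgue_like mu) (hsigma : facet_measure P sigma).
Hypotheses (fs : facet_system P a b) (bP : bounded_set P).

Let mP : measurable (P : set B) := polytope_measurable fs.
Let mdP : measurable (boundary P : set B) := polytope_boundary_measurable fs.
Let miP : measurable (interior P : set B) := polytope_interior_measurable P.

Lemma facet_projection_le (k : 'I_n) (i : I) : a i ord0 k != 0 ->
  exists2 C : R, 0 <= C & forall E, measurable (E : set B) ->
    E `<=` P `&` hyperplane (a i) (b i) ->
    (mu ((slide (a i) (b i) k @^-1` E) `&` [set x : V | (0 <= x ord0 k < 1)%R]) <=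
     C%:E * sigma E)%E.
Proof.
move=> ak; have [lam [c [hl [c0 sE]]]] := hsigma (fs.2 i).
have [C C0 hC] := facet_cylinder_comparison hmu hl ak.
exists (C / c) => [|E mE EF]; first by rewrite divr_ge0// ltW.
apply: le_trans (hC E mE _) _; first by move=> x /EF[].
have := sE E mE; rewrite (setIidl EF) => ->.
by rewrite EFinM -muleA [(c^-1%:E * _)%E]muleA -EFinM mulVf ?mul1e// gt_eqF.
Qed.

Lemma strip_column_measure (k : 'I_n) l (z : 'I_n -> int) :
  mu (dcol (predC1 k) l z `&` [set x : V | 0 <= x ord0 k < 1]) =
  ((2 ^+ l)%:E * mu (dcol xpredT l (fun=> 0%R)))%E.
Proof.
have l0 : (0 : R) < 2 ^+ l by rewrite exprn_gt0.
have lN : (2 ^ l)%:R = 2 ^+ l :> R by rewrite natrX.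
pose w (s : 'I_(2 ^ l)) : 'I_n -> int := fun i => if i == k then (s : nat)%:Z else z i.
have -> : dcol (predC1 k) l z `&` [set x : V | 0 <= x ord0 k < 1] =
    \bigcup_(s in [set` [set: 'I_(2 ^ l)]%SET]) dcol xpredT l (w s).
  apply/seteqP; split=> [x [xz /= /andP[x0 x1]]|x [s _] xs].
    have f0 : 0 <= Num.floor (2 ^+ l * x ord0 k) by rewrite floor_ge0 mulr_ge0// ltW.
    have H : (`|Num.floor (2 ^+ l * x ord0 k)|%N < 2 ^ l)%N.
      by rewrite -ltz_nat gez0_abs// floor_lt_int -pmulrn lN gtr_pMr.
    exists (Ordinal H); first by rewrite /= inE.
    move=> i _; rewrite /w; have [->|ik] := eqVneq i k; first by rewrite /= gez0_abs.
    exact: xz.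
  split=> [i /negbTE /= ik|/=]; first by rewrite (xs i isT) /w ik.
  have /dcol_floorP/(_ k isT) := xs; rewrite /w eqxx => /andP[x0 x1]; apply/andP; split.
    by apply: le_trans x0; rewrite divr_ge0// ltW.
  apply: lt_le_trans x1 _; rewrite ler_pdivrMr// mul1r -lN.
  by rewrite intrD -[X in _ + X]/(1%:R) -pmulrn -natrD addn1 ler_nat.
rewrite measure_fin_type_bigcup => [|s|s t x _ _ xs xt].
- under eq_bigr do rewrite (lebesgue_dcol hmu).
  by rewrite -lN mule_natl sumr_const cardsT card_ord.
- exact: measurable_dcol.
- apply/val_inj/eqP => /=; have := xs k isT; have := xt k isT; rewrite /w eqxx => -> /eqP.
  by rewrite eqz_nat eq_sym.
Qed.

(* A line in direction [e_k] through a cell where [u >= r] meets the boundary in two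
   points, and quasiconvexity gives [u >= r] at one of them. *)
Lemma column_superlevel (k : 'I_n) : exists2 C : R, 0 <= C &
  forall (u : V -> \bar R) l (z w : 'I_n -> int) (r : R),
  bmeas (boundary P) u -> quasiconvex_on P u ->
  (forall i, i != k -> z i = w i) ->
  dcol xpredT l w `<=` interior P -> (forall x, dcol xpredT l w x -> (r%:E <= u x)%E) ->
  ((2 ^+ l)%:E * mu (dcol xpredT l (fun=> 0%R)) <=
   C%:E * sigma ((boundary P `&` dcol (predC1 k) l z) `&` [set x | (r%:E <= u x)%E]))%E.
Proof.
(* Facets parallel to [e_k] get the constant 0: the exit facets of a line in direction [e_k] are
   never among them. *)
have CP i : exists C : R, 0 <= C /\ (a i ord0 k != 0 -> forall E, measurable (E : set B) ->
    E `<=` P `&` hyperplane (a i) (b i) ->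
    (mu ((slide (a i) (b i) k @^-1` E) `&` [set x : V | (0 <= x ord0 k < 1)%R]) <=
     C%:E * sigma E)%E).
  have [ak|ak] := eqVneq (a i ord0 k) 0; first by exists 0.
  by have [C C0 hC] := facet_projection_le ak; exists C.
have [C hC] := choice CP.
exists (\sum_i C i) => [|u l z w r mu_ qu zw wP wr].
  by apply: sumr_ge0 => i _; exact: (hC i).1.
rewrite -(strip_column_measure k l z).
set L := (boundary P `&` _) `&` _.
have mL : measurable (L : set B).
  rewrite /L -setIA [X in _ `&` X]setIC setIA; apply: (@measurableI _ B); last exact: measurable_dcol.
  exact: emeasurable_fun_c_infty.
(* [E i] is the part of the superlevel set on facet [i], and [D i] its shadow along [e_k] cut to the
   unit strip; the shadows cover the column within the strip. *)
pose E i := if a i ord0 k == 0 then set0 else L `&` (P `&` hyperplane (a i) (b i)).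
have mE i : measurable (E i : set B).
  rewrite /E; case: ifP => _; first exact: measurable0.
  by apply: (@measurableI _ B) => //; exact: facet_measurable fs i.
have mstrip := measurable_strip k (0 : R) 1.
pose D i : set V := (slide (a i) (b i) k @^-1` E i) `&` [set x : V | 0 <= x ord0 k < 1].
have mD i : measurable (D i : set B).
  rewrite /D /E; have [ak|ak] := eqVneq (a i ord0 k) 0.
    by rewrite preimage_set0 set0I; exact: measurable0.
  apply: (@measurableI _ B) => //; rewrite -[X in measurable X]setTI.
  apply: (continuous_measurableV (@slide_continuous _ _ (a i) (b i) k)) => //.
  by have := mE i; rewrite /E (negbTE ak).
apply: (@le_trans _ _ (\sum_i mu (D i))%E).
  apply: measure_fin_cover_le => //.
    by apply: (@measurableI _ B) => //; exact: measurable_dcol.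
  move=> x [xz xk].
  have key p i : P p -> dotp (a i) p = b i -> a i ord0 k != 0 -> (r%:E <= u p)%E ->
      (forall j, j != k -> p ord0 j = x ord0 j) -> (\bigcup_i D i) x.
    move=> Pp pi aik up px; exists i => //; split=> //.
    have sx : slide (a i) (b i) k x = p.
      by rewrite -(slide_id k pi); apply: slide_cyl => // j jk; rewrite px.
    rewrite /= sx /E (negbTE aik); split; last by split.
    split=> //; split; first by rewrite (facet_boundary fs); exists i.
    by move=> j jk /=; rewrite px//; exact: xz.
  pose e : V := delta_mx ord0 k.
  (* A point of the cell [w] on the line through [x] in direction [e_k]. *)
  pose c := x + ((w k)%:~R / 2 ^+ l - x ord0 k) *: e.
  have cj j : c ord0 j = if j == k then (w k)%:~R / 2 ^+ l else x ord0 j.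
    rewrite !mxE eqxx /=; have [->|jk] := eqVneq j k; first by rewrite mulr1 addrC subrK.
    by rewrite mulr0 addr0.
  have cw : dcol xpredT l w c.
    move=> j _; rewrite cj; have [->|jk] := eqVneq j k.
      by rewrite mulrC divfK ?expf_neq0// intrKfloor.
    by rewrite (xz j jk) zw.
  have e0 : e != 0.
    by apply/eqP => /rowP/(_ k)/eqP; rewrite !mxE !eqxx oner_eq0.
  have Ne0 : - e != 0 by rewrite oppr_eq0.
  have ci := wP _ cw.
  have [t1 [i1 [t10 P1 H1 d1]]] := polytope_exit fs bP ci e0.
  have [t2 [i2 [t20 P2 H2 d2]]] := polytope_exit fs bP ci Ne0.
  have s0 : 0 < t1 + t2 by rewrite addr_gt0.
  have cE (c' e' : V) :
      c' = (1 - t1 / (t1 + t2)) *: (c' + t1 *: e') + (t1 / (t1 + t2)) *: (c' + t2 *: - e').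
    apply/rowP => j; rewrite !mxE; field; exact: lt0r_neq0.
  have ne1 : a i1 ord0 k != 0 by move: d1; rewrite dotp_delta => /lt0r_neq0.
  have ne2 : a i2 ord0 k != 0.
    by move: d2; rewrite -scaleN1r dotpZ dotp_delta mulN1r oppr_gt0 => /ltr0_neq0.
  have off t p j : j != k -> (c + t *: (p *: e)) ord0 j = x ord0 j.
    by move=> jk; rewrite mxE cj (negbTE jk) !mxE (negbTE jk) andbF !mulr0 addr0.
  have t01 : 0 <= t1 / (t1 + t2) <= 1.
    by rewrite divr_ge0 ?(ltW t10) ?(ltW s0)//= ler_pdivrMr// mul1r lerDl ltW.
  have := qu _ _ _ P1 P2 t01; rewrite -(cE c e) => /(le_trans (wr c cw)); rewrite le_max => /orP[up|up].
    by apply: key P1 H1 ne1 up _ => j jk; rewrite -[e]scale1r off.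
  by apply: key P2 H2 ne2 up _ => j jk; rewrite -[- e]scaleN1r off.
have s0 i : 0 <= C i by exact: (hC i).1.
rewrite -sumEFin ge0_sume_distrl// => [|i _]; last by rewrite lee_fin.
apply: lee_sum => i _; rewrite /D /E.
have [ak|ak] := eqVneq (a i ord0 k) 0.
  by rewrite preimage_set0 set0I measure0 mule_ge0// lee_fin.
have mLi : measurable (L `&` (P `&` hyperplane (a i) (b i)) : set B).
  by have := mE i; rewrite /E (negbTE ak).
apply: le_trans ((hC i).2 ak _ mLi _) _; first by move=> y [].
apply: lee_wpmul2l; first by rewrite lee_fin.
by apply: le_measure; rewrite ?inE// => y [].
Qed.

Lemma limn_einf_sup_einfs (f : (\bar R)^nat) : limn_einf f = ereal_sup (range (einfs f)).
Proof. by rewrite limn_einf_lim; apply: cvg_lim => //; exact: cvg_einfs_sup. Qed.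

Lemma limn_einf_ge (f : (\bar R)^nat) (c : \bar R) N :
  (forall j, (N <= j)%N -> (c <= f j)%E) -> (c <= limn_einf f)%E.
Proof.
move=> h; rewrite limn_einf_sup_einfs; apply: (@le_trans _ _ (einfs f N)).
  by apply: le_ereal_inf_tmp => _ [j /= Nj <-]; exact: h.
by apply: ereal_sup_ubound; exists N.
Qed.

Lemma limn_einf_lt (f : (\bar R)^nat) (c : \bar R) :
  (limn_einf f < c)%E -> forall N, exists2 j, (N <= j)%N & (f j < c)%E.
Proof.
move=> h N; apply: contrapT => /forall2NP hN; move: h; apply/negP; rewrite -leNgt.
apply: (@limn_einf_ge _ _ N) => j Nj; rewrite leNgt; apply/negP.
by case: (hN j).
Qed.

Lemma limn_einf_le (f : (\bar R)^nat) (c : \bar R) :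
  (forall j, (f j <= c)%E) -> (limn_einf f <= c)%E.
Proof.
move=> h; rewrite limn_einf_sup_einfs; apply: ge_ereal_sup => _ [j _ <-].
by apply: le_trans (h j); apply: ereal_inf_lbound; exists j => /=.
Qed.

Lemma sum_integral_disjoint_le (m : {measure set B -> \bar R}) (D : set V) (u : V -> \bar R)
    (T : finType) (S : {set T}) (F : T -> set V) :
  measurable (D : set B) -> bmeas D u -> (forall x, D x -> (0 <= u x)%E) ->
  (forall t, measurable (F t : set B)) -> (forall t, F t `<=` D) ->
  (forall s t x, s \in S -> t \in S -> F s x -> F t x -> s = t) ->
  (\sum_(t in S) \int[m]_(x in F t) u x <= \int[m]_(x in D) u x)%E.
Proof.
move=> mD mu_ u0 mF FD Fdisj.
rewrite -big_enum/=.
have UD : \big[setU/set0]_(i <- enum S) F i `<=` D.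
  by rewrite -bigcup_seq => x [i _]; exact: FD.
have mU : measurable (\big[setU/set0]_(i <- enum S) F i : set B).
  by apply: (@bigsetU_measurable _ B).
rewrite -(@ge0_integral_bigsetU _ B R m T F u (enum S)) //.
- exact: ge0_subset_integral.
- exact: enum_uniq.
- by move=> s t /=; rewrite !mem_enum => sS tS [x [xs xt]]; exact: Fdisj xs xt.
- exact: (@measurable_funS _ _ B _ D).
- by move=> x /UD; exact: u0.
Qed.

(* Truncated at [M] so that the infimum is finite where [u] is infinite. *)
Definition cell_low (u : V -> \bar R) (l M : nat) (z : 'I_n -> int) : R :=
  if `[< dcol xpredT l z `<=` interior P >]
  then fine (ereal_inf [set mine (u x) M%:R%:E | x in dcol xpredT l z]) else 0.

Section CellLow.
Variables (u : V -> \bar R) (u0 : forall x, P x -> (0 <= u x)%E) (l M : nat).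

Lemma cell_low_fin z : dcol xpredT l z `<=` interior P ->
  ((cell_low u l M z)%:E = ereal_inf [set mine (u x) M%:R%:E | x in dcol xpredT l z])%E.
Proof.
move=> zP; rewrite /cell_low asboolT// fineK//.
have [U [_ [x Ux] Uz]] := @cell_interior R n l z.
rewrite ge0_fin_numE.
  apply: (@le_lt_trans _ _ (M%:R%:E)); last exact: ltry.
  apply: (@le_trans _ _ (mine (u x) M%:R%:E)).
    by apply: ereal_inf_lbound; exists x => //; exact: Uz.
  by rewrite ge_min lexx orbT.
apply: le_ereal_inf_tmp => _ [y yz <-]; rewrite le_min lee_fin ler0n andbT.
by apply: u0; apply: interior_subset; exact: zP.
Qed.

Lemma cell_low_ge0 z : 0 <= cell_low u l M z.
Proof.
rewrite /cell_low; case: asboolP => // zP; apply: fine_ge0.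
apply: le_ereal_inf_tmp => _ [y yz <-]; rewrite le_min lee_fin ler0n andbT.
by apply: u0; apply: interior_subset; exact: zP.
Qed.

Lemma cell_low_le z x : dcol xpredT l z `<=` interior P -> dcol xpredT l z x ->
  ((cell_low u l M z)%:E <= u x)%E.
Proof.
move=> zP zx; rewrite cell_low_fin//; apply: (@le_trans _ _ (mine (u x) M%:R%:E)).
  by apply: ereal_inf_lbound; exists x.
by rewrite ge_min lexx.
Qed.

Lemma le_cell_low z r : dcol xpredT l z `<=` interior P -> r <= M%:R ->
  (forall x, dcol xpredT l z x -> (r%:E <= u x)%E) -> r <= cell_low u l M z.
Proof.
move=> zP rM h; rewrite -lee_fin cell_low_fin//.
by apply: le_ereal_inf_tmp => _ [y yz <-]; rewrite le_min h//= lee_fin.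
Qed.

Lemma cell_low_gt0 z : 0 < cell_low u l M z -> dcol xpredT l z `<=` interior P.
Proof. by rewrite /cell_low; case: asboolP => //; rewrite ltxx. Qed.

End CellLow.

(** The shift lets ordinals index the level-[l] cells that tile the cube from [- K] to [K]. *)
Definition grid_idx (K l : nat) (z : {ffun 'I_n -> 'I_(2 * K * 2 ^ l)}) : 'I_n -> int :=
  fun i => (z i : nat)%:Z - (K * 2 ^ l)%N%:Z.

Lemma exists_grid_idx K l (x : V) : (forall i, `|x ord0 i| < K%:R) ->
  exists z : {ffun 'I_n -> 'I_(2 * K * 2 ^ l)}, grid_idx z = cellidx l x.
Proof.
move=> xK.
have l0 : (0 : R) < 2 ^+ l by rewrite exprn_gt0.
have lN : (2 ^ l)%:R = 2 ^+ l :> R by rewrite natrX.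
pose c i : int := cellidx l x i + (K * 2 ^ l)%N%:Z.
have H i : 0 <= c i /\ (`|c i|%N < 2 * K * 2 ^ l)%N.
  have := xK i; rewrite ltr_norml => /andP[x1 x2].
  have f0 : 0 <= c i.
    rewrite /c -lerBlDr sub0r /cellidx floor_ge_int intrN -pmulrn natrM lN mulrC -mulrN.
    by rewrite ler_pM2l// ltW.
  split=> //; rewrite -ltz_nat gez0_abs// /c -ltrBrDr /cellidx floor_lt_int.
  rewrite intrB -!pmulrn !natrM lN -mulrBl (_ : 2%:R * K%:R - K%:R = K%:R); last by ring.
  by rewrite mulrC ltr_pM2r.
exists [ffun i => Ordinal (H i).2]; apply/funext => i.
by rewrite /grid_idx ffunE /= gez0_abs ?(H i).1// /c addrK.
Qed.

Lemma markov_superlevel (m : {measure set B -> \bar R}) (D : set V) (u : V -> \bar R) (r : R) :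
  measurable (D : set B) -> bmeas D u -> (forall x, D x -> (0 <= u x)%E) ->
  (r%:E * m (D `&` [set x | (r%:E <= u x)%E]) <= \int[m]_(x in D) u x)%E.
Proof.
move=> mD mu_ u0.
have mDr : measurable (D `&` [set x | (r%:E <= u x)%E] : set B).
  exact: emeasurable_fun_c_infty.
have mDu : bmeas (D `&` [set x | (r%:E <= u x)%E]) u.
  by apply: measurable_funS mu_ => // x [].
have [r0|r0] := leP 0 r; last first.
  apply: (@le_trans _ _ 0%E); last exact: integral_ge0.
  by rewrite mule_le0_ge0// lee_fin ltW.
rewrite -integral_cst//; apply: (@le_trans _ _ (\int[m]_(x in D `&` [set x | (r%:E <= u x)%E]) u x)%E).
  apply: ge0_le_integral => //; by move=> x [].
by apply: ge0_subset_integral => // x [].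
Qed.

(** The largest cell minimum of a column bounds [u] from below on a boundary set whose mass
    [column_superlevel] controls; Markov's inequality turns this into an integral over the boundary
    part of the column. The factor [2 * K * 2 ^ l] appears since each column is indexed once for
    every value of [z k]. *)
Lemma column_sum_le (k : 'I_n) : exists2 C : R, 0 <= C &
  forall (u : V -> \bar R) (K l M : nat) (U0 : R),
  bmeas (boundary P) u -> (forall x, P x -> (0 <= u x)%E) -> quasiconvex_on P u ->
  (\int[sigma]_(x in boundary P) u x <= U0%:E)%E ->
  \sum_(z : {ffun 'I_n -> 'I_(2 * K * 2 ^ l)})
    (\big[Num.max/0]_(s < 2 * K * 2 ^ l) cell_low u l M (grid_idx (upd z k s))) <=
  (2 * K * 2 ^ l)%:R * (C * U0 / (2 ^+ l * fine (mu (dcol xpredT l (fun=> 0%R))))).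
Proof.
have [C C0 hC] := column_superlevel k; exists C => // u K l M U0 mu_ u0 qu uU.
set N := (2 * K * 2 ^ l)%N.
have m0 := lebesgue_cell_gt0 hmu l (fun=> 0); have mfin := lebesgue_cell_lty hmu l (fun=> 0).
set mE := mu (dcol xpredT l (fun=> 0%R)) in m0 mfin *.
have mf : mE \is a fin_num by rewrite ge0_fin_numE// ltW.
have mp : 0 < fine mE by rewrite fine_gt0// m0 ltey_eq mf.
have l0 : (0 : R) < 2 ^+ l by rewrite exprn_gt0.
set d := 2 ^+ l * fine mE; have d0 : 0 < d by rewrite mulr_gt0.
pose T := {ffun 'I_n -> 'I_N}.
pose G (z : T) := \big[Num.max/0]_(s < N) cell_low u l M (grid_idx (upd z k s)).
pose L (z : T) := boundary P `&` dcol (predC1 k) l (grid_idx z).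
have mL z : measurable (L z : set B).
  by apply: (@measurableI _ B) => //; exact: measurable_dcol.
have ubd x : boundary P x -> (0 <= u x)%E by move=> [/u0].
have mLu z : bmeas (L z) u by apply: measurable_funS mu_ => // x [].
have key z : ((G z * d)%:E <= C%:E * \int[sigma]_(x in L z) u x)%E.
  have R0 : (0 <= C%:E * \int[sigma]_(x in L z) u x)%E.
    by rewrite mule_ge0 ?lee_fin// integral_ge0// => x [/ubd].
  have [G0|G0] := leP (G z) 0.
    by apply: le_trans R0; rewrite lee_fin pmulr_lle0.
  have [s _ Gs] : {s : 'I_N | s \in xpredT & G z = cell_low u l M (grid_idx (upd z k s))}.
    by apply: (eq_bigmax (z k)) => // s _; exact: cell_low_ge0.
  have sub : dcol xpredT l (grid_idx (upd z k s)) `<=` interior P.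
    by apply: (@cell_low_gt0 u l M); rewrite -Gs.
  apply: (@le_trans _ _ ((G z)%:E * (C%:E * sigma (L z `&` [set x | ((G z)%:E <= u x)%E])))%E).
    rewrite EFinM lee_pmul2l// /d EFinM fineK//; apply: (hC u l (grid_idx z) (grid_idx (upd z k s)) (G z)) => //.
      by move=> i ik; rewrite /grid_idx ffunE (negbTE ik).
    by move=> x xs; rewrite Gs; exact: (@cell_low_le u u0 l M _ x sub xs).
  rewrite muleCA; apply: lee_wpmul2l; first by rewrite lee_fin.
  by apply: markov_superlevel => // x [/ubd].
(* With [z k] fixed, distinct indices give disjoint columns. *)
have fiber (s : 'I_N) : (\sum_(z : T | z k == s) \int[sigma]_(x in L z) u x <=
    \int[sigma]_(x in boundary P) u x)%E.
  have := @sum_integral_disjoint_le sigma (boundary P) u _ [set z : T | z k == s]%SET L.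
  rewrite (eq_bigl (fun z : T => z k == s)) => [|z]; last by rewrite inE.
  apply => //; first by move=> z x [].
  move=> z w x; rewrite !inE => /eqP zs /eqP ws [_ xz] [_ xw]; apply/ffunP => i.
  have [->|ik] := eqVneq i k; first by rewrite zs ws.
  by apply/val_inj; have := xz i ik; rewrite (xw i ik) /grid_idx => /addIr[].
have tot : (\sum_(z : T) \int[sigma]_(x in L z) u x <= N%:R%:E * U0%:E)%E.
  rewrite (partition_big (fun z : T => z k) xpredT)//=.
  apply: (@le_trans _ _ (\sum_(s < N) U0%:E)%E).
    by apply: lee_sum => s _; apply: le_trans (fiber s) uU.
  by rewrite mule_natl sumr_const card_ord.
rewrite mulrA ler_pdivlMr// mulr_suml -lee_fin -sumEFin.
apply: (@le_trans _ _ (\sum_(z : T) C%:E * \int[sigma]_(x in L z) u x)%E).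
  by apply: lee_sum => z _; exact: key.
rewrite -ge0_sume_distrr => [|z _]; last by apply: integral_ge0 => x [/ubd].
apply: le_trans (lee_wpmul2l _ tot) _; first by rewrite lee_fin.
by rewrite -!EFinM lee_fin mulrCA.
Qed.

Lemma measurable_limn_einf d (T : measurableType d) (D : set T) (f : (T -> \bar R)^nat) :
  (forall j, measurable_fun D (f j)) -> measurable_fun D (fun x => limn_einf (f ^~ x)).
Proof.
move=> mf.
rewrite (_ : (fun x => _) = (fun x => - limn_esup (fun j => - f j x))%E); last first.
  by apply/funext => x; rewrite -[in RHS]limn_einfN; congr limn_einf; apply/funext => j /=; rewrite oppeK.
apply: (measurableT_comp (@oppe_measurable R setT)).
apply: (@measurable_fun_limn_esup _ T R D (fun j x => - f j x)%E) => j.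
by apply: (measurableT_comp (@oppe_measurable R setT)); exact: mf.
Qed.

Lemma integral_interior (f : V -> \bar R) : bmeas P f -> (forall x, P x -> (0 <= f x)%E) ->
  (\int[mu]_(x in P) f x = \int[mu]_(x in interior P) f x)%E.
Proof.
move=> mf f0.
have PU : interior P `|` boundary P = P.
  apply/seteqP; split=> x; first by move=> [/interior_subset|[]].
  by have [|] := pselect (interior P x); [left|right].
have disj : [disjoint interior P & boundary P].
  by apply/disj_setPS => x [xi [_ /(_ xi)]].
rewrite -{1}PU ge0_integral_setU//; last 2 first.
- by rewrite PU.
- by rewrite PU.
rewrite (@null_set_integral _ B R mu (boundary P))// ?adde0//.
  by apply: measurable_funS mf => // x [].
exact: (boundary_null fs bP hmu).
Qed.

Lemma cell_measure_scale l : fine (mu (dcol xpredT 0 (fun=> 0))) =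
  (2 ^+ l) ^+ n * fine (mu (dcol xpredT l (fun=> 0%R))).
Proof.
rewrite (@dcol_measure_split R n xpredT mu l) => [|k z]; last exact: lebesgue_dcol.
rewrite (_ : offset_idx l xpredT = [set: _]%SET); last first.
  by apply/setP => z; rewrite !inE; apply/forallP.
rewrite cardsT card_ffun !card_ord fineM// ?ge0_fin_numE ?lebesgue_cell_lty//.
by rewrite /= !natrX.
Qed.

(** Real test values [r] below [x] also handle [x = +oo]. In the proof, [r] is the p-th root of a
    number strictly between the two sides. *)
Lemma poweR_le_limn_einf (x : \bar R) (p : R) (h : (\bar R)^nat) : 0 < p -> (0 <= x)%E ->
  (forall j, (0 <= h j)%E) ->
  (forall r : R, 0 <= r -> (r%:E < x)%E ->
     exists N, forall j, (N <= j)%N -> ((r `^ p)%:E <= h j)%E) ->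
  (x `^ p <= limn_einf h)%E.
Proof.
move=> p0 x0 h0 H; rewrite leNgt; apply/negP => Lx.
have L0 : (0 <= limn_einf h)%E by apply: (@limn_einf_ge _ _ 0).
have [c /andP[Lc cx]] : exists c : R, (limn_einf h < c%:E)%E && (c%:E < x `^ p)%E.
  case: (limn_einf h) L0 Lx => [L| |] L0; [|by rewrite ltNge leey|by []].
  case: (x `^ p)%E => [y| |]//=.
    rewrite lte_fin => Ly; exists ((L + y) / 2); rewrite !lte_fin.
    by rewrite midf_lt//= midf_lt.
  by move=> _; exists (L + 1); rewrite lte_fin ltrDl ltr01 ltry.
have c0 : 0 <= c by rewrite -lee_fin (le_trans L0)// ltW.
have cE : (c `^ p^-1) `^ p = c by rewrite -powRrM mulVf ?gt_eqF// powRr1.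
have [|N hN] := H (c `^ p^-1) (powR_ge0 _ _).
  rewrite ltNge; apply/negP => xc; move: cx; apply/negP; rewrite -leNgt.
  rewrite -cE -poweR_EFin; apply: gt0_ler_poweR => //; first exact: ltW.
  - by rewrite in_itv/= x0 leey.
  - by rewrite in_itv/= lee_fin powR_ge0 leey.
by move: Lc; apply/negP; rewrite -leNgt -cE; exact: limn_einf_ge hN.
Qed.

Definition crit_exp : R := n%:R / (n%:R - 1).

(** Step functions built from the cell minima approach [u] from below by lower semicontinuity, so
    Fatou applies once their integrals are bounded uniformly in the level [l]. Since
    [m l = m 0 / 2 ^ (l n)], the ratio of [m l] to the p-th power of [2 ^ l * m l] is independent of
    [l] exactly for [p = n / (n - 1)]; its value at [l = 0] gives the constant. *)
Lemma boundary_Lp_bound : (1 < n)%N -> exists2 C : R, 0 <= C &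
  forall (u : V -> \bar R) (U0 : R), lsc_on P u -> (forall x, P x -> (0 <= u x)%E) ->
  quasiconvex_on P u -> (\int[sigma]_(x in boundary P) u x <= U0%:E)%E ->
  (\int[mu]_(x in P) (u x `^ crit_exp) <= (C * U0 `^ crit_exp)%:E)%E.
Proof.
move=> n1; set p := crit_exp.
have n10 : (0 : R) < n%:R - 1 by rewrite subr_gt0 ltr1n.
have p0 : 0 < p by rewrite divr_gt0// ltr0n ltnW.
have [C hC] := choice (fun k => (let: ex_intro2 C C0 h := column_sum_le k in
  ex_intro (fun C : R => 0 <= C /\ _) C (conj C0 h))).
pose A := \sum_k C k.
have A0 : 0 <= A by apply: sumr_ge0 => k _; exact: (hC k).1.
have CA k : C k <= A.
  by rewrite /A (bigD1 k)//= lerDl sumr_ge0// => j _; exact: (hC j).1.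
have [M M0 PM] := bounded_sub_box bP.
pose K := Num.Def.archi_bound M.
have MK : M < K%:R by apply: archi_boundP; exact: ltW.
have K0 : (0 < K)%N by rewrite -(ltr0n R); exact: lt_trans MK.
pose m l := fine (mu (dcol xpredT l (fun=> 0%R))).
have m0 l : 0 < m l.
  rewrite fine_gt0// lebesgue_cell_gt0//= ltey_eq ge0_fin_numE ?lebesgue_cell_lty//.
exists (A `^ p * m 0%N / (m 0%N) `^ p) => [|u U0 lu u0 qu uU].
  by rewrite divr_ge0 ?powR_ge0// mulr_ge0 ?powR_ge0// ltW.
have mu_ : bmeas P u by exact: lsc_on_measurable.
have mbu : bmeas (boundary P) u by apply: measurable_funS mu_ => // x [].
have U00 : 0 <= U0.
  by rewrite -lee_fin; apply: le_trans uU; apply: integral_ge0 => x [/u0].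
pose N l := (2 * K * 2 ^ l)%N.
(* The truncation level grows with the mesh level, so no value is lost in the limit. *)
pose g l (z : {ffun 'I_n -> 'I_(N l)}) : R := cell_low u l l (grid_idx z).
have g0 l z : 0 <= g l z by exact: cell_low_ge0.
have LW l : \sum_z (g l z) `^ p * m l <= A `^ p * m 0%N / (m 0%N) `^ p * U0 `^ p.
  have q0 : (0 : R) < 2 ^+ l by rewrite exprn_gt0.
  pose f (i : 'I_n) z := \big[Num.max/0]_(s < N l) cell_low u l l (grid_idx (upd z i s)).
  have L1 : \sum_z (g l z) `^ p <= (A * U0 / (2 ^+ l * m l)) `^ p.
    apply: (@discrete_loomis_whitney R n (N l) f) => //.
    - by rewrite /N !muln_gt0 K0 expn_gt0.
    - move=> i z; rewrite -{1}(upd_id z i).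
      by apply/bigmax_geP; right; exists (z i).
    - by move=> i z s; rewrite /f; apply: eq_bigr => t _; rewrite upd_upd.
    - move=> i; apply: le_trans ((hC i).2 u K l l U0 mbu u0 qu uU) _.
      rewrite ler_wpM2l// ler_wpM2r ?invr_ge0 ?mulr_ge0 ?(ltW (m0 l)) ?(ltW q0)//.
      by rewrite ler_wpM2r.
  have qm : 0 < 2 ^+ l * m l by rewrite mulr_gt0.
  (* This property of the critical exponent is what cancels the powers of [2 ^+ l] in [key]. *)
  have np : n%:R * p = n%:R + p by rewrite /p /crit_exp; field; exact: lt0r_neq0.
  have key : m l * (m 0%N) `^ p = m 0%N * (2 ^+ l * m l) `^ p.
    have -> : m 0%N = (2 ^+ l) ^+ n * m l by exact: cell_measure_scale.
    rewrite !powRM ?exprn_ge0 ?(ltW (m0 l)) ?(ltW q0)//.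
    have -> : ((2 ^+ l) ^+ n) `^ p = (2 ^+ l) ^+ n * (2 ^+ l) `^ p :> R.
      rewrite -powR_mulrn ?(ltW q0)// -powRrM np powRD//.
      by rewrite (gt_eqF q0) implybT.
    by ring.
  rewrite -mulr_suml; apply: le_trans (ler_wpM2r (ltW (m0 l)) L1) _.
  rewrite !powRM ?invr_ge0 ?mulr_ge0 ?(ltW (m0 l)) ?(ltW q0)//.
  have kp : 0 < (m 0%N) `^ p by exact: powR_gt0.
  have kq : 0 < (2 ^+ l * m l) `^ p by exact: powR_gt0.
  have -> : ((2 ^+ l * m l)^-1) `^ p = ((2 ^+ l * m l) `^ p)^-1.
    by rewrite -(@powR_inv1 _ (2 ^+ l * m l) (ltW qm)) -powRrM mulN1r powRN.
  rewrite le_eqVlt; apply/orP; left; apply/eqP.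
  transitivity (A `^ p * U0 `^ p * (m l * (m 0%N) `^ p) / ((2 ^+ l * m l) `^ p * (m 0%N) `^ p)).
    by field; rewrite !gt_eqF.
  by rewrite key; field; rewrite !gt_eqF.
pose ind l z x := ((g l z `^ p)%:E * (\1_(dcol xpredT l (grid_idx z) : set B) x)%:E)%E.
pose h l x := (\sum_(z : {ffun 'I_n -> 'I_(N l)}) ind l z x)%E.
have mcell l (z : {ffun 'I_n -> 'I_(N l)}) :
    measurable (dcol xpredT l (grid_idx z) : set B) by exact: measurable_dcol.
have m1 l z D : @measurable_fun _ _ B (\bar R) D
    (fun x => (\1_(dcol xpredT l (@grid_idx K l z) : set B) x)%:E).
  by apply/measurable_EFinP; exact: measurable_indic.
have ind0 l z x : (0 <= ind l z x)%E by rewrite mule_ge0 ?lee_fin ?powR_ge0.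
have mind l z D : bmeas D (ind l z) by apply: measurable_funeM.
have h0 l x : (0 <= h l x)%E by apply: sume_ge0.
have mh l D : bmeas D (h l) by apply: emeasurable_sum.
have hint l : (\int[mu]_(x in interior P) h l x <=
    (A `^ p * m 0%N / (m 0%N) `^ p * U0 `^ p)%:E)%E.
  apply: (@le_trans _ _ (\sum_z (g l z `^ p * m l)%:E)%E); last by rewrite sumEFin lee_fin.
  rewrite ge0_integral_sum//; apply: lee_sum => z _.
  rewrite ge0_integralZl_EFin// ?powR_ge0//.
  rewrite integral_indic// EFinM lee_wpmul2l ?lee_fin ?powR_ge0//.
  rewrite /m -(lebesgue_dcol hmu l (grid_idx z)) fineK ?ge0_fin_numE ?lebesgue_cell_lty//.
  by apply: le_measure; rewrite ?inE//; exact: (@measurableI _ B).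
have mup : bmeas P (fun x => (u x `^ p)%E).
  exact: (measurableT_comp (measurable_poweR p) mu_).
rewrite integral_interior//; last by move=> x _; exact: poweR_ge0.
apply: (@le_trans _ _ (\int[mu]_(x in interior P) limn_einf (h ^~ x))%E).
  apply: ge0_le_integral => //.
  - by move=> x _; exact: poweR_ge0.
  - by apply: measurable_funS mup => //; exact: interior_subset.
  - by apply: measurable_limn_einf => l; exact: mh.
  move=> x Px; apply: poweR_le_limn_einf => // [|r r0 rx]; first by apply: u0; exact: interior_subset.
  have [W xW hW] := lu x r (interior_subset Px) rx.
  have nW : nbhs x (W `&` interior P).
    by apply: filterI => //; apply: open_nbhs_nbhs; split=> //; exact: open_interior.
  have [k hk] := cell_sub_nbhs nW.
  (* From this level on, the cell of [x] lies where [u] exceeds [r], and the truncation level is at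
     least [r]. *)
  exists (maxn k (Num.Def.archi_bound r)) => l; rewrite geq_max => /andP[kl rl].
  have [z zE] := @exists_grid_idx K l x (fun i => lt_trans (PM _ (interior_subset Px) i) MK).
  have sub := hk l kl; rewrite -zE in sub.
  have xz : dcol xpredT l (grid_idx z) x by rewrite zE => i _.
  apply: (@le_trans _ _ (ind l z x)); last first.
    by rewrite /h (bigD1 z)//= leeDl// sume_ge0.
  rewrite /ind indicE mem_set// mule1 lee_fin; apply: ge0_ler_powR; rewrite ?nnegrE ?(ltW p0)//.
  apply: le_cell_low => // [y /sub[]//||y /sub[Wy /interior_subset Py]].
  - by rewrite (le_trans (ltW (archi_boundP r0)))// ler_nat.
  - by apply: ltW; exact: hW.
apply: le_trans (@fatou _ B R mu _ miP h _ _) _ => //.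
by apply: limn_einf_le.
Qed.

End IntegralBound.

(** * Log-convexity in linear form *)

Section LogConvex.
Variables (R : realType) (n : nat).
Local Notation V := 'rV[R]_n.

(* Linear form of log-convexity: [a^(1-t) b^t] is the infimum over [l > 0] of
   [(1-t) l^t a + t l^(t-1) b], so it is stable under sums and limits. *)
Definition lin_logconvex (P : set V) (u : V -> \bar R) : Prop :=
  forall x y (t l : R), P x -> P y -> 0 < t < 1 -> 0 < l ->
    (u ((1 - t) *: x + t *: y)%R <=
     ((1 - t) * l `^ t)%:E * u x + (t * l `^ (t - 1))%:E * u y)%E.

(** Young's inequality with exponents [1 / (1 - t)] and [1 / t], for the weighted quantities
    [l ^ t * a] and [l ^ (t - 1) * b]: in the product the powers of [l] cancel. *)
Lemma weighted_AMGM (a b t l : R) : 0 <= a -> 0 <= b -> 0 < t < 1 -> 0 < l ->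
  a `^ (1 - t) * b `^ t <= (1 - t) * l `^ t * a + t * l `^ (t - 1) * b.
Proof.
move=> a0 b0 /andP[t0 t1] l0.
have s0 : 0 < 1 - t by rewrite subr_gt0.
have lp e : 0 <= l `^ e by exact: powR_ge0.
have := @conjugate_powR R ((l `^ t * a) `^ (1 - t)) ((l `^ (t - 1) * b) `^ t) (1 - t)^-1 t^-1
  (powR_ge0 _ _) (powR_ge0 _ _).
rewrite !invr_gt0 !invrK => /(_ s0 t0); rewrite subrK => /(_ erefl).
rewrite -2!powRrM (mulfV (lt0r_neq0 s0)) (mulfV (lt0r_neq0 t0)).
rewrite (powRr1 (mulr_ge0 (lp _) a0)) (powRr1 (mulr_ge0 (lp _) b0)).
rewrite !powRM// -2!powRrM.
rewrite mulrACA -powRD; last by rewrite (gt_eqF l0) implybT.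
rewrite (_ : t * (1 - t) + (t - 1) * t = 0); last by ring.
rewrite powRr0 mul1r => /le_trans; apply.
by rewrite le_eqVlt; apply/orP; left; apply/eqP; ring.
Qed.

Lemma logconvex_lin (P : set V) (u : V -> \bar R) :
  (forall x, P x -> (0 < u x)%E) -> logconvex_on P u -> lin_logconvex P u.
Proof.
move=> u0 lu x y t l Px Py /andP[t0 t1] l0.
have c1 : 0 < (1 - t) * l `^ t by rewrite mulr_gt0 ?subr_gt0 ?powR_gt0.
have c2 : 0 < t * l `^ (t - 1) by rewrite mulr_gt0 ?powR_gt0.
have ux := u0 _ Px; have uy := u0 _ Py.
case Ex : (u x) ux => [rx| |]// rx0; last first.
  have H : (0 <= (t * l `^ (t - 1))%:E * u y)%E by rewrite mule_ge0 ?lee_fin ?(ltW c2) ?(ltW uy).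
  by rewrite gt0_muley ?lte_fin// addye ?leey// gt_eqF// (lt_le_trans _ H)// ltNy0.
case Ey : (u y) uy => [ry| |]// ry0; last first.
  by rewrite [X in (_ + X)%E]gt0_muley ?lte_fin// addey ?leey.
have t01 : 0 <= t <= 1 by rewrite !ltW.
apply: le_trans (lu x y t Px Py t01 rx ry Ex Ey) _.
by rewrite -!EFinM -EFinD lee_fin; apply: weighted_AMGM; rewrite ?t0 ?t1// -lee_fin ltW.
Qed.

Lemma lin_logconvex_conv (P : set V) (u : V -> \bar R) :
  (forall x, P x -> (0 < u x)%E) -> lin_logconvex P u -> logconvex_on P u.
Proof.
move=> u0 lu x y t Px Py /andP[]; rewrite le_eqVlt => /orP[/eqP <- _ rx ry Ex Ey|t0].
  rewrite subr0 scale1r scale0r addr0 Ex powRr0 mulr1 powRr1//.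
  by rewrite -lee_fin -Ex ltW// u0.
rewrite le_eqVlt => /orP[/eqP -> rx ry Ex Ey|t1 rx ry Ex Ey].
  rewrite subrr scale0r scale1r add0r Ey powRr0 mul1r powRr1//.
  by rewrite -lee_fin -Ey ltW// u0.
have rx0 : 0 < rx by rewrite -lte_fin -Ex u0.
have ry0 : 0 < ry by rewrite -lte_fin -Ey u0.
have t01 : 0 < t < 1 by rewrite t0 t1.
(* [l = ry / rx] is the minimizing parameter, at which the linear bound equals the geometric
   mean. *)
apply: le_trans (lu x y t (ry / rx) Px Py t01 (divr_gt0 ry0 rx0)) _.
rewrite Ex Ey -!EFinM -EFinD lee_fin le_eqVlt; apply/orP; left; apply/eqP.
have rV (e : R) : (ry / rx) `^ e = ry `^ e * rx `^ (- e).
  rewrite powRM ?invr_ge0 ?(ltW rx0) ?(ltW ry0)//; congr (_ * _).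
  by rewrite -(@powR_inv1 _ rx (ltW rx0)) -powRrM mulN1r.
have D (c e f : R) : 0 < c -> c `^ (e + f) = c `^ e * c `^ f.
  by move=> c0; rewrite powRD// (gt_eqF c0) implybT.
rewrite !rV opprB (D rx 1 (- t))// (D ry t (- 1))// powR_inv1 ?(ltW ry0)// powRr1 ?(ltW rx0)//.
by field; rewrite gt_eqF.
Qed.

Lemma lin_logconvex_convex (P : set V) (u : V -> \bar R) x y (t : R) :
  lin_logconvex P u -> P x -> P y -> 0 < t < 1 ->
  (u ((1 - t) *: x + t *: y)%R <= (1 - t)%:E * u x + t%:E * u y)%E.
Proof.
by move=> lu Px Py t01; have := lu x y t 1 Px Py t01 ltr01; rewrite !powR1 !mulr1.
Qed.

Lemma lin_logconvex_quasi (P : set V) (u : V -> \bar R) :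
  (forall x, P x -> (0 <= u x)%E) -> lin_logconvex P u -> quasiconvex_on P u.
Proof.
move=> u0 lu x y t Px Py /andP[]; rewrite le_eqVlt => /orP[/eqP <- _|t0].
  by rewrite subr0 scale1r scale0r addr0 le_max lexx.
rewrite le_eqVlt => /orP[/eqP ->|t1].
  by rewrite subrr scale0r scale1r add0r le_max lexx orbT.
have t01 : 0 < t < 1 by rewrite t0 t1.
apply: le_trans (lin_logconvex_convex lu Px Py t01) _.
have m0 : (0 <= maxe (u x) (u y))%E by rewrite le_max u0.
apply: (@le_trans _ _ ((1 - t)%:E * maxe (u x) (u y) + t%:E * maxe (u x) (u y))%E).
  by apply: leeD; apply: lee_wpmul2l; rewrite ?lee_fin ?subr_ge0 ?(ltW t0) ?(ltW t1)// le_max lexx ?orbT.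
rewrite -ge0_muleDl ?lee_fin ?subr_ge0 ?(ltW t0) ?(ltW t1)//.
by rewrite -EFinD subrK mul1e.
Qed.

Lemma lin_logconvex_add (P : set V) (u w : V -> \bar R) :
  (forall x, P x -> (0 <= u x)%E) -> (forall x, P x -> (0 <= w x)%E) ->
  lin_logconvex P u -> lin_logconvex P w -> lin_logconvex P (fun x => u x + w x)%E.
Proof.
move=> u0 w0 lu lw x y t l Px Py t01 l0.
apply: le_trans (leeD (lu x y t l Px Py t01 l0) (lw x y t l Px Py t01 l0)) _.
by rewrite !ge0_muleDr ?u0 ?w0// addeACA.
Qed.

End LogConvex.

(** * Local bounds and compactness of densities *)

Section Compactness.
Variables (R : realType) (n : nat).
Local Notation V := 'rV[R]_n.
Local Notation B := (BorelV R n).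
Local Notation bmeas D u := (@measurable_fun _ _ B (\bar R) D u).
Variables (mu : {measure set B -> \bar R}) (P : set V).
Variables (I : finType) (a : I -> V) (b : I -> R).
Hypotheses (hmu : lebesgue_like mu) (fs : facet_system P a b) (bP : bounded_set P).
Hypothesis P0 : interior P !=set0.

Let mP : measurable (P : set B) := polytope_measurable fs.
Let miP : measurable (interior P : set B) := polytope_interior_measurable P.

(** The class [Mp mu P 1] with log-convexity in linear form; its integrability condition is
    contained in the mass normalisation ([Mp1_density]). *)
Definition density (u : V -> \bar R) : Prop :=
  [/\ lsc_on P u, (forall x, P x -> (0 < u x)%E), lin_logconvex P u &
      (\int[mu]_(x in P) u x = mu P)%E].

Lemma density_measurable u : density u -> bmeas P u.
Proof. by move=> [lu _ _ _]; exact: lsc_on_measurable. Qed.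

Lemma density_ge0 u x : density u -> P x -> (0 <= u x)%E.
Proof. by move=> [_ u0 _ _] Px; exact/ltW/u0. Qed.

Lemma polytope_mu_lty : (mu P < +oo)%E.
Proof. exact: (lebesgue_bounded_lty hmu). Qed.

Lemma polytope_mu_gt0 : (0 < mu P)%E.
Proof.
have [x Px] := P0; apply: (open_gt0_subset hmu _ (@open_interior _ P) Px) => //.
exact: interior_subset.
Qed.

Definition near_box (z : V) (d : R) : set V := [set x | forall i, `|z ord0 i - (x : V) ord0 i| < d].

Lemma near_box_open z d : open (near_box z d).
Proof.
rewrite (_ : near_box z d = (fun x => x - z) @^-1` open_box d).
  by apply: open_comp (@open_box_open R n d) => y _; exact: shift_continuous.
by apply/seteqP; split=> x h i; have := h i; rewrite !mxE distrC.
Qed.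

Lemma near_box_center z d : 0 < d -> near_box z d z.
Proof. by move=> d0 i; rewrite subrr normr0. Qed.

(* If [u x > M] then of any two points symmetric about [x] one has [u >= M], so
   [u >= M] on a fixed proportion of a box around [x]; conclude by Markov. *)
Lemma density_local_bound z : interior P z -> exists d M : R,
  [/\ 0 < d, 0 <= M, near_box z d `<=` interior P &
      forall u, density u -> forall x, near_box z d x -> (u x <= M%:E)%E].
Proof.
move=> Pz; have [e e0 eP] := (nbhs_rVP z (interior P)).1 (open_nbhs_nbhs (conj (@open_interior _ P) Pz)).
have [c c0 cE] := lebesgue_reflect hmu.
pose d := e / 2; have d0 : 0 < d by rewrite divr_gt0.
pose be := mu (open_box d).
have be0 : (0 < be)%E.
  by apply: (lebesgue_open_gt0 hmu (@open_box_open R n d)); exact: open_box0.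
have beoo : (be < +oo)%E.
  apply: (lebesgue_bounded_lty hmu); last exact: open_box_bounded.
  by apply: open_measurableV; exact: open_box_open.
have bef : be \is a fin_num by rewrite ge0_fin_numE// ltW.
have fb0 : 0 < fine be by rewrite fine_gt0// be0 ltey_eq bef.
have mPf : mu P \is a fin_num by rewrite ge0_fin_numE// polytope_mu_lty.
have mP0 : 0 < fine (mu P) by rewrite fine_gt0// polytope_mu_gt0 ltey_eq mPf.
(* If the bound fails, covering the box and Markov's inequality give [be <= (1 + c) * mu P / M]; the
   summand 1 turns this into a contradiction. *)
pose M := (1 + c) * fine (mu P) / fine be + 1.
have M0 : 0 < M by rewrite ltr_wpDl// divr_ge0 ?(ltW fb0)// mulr_ge0 ?addr_ge0// ltW.
exists d, M; split=> //.
- exact: ltW.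
- by move=> x xz; apply: eP => i; apply: lt_trans (xz i) _; rewrite /d ltr_pdivrMr// ltr_pMr// ltr1n.
move=> u du x xz; rewrite leNgt; apply/negP => Mu.
pose bad := P `&` [set y | (M%:E <= u y)%E].
have mbad : measurable (bad : set B).
  exact: emeasurable_fun_c_infty (density_measurable du) _.
(* The image of [bad] under the point reflection in [x]. *)
pose refl := translate (reflect bad) (2 *: x).
have mrefl : measurable (reflect bad : set B).
  rewrite -[X in measurable X]setTI.
  by apply: (@continuous_measurableV R n (fun x => - x)) => //; move=> y; exact: opp_continuous.
have mtr : measurable (refl : set B).
  rewrite /refl translateE -[X in measurable X]setTI.
  exact: (continuous_measurableV (@shift_continuous R n (2 *: x))).
have boxP (y : V) : (forall i, `|y ord0 i - x ord0 i| < d) -> P y.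
  move=> yx; apply: interior_subset; apply: eP => i.
  rewrite -[z ord0 i](subrK (x ord0 i)) -addrA (le_lt_trans (ler_normD _ _))//.
  by rewrite [e]splitr ltrD// distrC.
have cov : translate (open_box d) x `<=` bad `|` refl.
  rewrite translateE => y yx.
  have yx' i : `|y ord0 i - x ord0 i| < d by have := yx i; rewrite !mxE.
  have [My|My] := leP M%:E (u y); first by left; split=> //; exact: boxP.
  right; rewrite /refl translateE /= /reflect /=.
  have y'P : P (- (y - 2 *: x)).
    apply: boxP => i; rewrite !mxE opprB.
    by rewrite (_ : _ - _ = - (y ord0 i - x ord0 i)) ?normrN//; ring.
  split=> //=; rewrite leNgt; apply/negP => My'.
  have half : 0 < (2^-1 : R) < 1 by rewrite invr_gt0 ltr0n/= invf_lt1// ltr1n.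
  have half' : 0 <= (2^-1 : R) <= 1 by move/andP : half => [/ltW -> /ltW ->].
  have [_ u0 lu _] := du.
  have := lin_logconvex_quasi (fun x Px => ltW (u0 x Px)) lu (boxP _ yx') y'P half'.
  rewrite (_ : (1 - 2^-1) *: y + _ = x); last by apply/rowP => i; rewrite !mxE; field.
  by apply/negP; rewrite -ltNge; apply: lt_trans Mu; rewrite gt_max My My'.
have : (be <= (1 + c)%:E * mu bad)%E.
  rewrite /be -(@hmu.1 (open_box d) x); last by apply: open_measurableV; exact: open_box_open.
  apply: (@le_trans _ _ (mu (bad `|` refl))).
    apply: le_measure; rewrite ?inE//; last exact: measurableU.
    rewrite translateE -[X in measurable X]setTI.
    apply: (continuous_measurableV (@shift_continuous R n x)) => //.
    by apply: open_measurableV; exact: open_box_open.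
  apply: (@le_trans _ _ (mu bad + mu refl)%E); first exact: measureU2.
  have -> : mu refl = mu (reflect bad) by apply: hmu.1.
  by rewrite cE// EFinD ge0_muleDl ?lee_fin// mul1e.
have badM : (M%:E * mu bad <= mu P)%E.
  have [_ _ _ <-] := du; apply: markov_superlevel => //; first exact: density_measurable.
  by move=> y; exact: density_ge0.
have badf : mu bad \is a fin_num.
  rewrite ge0_fin_numE//; apply: le_lt_trans polytope_mu_lty.
  by apply: le_measure; rewrite ?inE// => y [].
move: badM; rewrite -(fineK badf) -(fineK mPf) -(fineK bef) -!EFinM !lee_fin => h1 h2.
have h3 : fine be * M <= (1 + c) * fine (mu P).
  apply: (@le_trans _ _ ((1 + c) * fine (mu bad) * M)); first by rewrite ler_pM2r.
  by rewrite -mulrA ler_wpM2l ?addr_ge0// mulrC.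
move: h3; rewrite /M mulrDr mulr1 mulrCA mulfV ?gt_eqF// mulr1.
by apply/negP; rewrite -ltNge ltrDl.
Qed.

Lemma density_fin_num u x : density u -> interior P x -> u x \is a fin_num.
Proof.
move=> du Px; have [d [M [d0 M0 dP hM]]] := density_local_bound Px.
rewrite ge0_fin_numE; last by apply: density_ge0 => //; exact: interior_subset.
by apply: le_lt_trans (hM u du x (near_box_center _ d0)) _; exact: ltry.
Qed.

Lemma density_neq_measurable u w : density u -> density w ->
  measurable (interior P `&` [set x | u x != w x] : set B).
Proof.
move=> du dw.
have mu1 : bmeas (interior P) u.
  by apply: measurable_funS (density_measurable du) => //; exact: interior_subset.
have mw1 : bmeas (interior P) w.
  by apply: measurable_funS (density_measurable dw) => //; exact: interior_subset.
have := emeasurable_neq miP (emeasurable_funB mu1 mw1) 0%E.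
congr (measurable _); apply/seteqP; split=> x [Px] /= h; split=> //=; move: h.
  by apply: contra_neq => ->; rewrite subee// density_fin_num.
by apply: contra_neq => /eqP; rewrite sube_eq ?add0e ?density_fin_num// => /eqP.
Qed.

(** If [w y < r < u y], lower semicontinuity keeps [u] above [r] near [y], while convexity keeps [w]
    below [r] on a small box centred on a segment from [y] into the interior. That box has positive
    measure, so it contains a point where the two agree. *)
Lemma density_eq_of_ae (u w : V -> \bar R) : density u -> density w ->
  mu (interior P `&` [set x | u x != w x]) = 0%E -> forall y, P y -> u y = w y.
Proof.
move=> du dw uw0.
suff H u1 w1 : density u1 -> density w1 -> mu (interior P `&` [set x | u1 x != w1 x]) = 0%E ->
    forall y, P y -> (u1 y <= w1 y)%E.
  move=> y Py; apply/eqP; rewrite eq_le H//= H// -uw0; congr (mu _).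
  by apply/seteqP; split=> x [? /=]; rewrite eq_sym.
move=> {du dw uw0 u w} du dw uw0 y Py; rewrite leNgt; apply/negP => wu.
have [z Pz] := P0; have [d [M [d0 M0 dP hM]]] := density_local_bound Pz.
have w0 := density_ge0 dw Py.
have [s Es] : exists s : R, w1 y = s%:E.
  by case: (w1 y) w0 wu => [s _ _|_|]//; [exists s|rewrite ltNge leey].
have s0 : 0 <= s by rewrite -lee_fin -Es.
have [r sr ru] : exists2 r : R, s < r & (r%:E < u1 y)%E.
  rewrite Es in wu; case: (u1 y) wu => [q| |]// sq; last by exists (s + 1); rewrite ?ltrDl ?ltry.
  by exists ((s + q) / 2); rewrite ?lte_fin midf_lt// -lte_fin.
have [lu _ _ _] := du; have [W yW hW] := lu y r Py ru.
have [e e0 eW] := (nbhs_rVP y W).1 yW.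
pose D := `|z - y| + d; have D0 : 0 < D by rewrite ltr_wpDl.
have [t [t0 t1 tD tM]] : exists t, [/\ 0 < t, t < 1, t * D < e & (1 - t) * s + t * M < r].
  (* The first term of the inner minimum keeps the shrunken box within [e] of [y], the second keeps
     the convex bound on [w1] below [r]. *)
  pose t := Num.min (2^-1) (Num.min (e / D / 2) ((r - s) / (M + 1) / 2)).
  have t0 : 0 < t.
    by rewrite !lt_min invr_gt0 ltr0n/= !divr_gt0// ?subr_gt0// ltr_wpDl.
  have M1 : 0 < M + 1 by rewrite ltr_wpDl.
  exists t; split=> //.
  - by rewrite gt_min invf_lt1// ltr1n.
  - rewrite -ltr_pdivlMr// !gt_min; apply/orP; right; apply/orP; left.
    by rewrite ltr_pdivrMr// ltr_pMr ?ltr1n// divr_gt0.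
  - have : t < (r - s) / (M + 1).
      rewrite !gt_min; apply/orP; right; apply/orP; right.
      by rewrite ltr_pdivrMr// ltr_pMr ?ltr1n// divr_gt0// subr_gt0.
    rewrite ltr_pdivlMr// => h.
    have : t * M <= t * (M + 1) by rewrite ler_pM2l// lerDl.
    have : 0 <= t * s by rewrite mulr_ge0// ltW.
    by lra.
have t01 : 0 < t < 1 by rewrite t0 t1.
pose c := (1 - t) *: y + t *: z.
pose O := near_box c (t * d).
(* [O] is the homothetic image, with centre [y] and ratio [t], of the box around [z]. *)
have back x : O x -> exists2 x', near_box z d x' & x = (1 - t) *: y + t *: x'.
  move=> xO; exists (t^-1 *: (x - (1 - t) *: y)); last first.
    by rewrite scalerA mulfV ?gt_eqF// scale1r addrC subrK.
  move=> i; have := xO i; rewrite /c !mxE => h.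
  rewrite -(ltr_pM2l t0) -{1}(gtr0_norm t0) -normrM.
  rewrite (_ : t * _ = (1 - t) * y ord0 i + t * z ord0 i - x ord0 i)//.
  by field; rewrite gt_eqF.
have OP : O `<=` interior P.
  move=> x /back[x' x'z ->]; apply: (polytope_conv_interior fs) => //; first exact: dP.
  by rewrite t0 ltW.
have cO : O c by apply: near_box_center; rewrite mulr_gt0.
have [x [Ox ux]] : exists x, O x /\ u1 x = w1 x.
  apply: contrapT => /forallNP h.
  have : (0 < mu (interior P `&` [set x | u1 x != w1 x]))%E.
    apply: (open_gt0_subset hmu _ (@near_box_open c (t * d)) cO).
      exact: density_neq_measurable.
    move=> x Ox; split; first exact: OP.
    by apply/eqP => E; exact: (h x).
  by rewrite uw0 ltxx.
have [x' x'z xE] := back x Ox.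
have : (r%:E < u1 x)%E.
  apply: hW; last by apply: interior_subset; exact: OP.
  apply: eW => i; rewrite xE !mxE.
  rewrite (_ : _ - _ = t * (y ord0 i - x' ord0 i)); last by ring.
  rewrite normrM gtr0_norm//; apply: le_lt_trans tD; rewrite ler_pM2l//.
  rewrite /D -[y ord0 i](subrK (z ord0 i)) -addrA (le_trans (ler_normD _ _))//.
  apply: lerD; last exact/ltW/x'z.
  by have := coord_norm_le (z - y) i; rewrite !mxE distrC.
apply/negP; rewrite -leNgt ux xE.
have [_ _ lw _] := dw.
apply: le_trans (lin_logconvex_convex lw Py (interior_subset (dP _ x'z)) t01) _.
rewrite Es; apply: (@le_trans _ _ ((1 - t)%:E * s%:E + t%:E * M%:E)%E).
  by apply: leeD2l; apply: lee_wpmul2l; [rewrite lee_fin ltW|exact: hM].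
by rewrite -!EFinM -EFinD lee_fin ltW.
Qed.

(** The subsequences [psi k] are nested. From index [k] on, the diagonal [psi j j] reads terms of
    [psi k] at indices at least [j], which gives convergence in column [k]. *)
Lemma diagonal_extraction (v : nat -> nat -> R) :
  (forall k, exists M, forall j, `|v j k| <= M) ->
  exists (phi : nat -> nat) (lim : nat -> R), (forall j, (j <= phi j)%N) /\
    forall k e, 0 < e -> exists N, forall j, (N <= j)%N -> `|lim k - v (phi j) k| < e.
Proof.
move=> vM.
have sel (p : (nat -> nat) * nat) : exists f : nat -> nat,
    (forall i j, (i < j)%N -> (f i < f j)%N) /\ cvgn (fun j => v (p.1 (f j)) p.2).
  have [M hM] := vM p.2.
  have bd : bounded_fun (fun j => v (p.1 j) p.2).
    by exists M; split => [|x Mx j _]; [exact: num_real|exact: le_trans (hM _) (ltW Mx)].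
  have [f inc cf] := bolzano_weierstrass bd.
  exists f; split=> // i j ij.
  by have := inc j i; rewrite leEnat ltnNge => ->; rewrite -ltnNge.
have [F hF] := choice sel.
pose psi := fix psi k := match k with
  | 0 => F (id, 0%N)
  | k'.+1 => psi k' \o F (psi k', k'.+1) end.
have ge_id f : (forall i j, (i < j)%N -> (f i < f j)%N) -> forall j, (j <= f j)%N.
  by move=> inc; elim=> // j; move=> /leq_ltn_trans; apply; exact: inc.
have psi_inc k : forall i j, (i < j)%N -> (psi k i < psi k j)%N.
  elim: k => [|k IH] i j ij /=; first exact: (hF (id, 0%N)).1.
  by apply: IH; exact: (hF (psi k, k.+1)).1.
have psi_cvg k : cvgn (fun j => v (psi k j) k).
  by case: k => [|k]; [exact: (hF (id, 0%N)).2|exact: (hF (psi k, k.+1)).2].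
have psi_sub k d : exists G : nat -> nat, (forall j, (j <= G j)%N) /\
    forall j, psi (k + d)%N j = psi k (G j).
  elim: d => [|d [G [G1 G2]]]; first by exists id; rewrite addn0.
  exists (G \o F (psi (k + d)%N, (k + d).+1)); split=> j /=.
    by apply: leq_trans (G1 _); apply: ge_id; exact: (hF (psi (k + d)%N, (k + d).+1)).1.
  by rewrite addnS /= G2.
exists (fun j => psi j j), (fun k => limn (fun j => v (psi k j) k)).
split=> [j|k e e0]; first exact: (ge_id _ (psi_inc j)).
have /cvgrPdist_lt/(_ e e0)[N _ hN] := psi_cvg k.
exists (maxn N k) => j; rewrite geq_max => /andP[Nj kj].
have [G [G1 G2]] := psi_sub k (j - k)%N.
rewrite -{1}(subnKC kj) G2; apply: hN => /=.
by apply: leq_trans (G1 j).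
Qed.

(** Enumerates the dyadic points of all levels through pickling; codes that decode to nothing give
    the origin. *)
Definition dyadic_point (k : nat) : V :=
  if (unpickle k : option (nat * {ffun 'I_n -> int})) is Some p
  then \row_i ((p.2 i)%:~R / 2 ^+ p.1) else 0.

Lemma dyadic_point_dense z d : 0 < d -> exists k, near_box z d (dyadic_point k).
Proof.
move=> d0; have [l hl] := exists_small_dyadic d0.
exists (pickle (l, [ffun i => cellidx l z i])) => i.
rewrite /dyadic_point pickleK/= !mxE ffunE.
apply: le_lt_trans (hl l (leqnn l)).
have l0 : (0 : R) < 2 ^+ l by rewrite exprn_gt0.
have /andP[h1 h2] := floor_itv (2 ^+ l * z ord0 i); rewrite intrD in h2.
have -> : z ord0 i - (cellidx l z i)%:~R / 2 ^+ l = (2 ^+ l * z ord0 i - (cellidx l z i)%:~R) / 2 ^+ l.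
  by field; rewrite gt_eqF.
rewrite ger0_norm; last by rewrite divr_ge0 ?(ltW l0)// subr_ge0.
by rewrite ler_pdivrMr// mulVf ?gt_eqF// lerBlDl ltW.
Qed.

(** A convex function with values between 0 and [M] on a box changes from its value at the centre by
    at most [t * M] within the box shrunk by [t]: prolong the segment by the factor [1 / t] and use
    convexity. The constants do not depend on the density, so this is equicontinuity. *)
Lemma density_local_lipschitz z : interior P z -> exists d M : R,
  [/\ 0 < d, 0 <= M, near_box z d `<=` interior P &
      forall u t x, density u -> 0 < t <= 2^-1 -> near_box z (t * d) x ->
        `|fine (u z) - fine (u x)| <= t * M].
Proof.
move=> Pz; have [d [M [d0 M0 dP hM]]] := density_local_bound Pz.
exists d, M; split=> // u t x du /andP[t0 t2] xz.
have t1 : t < 1 by rewrite (le_lt_trans t2)// invf_lt1// ltr1n.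
have t01 : 0 < t < 1 by rewrite t0 t1.
have [_ _ lu _] := du.
have xzd : near_box z d x.
  by move=> i; apply: lt_trans (xz i) _; rewrite gtr_pMl.
have Px := dP _ xzd.
have uf y : interior P y -> u y = (fine (u y))%:E by move=> Py; rewrite fineK// density_fin_num.
have u0 y : interior P y -> 0 <= fine (u y).
  by move=> Py; apply/fine_ge0/density_ge0 => //; exact: interior_subset.
have main p q : interior P p -> interior P q ->
    near_box z d (p + t^-1 *: (q - p)) -> fine (u q) - fine (u p) <= t * M.
  move=> Pp Pq wz.
  have := lin_logconvex_convex lu (interior_subset Pp) (interior_subset (dP _ wz)) t01.
  rewrite (_ : (1 - t) *: p + _ = q); last by apply/rowP => i; rewrite !mxE; field; rewrite gt_eqF.
  have uw := hM u du _ wz; rewrite (uf _ (dP _ wz)) lee_fin in uw.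
  rewrite (uf q)// (uf p)// (uf _ (dP _ wz)) -!EFinM -EFinD lee_fin => h.
  have : 0 <= t * fine (u p) by rewrite mulr_ge0 ?u0// ltW.
  have : t * fine (u (p + t^-1 *: (q - p))) <= t * M by rewrite ler_pM2l.
  by lra.
have tV (c : R) : `|c| < t * d -> `|t^-1 * c| < d.
  by move=> h; rewrite normrM gtr0_norm ?invr_gt0// ltr_pdivrMl.
rewrite ler_norml; apply/andP; split.
  rewrite lerNl opprB; apply: main => // i; rewrite !mxE.
  rewrite (_ : _ - _ = t^-1 * (z ord0 i - x ord0 i)); last by field; rewrite gt_eqF.
  exact/tV/xz.
apply: main => // i; rewrite !mxE.
rewrite (_ : _ - _ = (1 - t^-1) * (z ord0 i - x ord0 i)); last by field; rewrite gt_eqF.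
apply: le_lt_trans (tV _ (xz i)); rewrite !normrM ler_wpM2r//.
have tV1 : 1 < t^-1 by rewrite invf_gt1.
by rewrite ltr0_norm ?subr_lt0// opprB gtr0_norm ?invr_gt0// gerBl.
Qed.

(** * Convergence of integrals under an L^p bound *)

Lemma cvg_min_cst (f : nat -> R) (l c : R) :
  f @ \oo --> l -> (fun j => Num.min (f j) c) @ \oo --> Num.min l c.
Proof.
move=> /cvgrPdist_lt fl; apply/cvgrPdist_lt => e e0.
have [N _ hN] := fl e e0; exists N => // j Nj; apply: le_lt_trans (hN j Nj).
rewrite !minElt; case: (ltP l c) => lc; case: (ltP (f j) c) => fc //.
- by rewrite !ltr0_norm ?subr_lt0 ?(lt_le_trans lc)// !opprB lerD2r.
- rewrite ger0_norm ?subr_ge0 ?(ltW fc)// ger0_norm ?subr_ge0 ?lerD2r//.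
  by rewrite (le_trans (ltW fc)).
- by rewrite subrr normr0.
Qed.

(** Above [A], write [r] as the product of its powers [p] and [1 - p], and use that [1 - p] is
    negative. *)
Lemma trunc_powR_bound (r A p : R) : 0 <= r -> 0 < A -> 1 < p ->
  r <= Num.min r A + r `^ p * A `^ (1 - p).
Proof.
move=> r0 A0 p1; rewrite minElt; case: ltP => rA; first by rewrite lerDl mulr_ge0 ?powR_ge0.
have rp : 0 < r by exact: lt_le_trans rA.
rewrite ler_wpDl// ?(ltW A0)//.
have -> : r `^ p = r * r `^ (p - 1).
  have := @powRD R r 1 (p - 1); rewrite addrC subrK (gt_eqF rp) implybT => ->//.
  by rewrite powRr1.
rewrite -mulrA ler_peMr//.
have -> : A `^ (1 - p) = (A `^ (p - 1))^-1 by rewrite -opprB powRN.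
rewrite ler_pdivlMr ?powR_gt0// mul1r.
by apply: ge0_ler_powR; rewrite ?nnegrE ?subr_ge0 ?(ltW p1) ?(ltW A0).
Qed.

(* Vitali's theorem: a bound in L^p with [p > 1] is uniform integrability. *)
Lemma integral_cvg_of_powR_bound d (T : measurableType d) (m : {measure set T -> \bar R})
    (D : set T) (F : nat -> T -> R) (G : T -> R) (p K c : R) :
  measurable D -> (m D < +oo)%E -> 1 < p ->
  (forall j, measurable_fun D (F j)) -> measurable_fun D G ->
  (forall j x, D x -> 0 <= F j x) ->
  (forall x, D x -> F ^~ x @ \oo --> G x) ->
  (forall j, \int[m]_(x in D) (F j x)%:E = c%:E)%E ->
  (forall j, \int[m]_(x in D) ((F j x) `^ p)%:E <= K%:E)%E ->
  (\int[m]_(x in D) (G x)%:E = c%:E)%E.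
Proof.
move=> mD mDf p1 mF mG F0 FG Fc FK.
have G0 x : D x -> 0 <= G x.
  move=> Dx; rewrite -(cvg_lim (@Rhausdorff R) (FG x Dx)); apply: limr_ge.
    by apply/cvg_ex; exists (G x); exact: FG.
  by apply: nearW => j; exact: F0.
have mFe j : measurable_fun D (EFin \o F j) by exact/measurable_EFinP.
have mGe : measurable_fun D (EFin \o G) by exact/measurable_EFinP.
have FGe x : D x -> (fun j => (F j x)%:E) @ \oo --> (G x)%:E.
  by move=> Dx; apply: cvg_EFin; [exact: nearW|exact: FG].
have K0 : 0 <= K.
  by rewrite -lee_fin; apply: le_trans (FK 0%N); apply: integral_ge0 => x _; rewrite lee_fin powR_ge0.
apply/eqP; rewrite eq_le; apply/andP; split.
  apply: (@le_trans _ _ (\int[m]_(x in D) limn_einf (fun j => (F j x)%:E))%E).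
    apply: ge0_le_integral => //.
    - exact: (measurable_limn_einf mFe).
    - move=> x Dx; rewrite is_cvg_limn_einfE; last by apply/cvg_ex; eexists; exact: FGe.
      by rewrite (cvg_lim (@ereal_hausdorff R) (FGe x Dx)).
  apply: le_trans (@fatou _ T R m D mD (fun j x => (F j x)%:E) _ _) _ => //.
  by apply: limn_einf_le => j; rewrite Fc.
apply/lee_addgt0Pr => e e0.
(* Chosen so that the tail bound [K * A ^ (1 - p)] is at most [e]; [K + 1] in place of [K] keeps [A]
   positive. *)
pose A := ((K + 1) / e) `^ (p - 1)^-1.
have p10 : 0 < p - 1 by rewrite subr_gt0.
have K10 : 0 < K + 1 by rewrite ltr_wpDl.
have A0 : 0 < A by rewrite powR_gt0// divr_gt0.
have KA : K * A `^ (1 - p) <= e.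
  rewrite -opprB powRN /A -powRrM mulVf ?gt_eqF// powRr1 ?divr_ge0 ?(ltW K10) ?(ltW e0)//.
  by rewrite invf_div mulrA ler_pdivrMr// mulrC ler_pM2l// lerDl.
have mmin j : measurable_fun D (fun x => (Num.min (F j x) A)%:E).
  by apply/measurable_EFinP; apply: measurable_minr.
have mminG : measurable_fun D (fun x => (Num.min (G x) A)%:E).
  by apply/measurable_EFinP; apply: measurable_minr.
have step j : (c%:E <= \int[m]_(x in D) (Num.min (F j x) A)%:E + e%:E)%E.
  rewrite -(Fc j).
  have mp : measurable_fun D (fun x => ((F j x) `^ p)%:E).
    by apply/measurable_EFinP; exact: (measurableT_comp (measurable_powR p) (mF j)).
  have mpA : measurable_fun D (fun x => ((F j x) `^ p)%:E * (A `^ (1 - p))%:E)%E.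
    exact: emeasurable_funM.
  apply: (@le_trans _ _ (\int[m]_(x in D) ((Num.min (F j x) A)%:E + ((F j x) `^ p)%:E * (A `^ (1 - p))%:E))%E).
    apply: ge0_le_integral => //.
    - by move=> x Dx; rewrite lee_fin F0.
    - exact: mFe.
    - exact: emeasurable_funD.
    - by move=> x Dx; rewrite -EFinM -EFinD lee_fin trunc_powR_bound// F0.
  have m0 x : D x -> (0 <= (Num.min (F j x) A)%:E)%E.
    by move=> Dx; rewrite lee_fin le_min F0// ltW.
  rewrite ge0_integralD//; last by move=> x Dx; rewrite mule_ge0// lee_fin powR_ge0.
  rewrite leeD2l// ge0_integralZr//; last 2 first.
  - by move=> x Dx; rewrite lee_fin powR_ge0.
  - by rewrite lee_fin powR_ge0.
  apply: (@le_trans _ _ (K%:E * (A `^ (1 - p))%:E)%E); last by rewrite -EFinM lee_fin.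
  by apply: lee_wpmul2r => //; rewrite lee_fin powR_ge0.
have icst : m.-integrable D (cst A%:E).
  apply/integrableP; split; first exact: measurable_cst.
  under eq_integral do rewrite gee0_abs ?lee_fin ?(ltW A0)//.
  by rewrite integral_cst// lte_mul_pinfty// lee_fin ltW.
have [] := @dominated_convergence _ T R m D mD (fun j x => (Num.min (F j x) A)%:E)
  (fun x => (Num.min (G x) A)%:E) (cst A%:E) mmin mminG _ icst _.
- apply: aeW => x Dx; apply: cvg_EFin; first exact: nearW.
  exact: cvg_min_cst (FG x Dx).
- apply: aeW => x j Dx; rewrite gee0_abs ?lee_fin ?le_min ?F0 ?(ltW A0)//.
  by rewrite ge_min lexx orbT.
move=> _ _ cv.
apply: (@le_trans _ _ (\int[m]_(x in D) (Num.min (G x) A)%:E + e%:E)%E); last first.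
  rewrite leeD2r//; apply: ge0_le_integral => //.
  - by move=> x Dx; rewrite lee_fin le_min G0//= ltW.
  - by move=> x Dx; rewrite lee_fin ge_min lexx.
rewrite -leeBlDr//.
rewrite -(cvg_lim (@ereal_hausdorff R) cv); apply: lime_ge; first by apply/cvg_ex; eexists; exact: cv.
by exists 0%N => // j _; have := step j; rewrite -leeBlDr.
Qed.

(* The limit is only controlled in the interior; this extends it to the boundary. *)
Definition lsc_envelope (h : V -> R) (y : V) : \bar R :=
  ereal_sup [set e | exists2 d : R, 0 < d &
    e = ereal_inf [set (h x)%:E | x in interior P `&` near_box y d]].

Lemma lt_lsc_envelope h y (r : R) : (r%:E < lsc_envelope h y)%E ->
  exists d s, [/\ 0 < d, r < s & forall x, interior P x -> near_box y d x -> s <= h x].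
Proof.
move=> /ereal_sup_gt[_ [d d0 ->]]; set e := ereal_inf _ => re.
have He x : interior P x -> near_box y d x -> (e <= (h x)%:E)%E.
  by move=> Px xy; apply: ereal_inf_lbound; exists x.
move: re He; case: e => [s| |]// rs He.
  by exists d, s; split=> // x Px xy; have := He x Px xy; rewrite lee_fin.
by exists d, (r + 1); split; rewrite ?ltrDl// => x Px xy; have := He x Px xy.
Qed.

Lemma lsc_envelope_ge h y (c d : R) : 0 < d ->
  (forall x, interior P x -> near_box y d x -> c <= h x) -> (c%:E <= lsc_envelope h y)%E.
Proof.
move=> d0 hc; apply: (@le_trans _ _ (ereal_inf [set (h x)%:E | x in interior P `&` near_box y d])).
  by apply: le_ereal_inf_tmp => _ [x [Px xy] <-]; rewrite lee_fin; exact: hc.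
by apply: ereal_sup_ubound; exists d.
Qed.

Lemma lsc_envelope_lt h y (c d : R) : (lsc_envelope h y < c%:E)%E -> 0 < d ->
  exists x, [/\ interior P x, near_box y d x & h x < c].
Proof.
move=> hc d0; apply: contrapT => /forallNP hn; move: hc; apply/negP; rewrite -leNgt.
apply: (lsc_envelope_ge d0) => x Px xy; rewrite leNgt; apply/negP => xc.
exact: (hn x).
Qed.

Lemma near_box_trans y z x d e : near_box y d z -> near_box z e x -> near_box y (d + e) x.
Proof.
move=> yz zx i; rewrite -[y ord0 i](subrK (z ord0 i)) -addrA.
by apply: le_lt_trans (ler_normD _ _) _; rewrite ltrD.
Qed.

Lemma near_box_conv x y x' y' t d : 0 <= t <= 1 -> near_box x d x' -> near_box y d y' ->
  near_box ((1 - t) *: x + t *: y) d ((1 - t) *: x' + t *: y').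
Proof.
move=> /andP[t0 t1] xx yy i; rewrite !mxE.
rewrite (_ : _ - _ = (1 - t) * (x ord0 i - x' ord0 i) + t * (y ord0 i - y' ord0 i)); last by ring.
apply: le_lt_trans (ler_normD _ _) _; rewrite !normrM (ger0_norm t0) ger0_norm ?subr_ge0//.
have hx := xx i; have hy := yy i.
have [->|tn] := eqVneq t 0; first by rewrite subr0 mul1r mul0r addr0.
have tp : 0 < t by rewrite lt_neqAle eq_sym tn.
rewrite (_ : d = (1 - t) * d + t * d); last by ring.
by rewrite ler_ltD// ?ltr_pM2l// ler_wpM2l ?subr_ge0// ltW.
Qed.

Lemma lsc_envelope_lsc h : lsc_on P (lsc_envelope h).
Proof.
move=> x r Px /lt_lsc_envelope[d [s [d0 rs hs]]].
exists (near_box x (d / 2)).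
  apply/nbhs_rVP; exists (d / 2) => [|y xy]; [by rewrite divr_gt0|exact: xy].
move=> y xy Py; apply: (@lt_le_trans _ _ s%:E); first by rewrite lte_fin.
apply: (@lsc_envelope_ge _ _ _ (d / 2)); first by rewrite divr_gt0.
by move=> z Pz yz; apply: hs => //; rewrite [d]splitr; exact: near_box_trans yz.
Qed.

(** Choose interior points near [x] and [y] that nearly attain the envelope; their combination is
    interior and near the given one, so the inequality for [h] passes over. *)
Lemma lsc_envelope_lin_logconvex h : (forall x, interior P x -> 0 <= h x) ->
  (forall x y t l, interior P x -> interior P y -> 0 < t < 1 -> 0 < l ->
    h ((1 - t) *: x + t *: y) <= (1 - t) * l `^ t * h x + t * l `^ (t - 1) * h y) ->
  lin_logconvex P (lsc_envelope h).
Proof.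
move=> h0 hlin x y t l Px Py t01 l0.
have /andP[t0 t1] := t01.
have c1 : 0 < (1 - t) * l `^ t by rewrite mulr_gt0 ?subr_gt0 ?powR_gt0.
have c2 : 0 < t * l `^ (t - 1) by rewrite mulr_gt0 ?powR_gt0.
have env0 z : (0 <= lsc_envelope h z)%E.
  by apply: (lsc_envelope_ge ltr01) => w Pw _; exact: h0.
have ex0 := env0 x; have ey0 := env0 y.
set c := (1 - t) * _ in c1 *; set e := t * _ in c2 *.
have H : (0 <= c%:E * lsc_envelope h x)%E by rewrite mule_ge0 ?lee_fin ?(ltW c1).
case Ey : (lsc_envelope h y) ey0 => [s2| |]// s20; last first.
  by rewrite [X in (_ + X)%E]gt0_muley ?lte_fin// addey ?leey// gt_eqF// (lt_le_trans _ H)// ltNy0.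
case Ex : (lsc_envelope h x) ex0 => [s1| |]// s10; last first.
  by rewrite gt0_muley ?lte_fin// addye ?leey.
rewrite -!EFinM -EFinD leNgt; apply/negP => /lt_lsc_envelope[d [s [d0 rs hs]]].
(* The excess of [s] over the claimed bound, distributed over the two coefficients. *)
pose ep := (s - (c * s1 + e * s2)) / (c + e).
have ce : 0 < c + e by rewrite addr_gt0.
have ep0 : 0 < ep by rewrite divr_gt0 ?subr_gt0.
have [|x' [Px' xx' hx']] := @lsc_envelope_lt h x (s1 + ep) d _ d0; first by rewrite Ex lte_fin ltrDl.
have [|y' [Py' yy' hy']] := @lsc_envelope_lt h y (s2 + ep) d _ d0; first by rewrite Ey lte_fin ltrDl.
have t01' : 0 <= t <= 1 by rewrite !ltW.
have t01'' : 0 < t <= 1 by rewrite t0 ltW.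
have := hs _ (polytope_conv_interior fs (interior_subset Px') Py' t01'') (near_box_conv t01' xx' yy').
apply/negP; rewrite -ltNge; apply: le_lt_trans (hlin x' y' t l Px' Py' t01 l0) _.
rewrite -/c -/e; apply: (@lt_le_trans _ _ (c * (s1 + ep) + e * (s2 + ep))).
  by rewrite ltrD// ltr_pM2l.
have E : (c + e) * ep = s - (c * s1 + e * s2) by rewrite /ep mulrC divfK ?gt_eqF.
rewrite (_ : _ + _ = (c * s1 + e * s2) + (c + e) * ep); last by ring.
by rewrite E addrC subrK.
Qed.

(** Convergence on the dyadic points extends to the whole interior because the sequence is locally
    equicontinuous. The L^p bound enters in keeping the mass of the limit. *)
Lemma density_compactness (u : nat -> V -> \bar R) (p K : R) : 1 < p ->
  (forall j, density (u j)) ->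
  (forall j, \int[mu]_(x in P) (u j x `^ p) <= K%:E)%E ->
  exists phi w, [/\ forall j, (j <= phi j)%N, density w,
    forall x, P x -> (w x <= limn_einf (fun j => u (phi j) x))%E &
    forall x, interior P x -> (fun j => fine (u (phi j) x)) @ \oo --> fine (w x)].
Proof.
move=> p1 du uK.
have iPP x : interior P x -> P x by exact: interior_subset.
have u0 j x : interior P x -> 0 <= fine (u j x).
  by move=> Px; apply/fine_ge0/(density_ge0 (du j))/iPP.
have uE j x : interior P x -> u j x = (fine (u j x))%:E.
  by move=> Px; rewrite fineK// density_fin_num.
(* Columns of dyadic points outside the interior are filled with 0, which keeps every column
   bounded. *)
have [|phi [l [phi_ge hl]]] := @diagonal_extraction
  (fun j k => if `[< interior P (dyadic_point k) >] then fine (u j (dyadic_point k)) else 0).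
  move=> k; case: asboolP => Pk; last by exists 0 => j; rewrite normr0.
  have [d [M [d0 M0 dP hM]]] := density_local_bound Pk.
  exists M => j; rewrite ger0_norm ?u0//.
  by rewrite -lee_fin -uE//; apply: hM => //; exact: near_box_center.
pose r j x := fine (u (phi j) x).
have rcvg z : interior P z -> cvgn (fun j => r j z).
  move=> Pz; apply/cauchy_cvgP/cauchy_exP => _/posnumP[e].
  have [d [M [d0 M0 dP hlip]]] := density_local_lipschitz Pz.
  pose t := Num.min (2^-1) (e%:num / 2 / (M + 1)).
  have M1 : 0 < M + 1 by rewrite ltr_wpDl.
  have t0 : 0 < t by rewrite lt_min invr_gt0 ltr0n/= !divr_gt0.
  have t2 : 0 < t <= 2^-1 by rewrite t0 ge_min lexx.
  have tM : t * M < e%:num / 2.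
    have : t * (M + 1) <= e%:num / 2 by rewrite -ler_pdivlMr// ge_min lexx orbT.
    by apply: lt_le_trans; rewrite ltr_pM2l// ltrDl.
  have td : 0 < t * d by rewrite mulr_gt0.
  have [k zk] := dyadic_point_dense z td.
  have Pk : interior P (dyadic_point k).
    apply: dP => i; apply: lt_trans (zk i) _; rewrite gtr_pMl//.
    by rewrite (le_lt_trans (andP t2).2)// invf_lt1// ltr1n.
  have [N hN] := hl k (e%:num / 2) (divr_gt0 (gt0 e) (ltr0n _ 2)).
  exists (l k); exists N => // j Nj; rewrite /= /ball/=.
  have := hN j Nj; rewrite asboolT// => h1.
  have h2 := hlip _ t _ (du (phi j)) t2 zk.
  rewrite [e%:num]splitr -[l k](subrK (fine (u (phi j) (dyadic_point k)))) -addrA.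
  apply: le_lt_trans (ler_normD _ _) _; rewrite ltrD//.
  by rewrite distrC (le_lt_trans h2).
pose h z := limn (fun j => r j z).
have hcvg z : interior P z -> (fun j => r j z) @ \oo --> h z by move=> /rcvg.
have h0 z : interior P z -> 0 <= h z.
  by move=> Pz; apply: limr_ge; [exact: rcvg|apply: nearW => j; exact: u0].
have hlip z : interior P z -> exists d M : R, [/\ 0 < d, 0 <= M, near_box z d `<=` interior P &
    forall t x, 0 < t <= 2^-1 -> near_box z (t * d) x -> `|h z - h x| <= t * M].
  move=> Pz; have [d [M [d0 M0 dP hh]]] := density_local_lipschitz Pz.
  exists d, M; split=> // t x t2 zx.
  have Px : interior P x.
    apply: dP => i; apply: lt_trans (zx i) _; rewrite gtr_pMl//.
    by rewrite (le_lt_trans (andP t2).2)// invf_lt1// ltr1n.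
  have cv : (fun j => `|r j z - r j x|) @ \oo --> `|h z - h x|.
    by apply: cvg_norm; apply: cvgB; exact: hcvg.
  rewrite -(cvg_lim (@Rhausdorff R) cv); apply: limr_le; first by apply/cvg_ex; eexists; exact: cv.
  by apply: nearW => j; exact: hh.
have hlin x y t c : interior P x -> interior P y -> 0 < t < 1 -> 0 < c ->
    h ((1 - t) *: x + t *: y) <= (1 - t) * c `^ t * h x + t * c `^ (t - 1) * h y.
  move=> Px Py /andP[t0 t1] c0.
  have Pm : interior P ((1 - t) *: x + t *: y).
    by apply: (polytope_conv_interior fs) => //; [exact: iPP|rewrite t0 ltW].
  have cv : (fun j => (1 - t) * c `^ t * r j x + t * c `^ (t - 1) * r j y) @ \oo -->
      (1 - t) * c `^ t * h x + t * c `^ (t - 1) * h y.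
    by apply: cvgD; apply: cvgM; first [exact: cvg_cst|exact: hcvg].
  have icv : cvgn (fun j => (1 - t) * c `^ t * r j x + t * c `^ (t - 1) * r j y).
    by apply/cvg_ex; eexists; exact: cv.
  rewrite -(cvg_lim (@Rhausdorff R) cv); apply: ler_lim => //; first exact: rcvg.
  apply: nearW => j; have [_ _ lj _] := du (phi j).
  have t01 : 0 < t < 1 by rewrite t0 t1.
  have := lj x y t c (iPP _ Px) (iPP _ Py) t01 c0.
  by rewrite (uE _ _ Pm) (uE _ _ Px) (uE _ _ Py) -!EFinM -EFinD lee_fin.
pose w := lsc_envelope h.
have w0 x : (0 <= w x)%E by apply: (lsc_envelope_ge ltr01) => y Py _; exact: h0.
(* [h] is continuous in the interior, so the envelope does not change it there. *)
have wE z : interior P z -> w z = (h z)%:E.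
  move=> Pz; apply/eqP; rewrite eq_le; apply/andP; split.
    rewrite leNgt; apply/negP => /lt_lsc_envelope[d [s [d0 hs hh]]].
    by have := hh z Pz (near_box_center _ d0); rewrite leNgt hs.
  have [d [M [d0 M0 dP hh]]] := hlip z Pz.
  apply/lee_addgt0Pr => e e0.
  pose t := Num.min (2^-1) (e / (M + 1)).
  have M1 : 0 < M + 1 by rewrite ltr_wpDl.
  have t0 : 0 < t by rewrite lt_min invr_gt0 ltr0n/= !divr_gt0.
  have t2 : 0 < t <= 2^-1 by rewrite t0 ge_min lexx.
  have tM : t * M <= e.
    have : t * (M + 1) <= e by rewrite -ler_pdivlMr// ge_min lexx orbT.
    by apply: le_trans; rewrite ler_pM2l// lerDl.
  rewrite -leeBlDr// -EFinB; apply: (@lsc_envelope_ge _ _ _ (t * d)); first by rewrite mulr_gt0.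
  move=> x Px zx; have := hh t x t2 zx; rewrite ler_norml => /andP[_ h2].
  by rewrite lerBlDr -lerBlDl (le_trans h2).
have lw : lsc_on P w by exact: lsc_envelope_lsc.
have linw : lin_logconvex P w by exact: lsc_envelope_lin_logconvex.
have mw : bmeas P w by exact: lsc_on_measurable.
have mwi : bmeas (interior P) w by apply: measurable_funS mw => //.
have mui j : bmeas (interior P) (u j).
  by apply: measurable_funS (density_measurable (du j)) => //.
have intw : (\int[mu]_(x in P) w x = mu P)%E.
  rewrite (integral_interior hmu fs bP mw)//.
  have mPf : mu P \is a fin_num by rewrite ge0_fin_numE// polytope_mu_lty.
  have miPf : (mu (interior P) < +oo)%E.
    by apply: le_lt_trans polytope_mu_lty; apply: le_measure; rewrite ?inE.
  have := @integral_cvg_of_powR_bound _ B mu (interior P) r h p K (fine (mu P)) miP miPf p1.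
  rewrite (fineK mPf) => H; rewrite -[RHS]H.
  - by apply: eq_integral => x; rewrite inE => Px; rewrite wE.
  - move=> j; apply/measurable_EFinP.
    by apply: eq_measurable_fun (mui (phi j)) => x; rewrite inE => Px; rewrite /= uE.
  - by apply/measurable_EFinP; apply: eq_measurable_fun mwi => x; rewrite inE => Px; rewrite /= wE.
  - by move=> j x; exact: u0.
  - by move=> x; exact: hcvg.
  - move=> j; have [_ _ _ <-] := du (phi j).
    rewrite (integral_interior hmu fs bP (density_measurable (du (phi j)))).
      by apply: eq_integral => x; rewrite inE => Px; rewrite [RHS]uE.
    by move=> x; exact: density_ge0.
  - move=> j; apply: le_trans (uK (phi j)).
    rewrite (integral_interior hmu fs bP).
    + rewrite le_eqVlt; apply/orP; left; apply/eqP.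
      by apply: eq_integral => x; rewrite inE => Px; rewrite [in RHS]uE// poweR_EFin.
    + exact: (measurableT_comp (measurable_poweR p) (density_measurable (du (phi j)))).
    + by move=> x _; exact: poweR_ge0.
(* If [u (phi j) y < c < w y] for infinitely many [j], convexity on the segment from [y] to an
   interior point [z] bounds [u (phi j)] at an interior point [q] near [y] by a number below
   [s <= h q], contradicting convergence at [q]. *)
have wlim y : P y -> (w y <= limn_einf (fun j => u (phi j) y))%E.
  move=> Py; rewrite leNgt; apply/negP => lt1.
  have [z Pz] := P0; have [d [M [d0 M0 dP hM]]] := density_local_bound Pz.
  have [c /andP[lc cw]] : exists c : R, (limn_einf (fun j => u (phi j) y) < c%:E < w y)%E.
    have L0 : (0 <= limn_einf (fun j => u (phi j) y))%E.
      by apply: (@limn_einf_ge _ _ _ 0) => j _; exact: (density_ge0 (du _)).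
    case: (limn_einf _) L0 lt1 => [L| |] L0; [|by rewrite ltNge leey|by []].
    case: (w y) => [s| |]//; last by move=> _; exists (L + 1); rewrite lte_fin ltrDl ltr01 ltry.
    by rewrite lte_fin => Ls; exists ((L + s) / 2); rewrite !lte_fin !midf_lt.
  have [e [s [e0 cs hs]]] := lt_lsc_envelope cw.
  have c0 : 0 <= c.
    rewrite -lee_fin; apply: le_trans (ltW lc).
    by apply: (@limn_einf_ge _ _ _ 0) => j _; exact: (density_ge0 (du _)).
  pose D := `|z - y| + 1; have D0 : 0 < D by rewrite ltr_wpDl.
  pose t := Num.min (2^-1) (Num.min (e / D / 2) ((s - c) / (M + 1) / 2)).
  have M1 : 0 < M + 1 by rewrite ltr_wpDl.
  have t0 : 0 < t.
    by rewrite !lt_min invr_gt0 ltr0n/= !divr_gt0// subr_gt0.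
  have t1 : t < 1 by rewrite gt_min invf_lt1// ltr1n.
  have t01 : 0 < t < 1 by rewrite t0 t1.
  have tD : t * D < e.
    rewrite -ltr_pdivlMr// !gt_min; apply/orP; right; apply/orP; left.
    by rewrite ltr_pdivrMr// ltr_pMr ?ltr1n// divr_gt0.
  have tM : (1 - t) * c + t * M < s.
    have : t < (s - c) / (M + 1).
      rewrite !gt_min; apply/orP; right; apply/orP; right.
      by rewrite ltr_pdivrMr// ltr_pMr ?ltr1n// divr_gt0// subr_gt0.
    rewrite ltr_pdivlMr// => h1.
    have : t * M <= t * (M + 1) by rewrite ler_pM2l// lerDl.
    have : 0 <= t * c by rewrite mulr_ge0// ltW.
    by lra.
  pose q := (1 - t) *: y + t *: z.
  have Pq : interior P q by apply: (polytope_conv_interior fs) => //; rewrite t0 ltW.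
  have yq : near_box y e q.
    move=> i; rewrite !mxE (_ : _ - _ = t * (y ord0 i - z ord0 i)); last by ring.
    rewrite normrM gtr0_norm//; apply: le_lt_trans tD; rewrite ler_pM2l//.
    rewrite /D (@le_trans _ _ `|z - y|) ?lerDl//.
    by have := coord_norm_le (z - y) i; rewrite !mxE distrC.
  have sq := hs q Pq yq.
  have [N _ hN] : \forall j \near \oo, `|h q - r j q| < s - ((1 - t) * c + t * M).
    by have /cvgrPdist_lt := hcvg q Pq; apply; rewrite subr_gt0.
  have [j Nj ujc] := limn_einf_lt lc N.
  have := hN j Nj; apply/negP; rewrite -leNgt.
  have : r j q <= (1 - t) * c + t * M.
    have [_ _ lj _] := du (phi j).
    rewrite -lee_fin /r -uE//.
    apply: le_trans (lin_logconvex_convex lj Py (iPP _ Pz) t01) _.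
    apply: (@le_trans _ _ ((1 - t)%:E * c%:E + t%:E * M%:E)%E); last by rewrite -!EFinM -EFinD.
    apply: leeD; apply: lee_wpmul2l; rewrite ?lee_fin ?subr_ge0 ?(ltW t0) ?(ltW t1)//.
      exact: ltW.
    by apply: hM => //; exact: near_box_center.
  move=> h1; rewrite ler_normr; apply/orP; left; rewrite lerB//.
exists phi, w; split=> //; last first.
  by move=> x Px; rewrite wE//; exact: hcvg.
split=> // y Py; rewrite lt_neqAle w0 andbT eq_sym; apply/eqP => wy0.
(* [x] lies between [y] and [q], so [w y = 0] leaves [h x <= t * c ^ (t - 1) * h q] for all [c > 0];
   as [t < 1], large [c] forces [h x = 0]. A limit vanishing in the interior contradicts the mass of
   [w]. *)
have wx0 x : interior P x -> w x = 0%E.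
  move=> Px.
  have [e e0 eP] := (nbhs_rVP x (interior P)).1 (open_nbhs_nbhs (conj (@open_interior _ P) Px)).
  pose N := `|x - y| + 1; have N0 : 0 < N by rewrite ltr_wpDl.
  pose ep := e / N.
  have ep0 : 0 < ep by rewrite divr_gt0.
  pose t := (1 + ep)^-1; have e1 : 0 < 1 + ep by rewrite ltr_wpDl.
  have t0 : 0 < t by rewrite invr_gt0.
  have t1 : t < 1 by rewrite invf_lt1// ltrDl.
  have t01 : 0 < t < 1 by rewrite t0 t1.
  pose q := x + ep *: (x - y).
  have Pq : interior P q.
    apply: eP => i; rewrite !mxE opprD addNKr normrN normrM gtr0_norm//.
    rewrite /ep mulrAC ltr_pdivrMr// ltr_pM2l// (@le_lt_trans _ _ `|x - y|) ?ltrDl//.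
    by have := coord_norm_le (x - y) i; rewrite !mxE.
  have xE : x = (1 - t) *: y + t *: q.
    apply/rowP => i; rewrite !mxE /t; field; exact/lt0r_neq0.
  have hx c : 0 < c -> h x <= t * c `^ (t - 1) * h q.
    move=> c0; have := linw y q t c Py (iPP _ Pq) t01 c0.
    by rewrite -xE wy0 mule0 add0e !wE// -EFinM lee_fin.
  rewrite wE//; congr _%:E; apply/eqP; rewrite eq_le h0// andbT leNgt; apply/negP => hx0.
  have hq0 : 0 < h q.
    rewrite ltNge; apply/negP => hq; have := hx 1 ltr01; rewrite leNgt => /negP; apply.
    by apply: le_lt_trans hx0; rewrite pmulr_rle0// mulr_gt0// powR_gt0.
  have s0 : 0 < 1 - t by rewrite subr_gt0.
  (* Makes the bound equal to [t / 2 * h x], which is below [h x]. *)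
  pose c := (2 * h q / h x) `^ (1 - t)^-1.
  have cpos : 0 < c by rewrite powR_gt0// !divr_gt0// mulr_gt0.
  have := hx c cpos; apply/negP; rewrite -ltNge.
  have -> : c `^ (t - 1) = h x / (2 * h q).
    rewrite -opprB powRN /c -powRrM mulVf ?gt_eqF// powRr1 ?invf_div//.
    by rewrite !divr_ge0// ?mulr_ge0// ltW.
  rewrite (_ : t * (h x / (2 * h q)) * h q = t / 2 * h x); last by field; rewrite gt_eqF.
  by rewrite gtr_pMl// ltr_pdivrMr// mul1r (lt_trans t1)// ltr1n.
have := polytope_mu_gt0; rewrite -intw (integral_interior hmu fs bP mw)//.
rewrite (eq_integral (cst 0%E)); first by rewrite integral_cst// mul0e ltxx.
by move=> x; rewrite inE => Px; rewrite wx0.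
Qed.

End Compactness.

(** * Estimates for [r ln r] *)

Section Entropy.
Variable R : realType.

Lemma xlnx_lower (r : R) : 0 < r -> r - 1 <= r * ln r.
Proof.
move=> r0; have := @expR_ge1Dx R (- ln r).
rewrite expRN lnK ?posrE// -(ler_pM2l r0) mulfV ?gt_eqF//; lra.
Qed.

(** Sum the tangent inequality [z ln m <= z ln z + m - z] at the midpoint [m] over [z = x] and
    [z = y]: the linear terms cancel, and each inequality is strict unless [z = m]. *)
Lemma xlnx_convex (x y : R) : 0 < x -> 0 < y ->
  2 * ((x + y) / 2 * ln ((x + y) / 2)) <= x * ln x + y * ln y ?= iff (x == y).
Proof.
move=> x0 y0; set m := (x + y) / 2.
have m0 : 0 < m by rewrite divr_gt0// addr_gt0.
have key z : 0 < z -> z * ln m <= z * ln z + (m - z) ?= iff (z == m).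
  move=> z0; apply/leifP.
  have [->|zm] := eqVneq z m; first by rewrite subrr addr0.
  have mz0 : 0 < m / z by exact: divr_gt0.
  have : 1 + ln (m / z) < expR (ln (m / z)).
    apply: expR_gt1Dx; rewrite ln_eq0//; apply/eqP => /divr1_eq mz.
    by move: zm; rewrite mz eqxx.
  rewrite lnK ?posrE// lnM ?posrE ?invr_gt0// lnV ?posrE//.
  rewrite -(ltr_pM2l z0) [z * (m / z)]mulrC divfK ?gt_eqF//; lra.
have [h1 e1] := key x x0; have [h2 e2] := key y y0.
have E : 2 * (m * ln m) = x * ln m + y * ln m by rewrite /m; field.
have Em : m - x + (m - y) = 0 by rewrite /m; field.
split; first by rewrite E; lra.
apply/eqP/eqP => [h|xy].
  have hx : x * ln m == x * ln x + (m - x) by rewrite eq_le h1 /=; lra.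
  by move: hx; rewrite e1 /m => /eqP; lra.
have -> : m = y by rewrite /m xy; field.
by rewrite xy; ring.
Qed.

(** This is [ln s < s] at [s = r ^ (p - 1)]. *)
Lemma xlnx_le_powR (r p : R) : 0 < r -> 1 < p -> r * ln r <= r `^ p / (p - 1).
Proof.
move=> r0 p1; have p0 : 0 < p - 1 by rewrite subr_gt0.
have -> : r `^ p = r * r `^ (p - 1).
  have := @powRD R r 1 (p - 1); rewrite addrC subrK (gt_eqF r0) implybT => ->//.
  by rewrite powRr1// ltW.
rewrite -mulrA ler_pM2l// ler_pdivlMr// mulrC -ln_powR ltW// ln_sublinear//.
exact: powR_gt0.
Qed.

Lemma ulogu_measurable : measurable_fun [set: \bar R] (@ulogu R).
Proof.
have mg : measurable_fun [set: R] (fun r : R => r * ln r).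
  by apply: measurable_funM => //; exact: measurable_ln.
move=> _ Y mY; rewrite setTI.
have -> : @ulogu R @^-1` Y =
    [set r%:E | r in (fun r : R => (r * ln r)%:E) @^-1` Y] `|`
    ((if (+oo%E \in Y) then [set +oo%E] else set0) `|`
     (if (-oo%E \in Y) then [set -oo%E] else set0)).
  apply/seteqP; split=> [[r| |] /= Yr|x].
  - by left; exists r.
  - by right; left; rewrite mem_set.
  - by right; right; rewrite mem_set.
  - case=> [[r Yr <-]//|[]]; case: ifPn => // /set_mem Yx /= ->.
    by [].
    by [].
apply: measurableU.
  apply: measurable_image_EFin.
  have mg' : measurable_fun [set: R] (fun r : R => (r * ln r)%:E) by exact/measurable_EFinP.
  by have := mg' measurableT Y mY; rewrite setTI.
by apply: measurableU; case: ifPn => // _; exact: emeasurable_set1.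
Qed.

Lemma lt_adde_split (r : R) (A B : \bar R) : (0 <= A)%E -> (0 <= B)%E -> (r%:E < A + B)%E ->
  exists a b : R, [/\ (a%:E < A)%E, (b%:E < B)%E & r < a + b].
Proof.
case: A => [x| |]//; case: B => [y| |]// _ _.
- rewrite -EFinD lte_fin => h; pose e := (x + y - r) / 4.
  have e0 : 0 < e by rewrite divr_gt0// subr_gt0.
  exists (x - e), (y - e); rewrite !lte_fin; split; rewrite ?ltrBlDr ?ltrDl//.
  by rewrite /e; lra.
- by move=> _; exists (x - 1), (r - x + 2); rewrite lte_fin ltry; split=> //; lra.
- by move=> _; exists (r - y + 2), (y - 1); rewrite lte_fin ltry; split=> //; lra.
- by move=> _; exists (r + 1), 0; rewrite !ltry; split=> //; lra.
Qed.

End Entropy.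

(** * Energy and entropy of densities *)

Section Minimization.
Variables (R : realType) (n : nat).
Hypothesis n1 : (1 < n)%N.
Local Notation V := 'rV[R]_n.
Local Notation B := (BorelV R n).
Local Notation bmeas D u := (@measurable_fun _ _ B (\bar R) D u).
Variables (mu sigma : {measure set B -> \bar R}) (P : set V).
Variables (I : finType) (a : I -> V) (b : I -> R).
Hypotheses (hmu : lebesgue_like mu) (hsigma : facet_measure P sigma).
Hypotheses (fs : facet_system P a b) (bP : bounded_set P) (P0 : interior P !=set0).

Let mP : measurable (P : set B) := polytope_measurable fs.
Let mdP : measurable (boundary P : set B) := polytope_boundary_measurable fs.
Let miP : measurable (interior P : set B) := polytope_interior_measurable P.

Local Notation density := (density mu P).

Let iPP x : interior P x -> P x.
Proof. exact: interior_subset. Qed.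

Definition bdry_energy (u : V -> \bar R) : \bar R := (\int[sigma]_(x in boundary P) u x)%E.

(* [ulogu + 1 >= 0], so Fatou and additivity apply without integrability conditions. *)
Definition shifted_entropy (u : V -> \bar R) : \bar R :=
  (\int[mu]_(x in P) (ulogu (u x) + 1))%E.

Lemma ulogu1_ge0 (e : \bar R) : (0 < e)%E -> (0 <= ulogu e + 1)%E.
Proof.
case: e => [r| |]//= r0; rewrite -EFinD lee_fin.
have := xlnx_lower r0; have : 0 < r by []. by lra.
Qed.

Lemma shifted_entropy_ge0 u : density u -> (0 <= shifted_entropy u)%E.
Proof. by move=> [_ u0 _ _]; apply: integral_ge0 => x Px; apply: ulogu1_ge0; exact: u0. Qed.

Lemma bdry_energy_ge0 u : density u -> (0 <= bdry_energy u)%E.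
Proof. by move=> du; apply: integral_ge0 => x [Px _]; exact: density_ge0 du Px. Qed.

Lemma ulogu1_measurable u : density u -> bmeas P (fun x => ulogu (u x) + 1)%E.
Proof.
move=> du; apply: emeasurable_funD; last exact: measurable_cst.
exact: (measurableT_comp (@ulogu_measurable R) (density_measurable fs du)).
Qed.

Lemma bdry_measurable u : density u -> bmeas (boundary P) u.
Proof.
by move=> du; apply: measurable_funS (density_measurable fs du) => // x [].
Qed.

Let muPfin : mu P \is a fin_num.
Proof. by rewrite ge0_fin_numE// (polytope_mu_lty hmu fs bP). Qed.

(** The negative part of [ulogu] is at most 1 along [u], hence of finite integral; adding that
    integral to both sides reduces the claim to additivity for nonnegative functions. *)
Lemma integral_ulogu u : density u ->
  (\int[mu]_(x in P) ulogu (u x) = shifted_entropy u - mu P)%E.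
Proof.
move=> du.
have mul : bmeas P (fun x => ulogu (u x)).
  exact: (measurableT_comp (@ulogu_measurable R) (density_measurable fs du)).
have u1 x : P x -> (0 <= ulogu (u x) + 1)%E.
  by move=> Px; apply: ulogu1_ge0; have [_ u0 _ _] := du; exact: u0.
pose f x := ulogu (u x).
have fneg x : P x -> (f^\- x <= 1)%E.
  move=> Px; rewrite funenegE ge_max lee_fin ler01 andbT /f.
  by have := u1 x Px; case: (ulogu (u x)) => [r|_|//];
    [rewrite -EFinD -EFinN !lee_fin; lra|rewrite leNye].
have neg_int : (\int[mu]_(x in P) f^\- x <= mu P)%E.
  rewrite -[leRHS]mul1e -integral_cst//; apply: ge0_le_integral => //.
  by apply: measurable_funeneg.
have negf : (\int[mu]_(x in P) f^\- x)%E \is a fin_num.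
  rewrite ge0_fin_numE ?integral_ge0// (le_lt_trans neg_int)//.
  exact: (polytope_mu_lty hmu fs bP).
have E : (shifted_entropy u + \int[mu]_(x in P) f^\- x =
    \int[mu]_(x in P) f^\+ x + mu P)%E.
  rewrite -[X in (_ + X)%E = _]/(\int[mu]_(x in P) f^\- x)%E -ge0_integralD//; last 2 first.
  - exact: ulogu1_measurable.
  - by apply: measurable_funeneg.
  rewrite -[X in _ = (_ + X)%E]mul1e -[X in _ = (_ + X)%E](integral_cst mu mP).
  rewrite -ge0_integralD//; last by apply: measurable_funepos.
  apply: eq_integral => x; rewrite inE => Px.
  rewrite funeposE funenegE /f /=; have := u1 x Px.
  case: (ulogu (u x)) => [r| |]//= _; last by rewrite maxNye.
  rewrite -!EFin_max -!EFinD; congr _%:E.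
  rewrite !maxElt; case: (ltP r 0) => h1; case: (ltP (- r) 0) => h2; lra.
rewrite [LHS]integralE -[X in _ = (X - _)%E](addeK _ negf) E.
rewrite addeAC addeK//.
Qed.

Lemma entropyE u : density u ->
  entropy mu P u = (- ((fine (mu P))^-1%:E * (shifted_entropy u - mu P)))%E.
Proof. by move=> du; rewrite /entropy integral_ulogu. Qed.

Definition midfun (u w : V -> \bar R) : V -> \bar R := fun x => (2^-1%:E * (u x + w x))%E.

Lemma density_mid u w : density u -> density w -> density (midfun u w).
Proof.
move=> du dw; have [lu u0 cu iu] := du; have [lw w0 cw iw] := dw.
have h0 : (0 : R) < 2^-1 by rewrite invr_gt0.
have s0 x : P x -> (0 < u x + w x)%E by move=> Px; rewrite adde_gt0// ?u0 ?w0.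
split.
- move=> x r Px; rewrite /midfun => h.
  have h' : ((2 * r)%:E < u x + w x)%E.
    by rewrite EFinM muleC -lte_pdivlMr// muleC.
  have [c [d [cu' dw' rcd]]] := lt_adde_split (ltW (u0 x Px)) (ltW (w0 x Px)) h'.
  have [W1 xW1 hW1] := lu x c Px cu'; have [W2 xW2 hW2] := lw x d Px dw'.
  exists (W1 `&` W2); first exact: filterI.
  move=> y [yW1 yW2] Py; rewrite muleC lte_pdivlMr// -EFinM.
  apply: (@lt_trans _ _ (c + d)%:E); first by rewrite lte_fin mulrC.
  by rewrite EFinD lteD// ?hW1 ?hW2.
- by move=> x Px; rewrite mule_gt0// ?lte_fin// s0.
- move=> x y t l Px Py t01 l0; rewrite /midfun.
  have c0 : (0 <= (2^-1 : R)%:E)%E by rewrite lee_fin ltW.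
  have ns z : P z -> (0 <= u z + w z)%E by move=> /s0/ltW.
  have := lin_logconvex_add (fun x Px => ltW (u0 x Px)) (fun x Px => ltW (w0 x Px)) cu cw Px Py t01 l0.
  move=> /(lee_wpmul2l c0)/le_trans; apply.
  have /andP[t0 t1] := t01.
  rewrite ge0_muleDr ?mule_ge0 ?ns// ?lee_fin ?mulr_ge0 ?subr_ge0 ?powR_ge0 ?(ltW t0) ?(ltW t1)//.
  by rewrite muleCA [X in (_ + X)%E]muleCA.
- rewrite ge0_integralZl_EFin//; last 2 first.
  + by move=> x /s0/ltW.
  + by apply: emeasurable_funD; [exact: (density_measurable fs du)|exact: (density_measurable fs dw)].
  rewrite ge0_integralD//; last 4 first.
  + by move=> x /u0/ltW.
  + exact: (density_measurable fs du).
  + by move=> x /w0/ltW.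
  + exact: (density_measurable fs dw).
  rewrite iu iw -(fineK muPfin) -EFinD -EFinM; congr _%:E; by field.
Qed.

Lemma bdry_energy_mid u w : density u -> density w ->
  bdry_energy (midfun u w) = (2^-1%:E * (bdry_energy u + bdry_energy w))%E.
Proof.
move=> du dw; have h0 : (0 : R) <= 2^-1 by rewrite invr_ge0.
have u0 x : boundary P x -> (0 <= u x)%E by move=> [Px _]; exact: density_ge0 du Px.
have w0 x : boundary P x -> (0 <= w x)%E by move=> [Px _]; exact: density_ge0 dw Px.
rewrite /bdry_energy ge0_integralZl_EFin//; last 2 first.
- by move=> x bx; rewrite adde_ge0 ?u0 ?w0.
- by apply: emeasurable_funD; exact: bdry_measurable.
by rewrite ge0_integralD//; exact: bdry_measurable.
Qed.

(** [F] is the pointwise defect in the convexity of [r ln r]. It is nonnegative, and its integral is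
    the sum of the two entropies minus twice that of the midpoint, so the hypothesis makes it vanish
    almost everywhere; the equality case then gives [u = w] almost everywhere in the interior. *)
Lemma shifted_entropy_mid u w : density u -> density w ->
  (shifted_entropy u < +oo)%E -> (shifted_entropy w < +oo)%E ->
  (2^-1%:E * (shifted_entropy u + shifted_entropy w) <= shifted_entropy (midfun u w))%E ->
  forall x, P x -> u x = w x.
Proof.
move=> du dw eu ew hm.
have dm := density_mid du dw.
have fin := density_fin_num hmu fs bP P0.
have pos v x : density v -> interior P x -> 0 < fine (v x).
  move=> dv Px; rewrite fine_gt0//; have [_ v0 _ _] := dv.
  by rewrite v0 ?ltey_eq ?(fin v x dv Px)//; exact: iPP.
pose F x := fine (u x) * ln (fine (u x)) + fine (w x) * ln (fine (w x)) -
  2 * ((fine (u x) + fine (w x)) / 2 * ln ((fine (u x) + fine (w x)) / 2)).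
have F0 x : interior P x -> 0 <= F x.
  by move=> Px; rewrite subr_ge0; exact: (xlnx_convex (pos u x du Px) (pos w x dw Px)).1.
have uE v x : density v -> interior P x -> v x = (fine (v x))%:E.
  by move=> dv Px; rewrite fineK// fin.
have mi v : density v -> bmeas (interior P) v.
  by move=> dv; apply: measurable_funS (density_measurable fs dv) => //.
have mfi v : density v -> @measurable_fun _ _ B R (interior P) (fun x => fine (v x)).
  move=> dv; apply/measurable_EFinP; apply: eq_measurable_fun (mi v dv) => x.
  by rewrite inE => Px; exact: uE.
have mxlnx : measurable_fun [set: R] (fun r : R => r * ln r).
  by apply: measurable_funM => //; exact: measurable_ln.
have mF : @measurable_fun _ _ B R (interior P) F.
  apply: measurable_funB.
    by apply: measurable_funD; exact: (measurableT_comp mxlnx (mfi _ _)).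
  apply: measurable_funM => //; apply: (measurableT_comp mxlnx).
  by apply: measurable_funM => //; apply: measurable_funD; exact: mfi.
have se v : density v -> shifted_entropy v = (\int[mu]_(x in interior P) (ulogu (v x) + 1))%E.
  move=> dv; rewrite /shifted_entropy (integral_interior hmu fs bP)//.
    exact: ulogu1_measurable.
  by move=> x Px; apply: ulogu1_ge0; have [_ v0 _ _] := dv; exact: v0.
have u1 v x : density v -> interior P x -> (0 <= ulogu (v x) + 1)%E.
  by move=> dv Px; apply: ulogu1_ge0; have [_ v0 _ _] := dv; apply: v0; exact: iPP.
have m1 v : density v -> bmeas (interior P) (fun x => ulogu (v x) + 1)%E.
  by move=> dv; apply: measurable_funS (ulogu1_measurable dv) => //.
have mFe : bmeas (interior P) (fun x => (F x)%:E) by exact/measurable_EFinP.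
have key : (2%:E * shifted_entropy (midfun u w) + \int[mu]_(x in interior P) (F x)%:E =
    shifted_entropy u + shifted_entropy w)%E.
  rewrite !se// -ge0_integralZl_EFin//; last 2 first.
  - by move=> x; exact: u1.
  - exact: m1.
  rewrite -!ge0_integralD//; first last.
  - by apply: measurable_funeM; exact: m1.
  - by move=> x Px; rewrite mule_ge0// u1.
  - exact: m1.
  - by move=> x; exact: u1.
  - exact: m1.
  - by move=> x; exact: u1.
  apply: eq_integral => x; rewrite inE => Px.
  have uxE := uE u x du Px; have wxE := uE w x dw Px.
  have -> : midfun u w x = ((fine (u x) + fine (w x)) / 2)%:E.
    by rewrite /midfun [in LHS]uxE [in LHS]wxE -EFinD -EFinM mulrC.
  have -> : ulogu (u x) = (fine (u x) * ln (fine (u x)))%:E by rewrite [in LHS]uxE.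
  have -> : ulogu (w x) = (fine (w x) * ln (fine (w x)))%:E by rewrite [in LHS]wxE.
  set m := (fine (u x) + fine (w x)) / 2.
  transitivity (2 * (m * ln m + 1) + F x)%:E; first by [].
  by rewrite -!EFinD; congr _%:E; rewrite /F -/m; ring.
have eum : (2%:E * (2^-1%:E * (shifted_entropy u + shifted_entropy w)) =
    shifted_entropy u + shifted_entropy w)%E.
  by rewrite muleA -EFinM mulfV// mul1e.
have su : (shifted_entropy u + shifted_entropy w)%E \is a fin_num.
  by rewrite fin_numD !ge0_fin_numE ?shifted_entropy_ge0// eu ew.
have IF0 : (\int[mu]_(x in interior P) (F x)%:E = 0)%E.
  apply/eqP; rewrite eq_le integral_ge0 ?andbT; last by move=> x Px; rewrite lee_fin F0.
  have h2 : (shifted_entropy u + shifted_entropy w <= 2%:E * shifted_entropy (midfun u w))%E.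
    by rewrite -eum; apply: lee_wpmul2l; rewrite ?lee_fin.
  have := leeD2r (\int[mu]_(x in interior P) (F x)%:E)%E h2; rewrite key.
  by rewrite -[leRHS]adde0 leeD2lE.
apply: (density_eq_of_ae hmu fs bP P0 du dw).
have /ae_eq_integral_abs : (\int[mu]_(x in interior P) `|(F x)%:E| = 0)%E.
  by rewrite -[RHS]IF0; apply: eq_integral => x; rewrite inE => Px; rewrite gee0_abs// lee_fin F0.
move=> /(_ miP mFe)[N [mN N0 hN]].
apply/eqP; rewrite eq_le measure_ge0 andbT -N0; apply: le_measure; rewrite ?inE//.
  exact: (density_neq_measurable hmu fs bP P0).
move=> x [Px /= uw]; apply: hN => /= /(_ Px) [/eqP]; rewrite subr_eq0 eq_sym.
rewrite (xlnx_convex (pos u x du Px) (pos w x dw Px)).2 => /eqP E.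
by move: uw; rewrite (uE u x du Px) (uE w x dw Px) E eqxx.
Qed.

Lemma lt_limn_einf (f : (\bar R)^nat) (c : \bar R) : (c < limn_einf f)%E ->
  exists N, forall j, (N <= j)%N -> (c < f j)%E.
Proof.
rewrite limn_einf_sup_einfs => /ereal_sup_gt[_ [N _ <-] cN].
exists N => j Nj; apply: lt_le_trans cN _.
by apply: ereal_inf_lbound; exists j.
Qed.

Lemma density_powR_bound : exists2 C : R, 0 <= C & forall u (U0 : R), density u ->
  (bdry_energy u <= U0%:E)%E ->
  (\int[mu]_(x in P) (u x `^ crit_exp R n) <= (C * U0 `^ crit_exp R n)%:E)%E.
Proof.
have [C C0 hC] := boundary_Lp_bound hmu hsigma fs bP n1.
exists C => // u U0 du; apply: hC; first by case: du.
- by move=> x Px; exact: density_ge0 du Px.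
- by have [_ u0 cu _] := du; apply: lin_logconvex_quasi => // x Px; exact/ltW/u0.
Qed.

Let crit_exp_gt1 : 1 < crit_exp R n.
Proof.
have h : (0 : R) < n%:R - 1 by rewrite subr_gt0 ltr1n.
by rewrite /crit_exp ltr_pdivlMr// mul1r ltrBlDr ltrDl.
Qed.

Lemma density_powR_lty u : density u -> (bdry_energy u < +oo)%E ->
  (\int[mu]_(x in P) (u x `^ crit_exp R n) < +oo)%E.
Proof.
move=> du Uu; have [C C0 hC] := density_powR_bound.
have Uf : bdry_energy u \is a fin_num by rewrite ge0_fin_numE// bdry_energy_ge0.
have := hC u (fine (bdry_energy u)) du; rewrite fineK// => /(_ (lexx _)) /le_lt_trans; apply.
exact: ltry.
Qed.

(** The L^p bound dominates [r ln r]. Thus finite boundary energy alone makes the entropy finite,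
    and comparisons with midpoints take place among real numbers. *)
Lemma shifted_entropy_lty u : density u -> (bdry_energy u < +oo)%E ->
  (shifted_entropy u < +oo)%E.
Proof.
move=> du Uu; have := density_powR_lty du Uu; set p := crit_exp R n => h.
have p1 : 0 < p - 1 by rewrite subr_gt0.
have mp : bmeas P (fun x => u x `^ p)%E.
  exact: (measurableT_comp (measurable_poweR p) (density_measurable fs du)).
apply: (@le_lt_trans _ _ ((p - 1)^-1%:E * \int[mu]_(x in P) (u x `^ p) + mu P)%E).
  rewrite -[X in (_ + X)%E]mul1e -[X in (_ + X)%E](integral_cst mu mP).
  rewrite -ge0_integralZl_EFin ?invr_ge0 ?(ltW p1)//; last by move=> x _; exact: poweR_ge0.
  rewrite -ge0_integralD//; last 2 first.
  - by move=> x _; rewrite mule_ge0 ?poweR_ge0// lee_fin invr_ge0 ltW.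
  - by apply: measurable_funeM.
  apply: ge0_le_integral => //.
  - by move=> x Px; apply: ulogu1_ge0; have [_ u0 _ _] := du; exact: u0.
  - exact: ulogu1_measurable.
  - by apply: emeasurable_funD => //; apply: measurable_funeM.
  move=> x Px; apply: leeD => //; have [_ u0 _ _] := du; have := u0 x Px.
  case: (u x) => [r| |]//; last first.
    move=> _; rewrite poweRyr ?gt_eqF ?(lt_trans ltr01)// gt0_muley ?leey// lte_fin invr_gt0//.
  rewrite lte_fin => r0; rewrite poweR_EFin -EFinM lee_fin [leRHS]mulrC.
  exact: xlnx_le_powR.
rewrite lte_add_pinfty ?(polytope_mu_lty hmu fs bP)//.
rewrite lte_mul_pinfty// lee_fin invr_ge0 ltW//.
Qed.

(** For [sigma], Fatou is combined with the inequality between [w] and the liminf on the boundary;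
    for [mu], with pointwise convergence in the interior. *)
Lemma density_energy_compactness (u : nat -> V -> \bar R) (U0 : R) :
  (forall j, density (u j)) -> (forall j, (bdry_energy (u j) <= U0%:E)%E) ->
  exists phi w, [/\ forall j, (j <= phi j)%N, density w,
    (bdry_energy w <= limn_einf (fun j => bdry_energy (u (phi j))))%E &
    (shifted_entropy w <= limn_einf (fun j => shifted_entropy (u (phi j))))%E].
Proof.
move=> du hU; have [C C0 hC] := density_powR_bound.
have [phi [w [hphi dw wlim wcvg]]] := density_compactness hmu fs bP P0 crit_exp_gt1 du
  (fun j => hC (u j) U0 (du j) (hU j)).
have fin := density_fin_num hmu fs bP P0.
exists phi, w; split=> //.
  apply: (@le_trans _ _ (\int[sigma]_(x in boundary P) limn_einf (fun j => u (phi j) x))%E).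
    apply: ge0_le_integral => //.
    - by move=> x [Px _]; exact: density_ge0 dw Px.
    - exact: bdry_measurable.
    - by apply: measurable_limn_einf => j; exact: bdry_measurable.
    - by move=> x [Px _]; exact: wlim.
  apply: fatou => // [j|j x [Px _]]; first exact: bdry_measurable.
  exact: density_ge0 (du _) Px.
have se v : density v -> shifted_entropy v = (\int[mu]_(x in interior P) (ulogu (v x) + 1))%E.
  move=> dv; rewrite /shifted_entropy (integral_interior hmu fs bP)//.
    exact: ulogu1_measurable.
  by move=> x Px; apply: ulogu1_ge0; have [_ v0 _ _] := dv; exact: v0.
have u1 v x : density v -> interior P x -> (0 <= ulogu (v x) + 1)%E.
  by move=> dv Px; apply: ulogu1_ge0; have [_ v0 _ _] := dv; apply: v0; exact: iPP.
have m1 v : density v -> bmeas (interior P) (fun x => ulogu (v x) + 1)%E.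
  by move=> dv; apply: measurable_funS (ulogu1_measurable dv) => //.
rewrite se// (_ : (fun j => _) =
    (fun j => \int[mu]_(x in interior P) (ulogu (u (phi j) x) + 1))%E); last first.
  by apply/funext => j; exact: se.
apply: le_trans (fatou mu miP (fun j => m1 _ (du (phi j))) (fun j x => u1 _ x (du (phi j)))).
rewrite le_eqVlt; apply/orP; left; apply/eqP; apply: eq_integral => x; rewrite inE => Px.
apply/esym/(cvg_limn_einf_sup _).1.
have uE v : density v -> v x = (fine (v x))%:E by move=> dv; rewrite fineK// fin.
(* [ln] is continuous only away from 0, so the limit has to be positive. *)
have w0 : 0 < fine (w x).
  rewrite fine_gt0//; have [_ v0 _ _] := dw.
  by rewrite v0 ?ltey_eq ?(fin w x dw Px)//; exact: iPP.
have uwE v : density v -> (ulogu (v x) + 1)%E = (fine (v x) * ln (fine (v x)) + 1)%:E.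
  by move=> dv; rewrite [in LHS](uE v dv).
rewrite uwE// (_ : (fun j => _) =
    (fun j => (fine (u (phi j) x) * ln (fine (u (phi j) x)) + 1)%:E)); last first.
  by apply/funext => j; rewrite uwE.
apply: cvg_EFin; first by near=> j.
have c := wcvg x Px.
apply: cvgD; last exact: cvg_cst.
by apply: cvgM => //; apply: (cvg_comp _ _ c); exact: continuous_ln.
Unshelve. all: by end_near.
Qed.

(** * Existence and uniqueness of energy minimizers *)

Definition total_energy (T : R) (u : V -> \bar R) : \bar R :=
  (bdry_energy u + T%:E * shifted_entropy u)%E.

Lemma bdry_le_total T u : 0 <= T -> density u -> (bdry_energy u <= total_energy T u)%E.
Proof. by move=> T0 du; rewrite leeDl// mule_ge0 ?lee_fin// shifted_entropy_ge0. Qed.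

Lemma total_energy_lty T u : 0 <= T -> density u -> (bdry_energy u < +oo)%E ->
  (total_energy T u < +oo)%E.
Proof.
move=> T0 du Uu; rewrite lte_add_pinfty// lte_mul_pinfty// shifted_entropy_lty//.
Qed.

(* The upper bound [U1] on the boundary energy lets the same lemma select, at
   [T = 0], the entropy maximizer among the energy minimizers. *)
Lemma total_energy_minimizer (T : R) (U1 : \bar R) : 0 <= T ->
  (exists v, [/\ density v, (bdry_energy v <= U1)%E & (bdry_energy v < +oo)%E]) ->
  exists w, [/\ density w, (bdry_energy w <= U1)%E, (bdry_energy w < +oo)%E &
    forall v, density v -> (bdry_energy v <= U1)%E ->
      (total_energy T w <= total_energy T v)%E].
Proof.
move=> T0 [v0 [dv0 v0U v0f]].
pose A : set (V -> \bar R) := [set v | density v /\ (bdry_energy v <= U1)%E].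
pose S := [set total_energy T v | v in A].
have S0 : (0 <= ereal_inf S)%E.
  apply: le_ereal_inf_tmp => _ [v [dv _] <-].
  exact: le_trans (bdry_energy_ge0 dv) (bdry_le_total T0 dv).
have Sy : (ereal_inf S < +oo)%E.
  by apply: le_lt_trans (total_energy_lty T0 dv0 v0f); apply: ereal_inf_lbound; exists v0.
have Sf : ereal_inf S \is a fin_num by rewrite ge0_fin_numE.
pose m := fine (ereal_inf S).
have mE : ereal_inf S = m%:E by rewrite fineK.
have /choice[u hu] : forall j : nat, exists v, A v /\ (total_energy T v < (m + j.+1%:R^-1)%:E)%E.
  move=> j; have := @lb_ereal_inf_adherent R S j.+1%:R^-1.
  rewrite invr_gt0 ltr0n => /(_ isT Sf)[_ [v Av <-]]; rewrite mE => h.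
  by exists v.
have du j : density (u j) by have [[]] := hu j.
have hU j : (bdry_energy (u j) <= (m + 1)%:E)%E.
  apply: le_trans (bdry_le_total T0 (du j)) _; apply: le_trans (ltW (hu j).2) _.
  by rewrite lee_fin lerD2l invf_le1// ler1n.
have [phi [w [hphi dw Uw Sw]]] := density_energy_compactness du hU.
have wm : (total_energy T w <= m%:E)%E.
  rewrite leNgt; apply/negP.
  have TS0 : (0 <= T%:E * shifted_entropy w)%E by rewrite mule_ge0 ?lee_fin ?shifted_entropy_ge0.
  (* Splitting the strict inequality lets each term use its own lower semicontinuity. *)
  move=> /(lt_adde_split (bdry_energy_ge0 dw) TS0)[c [d [cU dS mcd]]].
  have [N1 hN1] := lt_limn_einf (lt_le_trans cU Uw).
  have [N2 hN2] : exists N, forall j, (N <= j)%N ->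
      (d%:E < T%:E * shifted_entropy (u (phi j)))%E.
    (* [T = 0] is treated apart because otherwise the bound is transferred after division by [T]. *)
    move: T0; rewrite le_eqVlt => /orP[/eqP T0|T0].
      exists 0%N => j _; move: dS; rewrite -T0 !mul0e//.
    have dS' : ((d / T)%:E < shifted_entropy w)%E.
      by move: dS; rewrite muleC -lte_pdivrMr.
    have [N hN] := lt_limn_einf (lt_le_trans dS' Sw).
    by exists N => j /hN; rewrite EFinM lte_pdivrMr// muleC.
  have [N3 _ hN3] : \forall j \near \oo, (j.+1%:R^-1 : R) < c + d - m.
    by apply: near_infty_natSinv_lt (PosNum _); rewrite subr_gt0.
  pose j := maxn N1 (maxn N2 N3).
  have h1 := hN1 j (leq_maxl _ _).
  have h2 := hN2 j (leq_trans (leq_maxl _ _) (leq_maxr _ _)).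
  have h3 := hN3 j (leq_trans (leq_maxr _ _) (leq_maxr _ _)).
  have := (hu (phi j)).2; apply/negP; rewrite -leNgt.
  apply: (@le_trans _ _ (c + d)%:E); last by rewrite EFinD ltW// lteD.
  rewrite lee_fin -lerBrDl (le_trans _ (ltW h3))// lef_pV2 ?posrE ?ltr0n//.
  by rewrite ler_nat ltnS.
exists w; split=> //.
- by apply: le_trans Uw _; apply: limn_einf_le => j; have [[]] := hu (phi j).
- by apply: le_lt_trans (bdry_le_total T0 dw) _; apply: le_lt_trans wm _; exact: ltry.
- move=> v dv vU; apply: le_trans wm _; rewrite -mE; apply: ereal_inf_lbound.
  by exists v.
Qed.

(** The constraint is convex, so the midpoint is admissible. The boundary energy is affine under
    midpoints, so minimality leaves [T] times the entropy inequality required by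
    [shifted_entropy_mid]. *)
Lemma total_energy_minimizer_unique (T : R) (U1 : \bar R) u w : 0 < T ->
  density u -> density w -> (bdry_energy u <= U1)%E -> (bdry_energy w <= U1)%E ->
  (bdry_energy u < +oo)%E -> (bdry_energy w < +oo)%E ->
  (forall v, density v -> (bdry_energy v <= U1)%E -> (total_energy T u <= total_energy T v)%E) ->
  (forall v, density v -> (bdry_energy v <= U1)%E -> (total_energy T w <= total_energy T v)%E) ->
  forall x, P x -> u x = w x.
Proof.
move=> T0 du dw uU wU uf wf hu hw.
have Su := shifted_entropy_lty du uf; have Sw := shifted_entropy_lty dw wf.
have h0 : (0 : R) <= 2^-1 by rewrite invr_ge0.
apply: shifted_entropy_mid => //.
have dm := density_mid du dw.
have Um := bdry_energy_mid du dw.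
have mf : (bdry_energy (midfun u w) < +oo)%E.
  by rewrite Um lte_mul_pinfty ?lee_fin// lte_add_pinfty.
have Ff v : density v -> (bdry_energy v < +oo)%E ->
    exists p q : R, bdry_energy v = p%:E /\ shifted_entropy v = q%:E.
  move=> dv vf; exists (fine (bdry_energy v)), (fine (shifted_entropy v)).
  by rewrite !fineK ?ge0_fin_numE ?bdry_energy_ge0 ?shifted_entropy_ge0 ?shifted_entropy_lty.
have mU : (bdry_energy (midfun u w) <= U1)%E.
  rewrite Um; move: uU wU.
  have [p [_ [-> _]]] := Ff u du uf; have [p' [_ [-> _]]] := Ff w dw wf.
  case: (U1) => [r| |]; rewrite ?leey//.
  rewrite -EFinD -EFinM !lee_fin; lra.
have Sm := shifted_entropy_lty dm mf.
have := hu _ dm mU; have := hw _ dm mU; rewrite /total_energy Um.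
have [p [q [-> ->]]] := Ff u du uf; have [p' [q' [-> ->]]] := Ff w dw wf.
have [_ [q'' [_ ->]]] := Ff _ dm mf.
rewrite -(EFinD p) -(EFinD q) -!EFinM -!EFinD !lee_fin => h1 h2.
rewrite -(ler_pM2l T0); lra.
Qed.

(** The competitor that makes the minimization problems nonvacuous: its boundary energy is
    [sigma (boundary P)], which is finite. *)
Lemma density_cst1 : density (cst 1%E).
Proof.
split=> //.
- by move=> x r Px r1; exists setT => //; exact: filterT.
- apply: logconvex_lin => // x y t _ _ _ rx ry [<-] [<-].
  by rewrite /= !powR1 mulr1.
- by rewrite integral_cst// mul1e.
Qed.

Lemma bdry_energy_cst1_lty : (bdry_energy (cst 1%E) < +oo)%E.
Proof. by rewrite /bdry_energy integral_cst// mul1e (sigma_boundary_lty fs bP hsigma). Qed.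

(** * Return to the classes [Mp] and to free energy and entropy *)

Lemma Mp_density (p : R) (u : V -> \bar R) :
  Mp mu P p u <-> density u /\ (\int[mu]_(x in P) (u x `^ p) < +oo)%E.
Proof.
split=> [[lu u0 cu iu pu]|[[lu u0 cu iu] pu]]; split=> //.
  by split=> //; exact: logconvex_lin.
exact: lin_logconvex_conv.
Qed.

Lemma Mp1_density (u : V -> \bar R) : Mp mu P 1 u <-> density u.
Proof.
split=> [/Mp_density[]//|du]; apply/Mp_density; split=> //.
have [_ _ _ iu] := du; apply: le_lt_trans (polytope_mu_lty hmu fs bP).
rewrite le_eqVlt; apply/orP; left; apply/eqP; rewrite -iu; apply: eq_integral => x.
by rewrite inE => Px; rewrite poweRe1//; exact: density_ge0 du Px.
Qed.

Let M0 : 0 < fine (mu P).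
Proof. by rewrite fine_gt0// (polytope_mu_gt0 hmu fs P0) (polytope_mu_lty hmu fs bP). Qed.

Let Mi0 : 0 < (fine (mu P))^-1.
Proof. by rewrite invr_gt0. Qed.

Lemma internal_energy_le u v :
  (internal_energy mu sigma P u <= internal_energy mu sigma P v)%E =
  (bdry_energy u <= bdry_energy v)%E.
Proof. by rewrite /internal_energy lee_pmul2l// lte_fin. Qed.

Lemma entropy_le u v : density u -> density v ->
  (entropy mu P u <= entropy mu P v)%E = (shifted_entropy v <= shifted_entropy u)%E.
Proof.
by move=> du dv; rewrite !entropyE// leeN2 lee_pmul2l ?lte_fin// leeBlDr// subeK.
Qed.

Lemma free_energyE (T : R) u : 0 < T -> density u ->
  free_energy mu sigma P T u =
  ((fine (mu P))^-1%:E * total_energy T u - T%:E)%E.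
Proof.
move=> T0 du; rewrite /free_energy entropyE// /internal_energy -/(bdry_energy u) /total_energy.
have := shifted_entropy_ge0 du; have := bdry_energy_ge0 du.
move: (fineK muPfin) Mi0 M0 => <-; rewrite /=; set M := fine _ => Mi M_gt0.
(* Infinite [shifted_entropy] corresponds to the branch where [free_energy] is set to [+oo]. *)
case: (shifted_entropy u) => [q| |]// U0 _; last first.
  rewrite addye// gt0_muley ?lte_fin//= gt0_muley ?lte_fin// addey.
    by rewrite gt0_muley ?lte_fin.
  by rewrite gt_eqF// (lt_le_trans _ U0).
rewrite -EFinB -EFinM -EFinN /=.
case: (bdry_energy u) U0 => [r| |]// _.
  rewrite -(EFinM T) -(EFinD r) -!EFinM -!EFinD; congr _%:E; field.
  by rewrite gt_eqF.
by rewrite gt0_muley ?lte_fin// addye// gt0_muley ?lte_fin// addye.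
Qed.

Lemma free_energy_le (T : R) u v : 0 < T -> density u -> density v ->
  (free_energy mu sigma P T u <= free_energy mu sigma P T v)%E =
  (total_energy T u <= total_energy T v)%E.
Proof. by move=> T0 du dv; rewrite !free_energyE// leeD2rE// lee_pmul2l// lte_fin. Qed.

Lemma canonical_density_positive (T : R) : 0 < T ->
  exists u, [/\ Mp mu P 1 u,
    (forall v, Mp mu P 1 v ->
      (free_energy mu sigma P T u <= free_energy mu sigma P T v)%E),
    Mp mu P (crit_exp R n) u &
    (forall w, Mp mu P 1 w ->
      (forall v, Mp mu P 1 v ->
        (free_energy mu sigma P T w <= free_energy mu sigma P T v)%E) ->
      forall x, P x -> w x = u x)].
Proof.
move=> T0; have [|u [du _ uf hu]] := @total_energy_minimizer T +oo%E (ltW T0).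
  by exists (cst 1%E); rewrite leey bdry_energy_cst1_lty; split=> //; exact: density_cst1.
exists u; split.
- exact/Mp1_density.
- by move=> v /Mp1_density dv; rewrite free_energy_le// hu// leey.
- by apply/Mp_density; split=> //; exact: density_powR_lty.
move=> w /Mp1_density dw hw.
have hw' v : density v -> (total_energy T w <= total_energy T v)%E.
  by move=> dv; rewrite -free_energy_le//; apply: hw; exact/Mp1_density.
apply: (@total_energy_minimizer_unique T +oo%E) => //; rewrite ?leey//; last by move=> v dv _; exact: hw'.
(* Any other minimizer has finite boundary energy because its total energy is at most that of
   [u]. *)
apply: le_lt_trans (bdry_le_total (ltW T0) dw) _; apply: le_lt_trans (hw' u du) _.
exact: total_energy_lty (ltW T0) du uf.
Qed.

Lemma canonical_density_zero :
  let canon0 (w : V -> \bar R) :=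
    [/\ Mp mu P 1 w,
        (forall v, Mp mu P 1 v ->
          (internal_energy mu sigma P w <= internal_energy mu sigma P v)%E) &
        (forall v, Mp mu P 1 v ->
          internal_energy mu sigma P v = internal_energy mu sigma P w ->
          (entropy mu P v <= entropy mu P w)%E)] in
  exists u, [/\ canon0 u, Mp mu P (crit_exp R n) u &
    forall w, canon0 w -> forall x, P x -> w x = u x].
Proof.
move=> canon0.
(* At [T = 0] the total energy is the boundary energy, and the bound [+oo] is no constraint, so the
   least boundary energy is attained. *)
have [|v0 [dv0 _ v0f hv0]] := @total_energy_minimizer 0 +oo%E (lexx 0).
  by exists (cst 1%E); rewrite leey bdry_energy_cst1_lty; split=> //; exact: density_cst1.
have {}hv0 v : density v -> (bdry_energy v0 <= bdry_energy v)%E.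
  by move=> /hv0; rewrite leey /total_energy !mul0e !adde0; exact.
have v0fin : bdry_energy v0 \is a fin_num by rewrite ge0_fin_numE// bdry_energy_ge0.
(* Under this bound the boundary energy is constant, so minimizing with [T = 1] maximizes the
   entropy; a positive [T] makes the uniqueness lemma applicable. *)
have [|u [du uU uf hu]] := @total_energy_minimizer 1 (bdry_energy v0) ler01.
  by exists v0.
have UE v : density v -> (bdry_energy v <= bdry_energy v0)%E -> bdry_energy v = bdry_energy v0.
  by move=> dv vU; apply/eqP; rewrite eq_le vU hv0.
have minS w : density w -> bdry_energy w = bdry_energy v0 ->
    ((forall v, density v -> (bdry_energy v <= bdry_energy v0)%E ->
      (total_energy 1 w <= total_energy 1 v)%E) <->
    (forall v, density v -> bdry_energy v = bdry_energy v0 ->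
      (shifted_entropy w <= shifted_entropy v)%E)).
  move=> dw wE; split=> h v dv vE.
    by have := h v dv; rewrite vE lexx /total_energy wE vE !mul1e leeD2lE//; exact.
  have {}vE := UE v dv vE.
  by rewrite /total_energy wE vE !mul1e leeD2lE// h.
have canonP w : canon0 w <-> [/\ density w, bdry_energy w = bdry_energy v0 &
    forall v, density v -> (bdry_energy v <= bdry_energy v0)%E ->
      (total_energy 1 w <= total_energy 1 v)%E].
  split=> [[/Mp1_density dw hU hS]|[dw wE h]].
    have wE : bdry_energy w = bdry_energy v0.
      by apply: UE => //; rewrite -internal_energy_le hU//; exact/Mp1_density.
    split=> //; apply/minS => // v dv vE; rewrite -entropy_le//; apply: hS.
      exact/Mp1_density.
    by rewrite /internal_energy -!/(bdry_energy _) vE wE.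
  split; first exact/Mp1_density.
  - by move=> v /Mp1_density dv; rewrite internal_energy_le wE hv0.
  move=> v /Mp1_density dv vE; rewrite entropy_le//; apply: ((minS w dw wE).1 h) => //.
  by apply: UE => //; rewrite -wE -internal_energy_le vE.
exists u; split.
- by apply/canonP; split=> //; exact: UE.
- by apply/Mp_density; split=> //; exact: density_powR_lty.
move=> w /canonP[dw wE hw].
apply: (@total_energy_minimizer_unique 1 (bdry_energy v0)) => //; rewrite ?wE//.
Qed.

End Minimization.

Theorem mainTheorem12 (R : realType) (n : nat) (hn : (2 <= n)%N)
  (P : set 'rV[R]_n) (mu sigma : {measure set BorelV R n -> \bar R})
  (hP : simple_polytope P) (hmu : lebesgue_like mu)
  (hsigma : facet_measure P sigma) :
  (forall T : R, 0 < T ->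
    exists u, [/\ Mp mu P 1 u,
      (forall v, Mp mu P 1 v ->
         (free_energy mu sigma P T u <= free_energy mu sigma P T v)%E),
      Mp mu P (n%:R / (n%:R - 1)) u &
      (forall w, Mp mu P 1 w ->
         (forall v, Mp mu P 1 v ->
            (free_energy mu sigma P T w <= free_energy mu sigma P T v)%E) ->
         forall x, P x -> w x = u x)])
  /\
  (let canon0 (w : 'rV[R]_n -> \bar R) :=
     [/\ Mp mu P 1 w,
         (forall v, Mp mu P 1 v ->
            (internal_energy mu sigma P w <= internal_energy mu sigma P v)%E) &
         (forall v, Mp mu P 1 v ->
            internal_energy mu sigma P v = internal_energy mu sigma P w ->
            (entropy mu P v <= entropy mu P w)%E)] in
   exists u, [/\ canon0 u, Mp mu P (n%:R / (n%:R - 1)) u &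
     forall w, canon0 w -> forall x, P x -> w x = u x]).
Proof.
have [hpoly cP P0 _] := hP.
have bP : bounded_set P by exact: compact_bounded.
have [I [a [b fs]]] := facet_system_exists hpoly P0.
split; first exact: (canonical_density_positive hn hmu hsigma fs bP P0).
exact: (canonical_density_zero hn hmu hsigma fs bP P0).
Qed.
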